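(* Let $\boldsymbol\beta_2=(\beta_0,\beta_1,\beta_2)$ with $\beta_k\ge0$, $f\in\mathcal{C}^{3,\boldsymbol\beta_2}_{loc}(V^2;V)$, and let $\mathbf{X}=(X,\mathbb{X})$ be a $V$-valued (linear) $\alpha$-Hölder rough path on $[0,T]$. Let $W(t,x)=f(X_t,x)$, $g(t,y)=D_2f(X_t,y)$, $g_{s,t}(y)=g(t,y)-g(s,y)$, and $$\mathbb{W}_{s,t}(x,y)=\int_s^tD_{21}f(X_r,y)f(X_r,x)\,d\mathbf{X}_r+\frac12\int_s^tD_{211}f(X_r,y)f(X_r,x)\,d\langle X\rangle_r-g_{s,t}(y)(f(X_s,x)),$$ so that $(W,\mathbb{W})$ is a nonlinear rough path in $\mathbf{C}^{\alpha,\boldsymbol\beta_2}([0,T]\times V;V)$. Let $(Y,\dot Y)\in\mathcal{E}^{2\alpha}_W$. Then, with $Y'=D_1f(X,\dot Y)$, one has $(Y,Y')\in\mathcal{D}^{2\alpha}_X(V)$, and for all $0\le s\le t\le T$ $$\int_s^tW(dr,Y_r)=\int_s^tD_1f(X_r,Y_r)\,d\mathbf{X}_r+\frac12\int_s^tD_{11}f(X_r,Y_r)\,d\langle X\rangle_r,$$ where the left-hand side is the nonlinear rough integral, the first integral on the right is the linear rough integral, and the last integral is a Young integral.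
   Context: Fix $T>0$, $\alpha\in(\frac13,\frac12]$ and a separable Banach space $V$; $\Phi_{s,t}:=\Phi_t-\Phi_s$ for functions of time; tensor products carry the projective norm. Linear rough paths: $\mathbf{X}=(X,\mathbb{X})$ with $X:[0,T]\to V$ $\alpha$-Hölder, $\mathbb{X}:[0,T]^2\to V\otimes V$ with $\sup_{s\ne t}\|\mathbb{X}_{s,t}\|/|t-s|^{2\alpha}<\infty$, and $\mathbb{X}_{s,t}-\mathbb{X}_{s,u}-\mathbb{X}_{u,t}=X_{s,u}\otimes X_{u,t}$. $\langle X\rangle_{s,t}=X_{s,t}\otimes X_{s,t}-2\mathbb{X}_{s,t}$. For a Banach space $K$, $\mathcal{D}_X^{2\alpha}(K)$ is the set of pairs $(Y,Y')$ of $\alpha$-Hölder paths $Y:[0,T]\to K$, $Y':[0,T]\to\mathcal{L}(V;K)$ with $\sup_{s\ne t}\|Y_{s,t}-Y'_sX_{s,t}\|_K/|t-s|^{2\alpha}<\infty$. For $(H,H')\in\mathcal{D}_X^{2\alpha}(\mathcal{L}(V;V))$ (with $H'_t(v\otimes w)=(H'_tv)(w)$), $\int_s^tH_rd\mathbf{X}_r=\lim_{|\pi|\to0}\sum_k[H_{t_{k-1}}X_{t_{k-1},t_k}+H'_{t_{k-1}}\mathbb{X}_{t_{k-1},t_k}]$ over partitions $\pi$ of $[s,t]$. Young integrals $\int_s^tA_rd\langle X\rangle_r$ (with $A$ $\alpha$-Hölder with values in symmetric bilinear maps $V\times V\to V$, extended to $V\otimes V$) are $\lim_{|\pi|\to0}\sum_kA_{t_{k-1}}\langle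 X\rangle_{t_{k-1},t_k}$. $\mathcal{C}^{m,\boldsymbol\beta_n}_{loc}(V^2;V)$: functions $f:V^2\to V$ with (continuous) mixed partial Fréchet derivatives such that for every compact $K\subset V$, $\sum_{j=0}^m\sum_{k=0}^n\sup_{x\in K,\,y\in V}\|D_2^kD_1^jf(x,y)\|(1+\|y\|_V)^{-\beta_k}<\infty$, where $D_1,D_2$ are the partial derivatives in the first and second argument. $D_{21}f(z,y)f(z,x)\in\mathcal{L}(V;V)$ is the operator $h^{x,y}(z)$ obtained from the mixed derivative of $f$ at $(z,y)$ by inserting $f(z,x)$ in the second-variable direction and leaving the first-variable direction free; the rough integral of $r\mapsto h^{x,y}(X_r)$ is taken with Gubinelli derivative $Dh^{x,y}(X_r)$ ($D$ = derivative in $z$). $D_{211}f(z,y)f(z,x)$ is the symmetric bilinear map given by the derivative of $f$ at $(z,y)$, once in the second variable in direction $f(z,x)$ and twice in the first variable. The path $D_1f(X,Y)$ is controlled by $X$ with Gubinelli derivative sending $v\in V$ to the operator $w\mapsto D_{11}f(X_t,Y_t)(v,w)+D_{12}f(X_t,Y_t)(w,Y'_tv)$, where in $D_{12}f(w,a)$ the vector $w$ is the direction in the first variable and $a$ in the second. Nonlinear rough paths: $\mathcal{C}^{\alpha,\boldsymbol\beta_n}([0,T]\times V;V)$ is the space of $\Phi$, $n$ times continuously Fréchet differentiable in space, with $\sum_{k=0}^n\sup_{s\ne t,x}\|D^k\Phi_{s,t}(x)\|\,|t-s|^{-\alpha}(1+\|x\|_V)^{-\beta_k}<\infty$. $\mathcal{C}_2^{2\alpha,\boldsymbol\beta^1,\boldsymbol\beta^2}([0,T]^2\times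 V^2;V)$ (multi-indices of length $m+1$) is the space of $\Psi$, $m$ times continuously Fréchet differentiable in $(x_1,x_2)$, with $\sum_{k=0}^m\sup_{s\ne t,x_1,x_2}\|D^k\Psi_{s,t}(x_1,x_2)\|\,|t-s|^{-2\alpha}(1+\|x_1\|_V)^{-\beta^1_k}(1+\|x_2\|_V)^{-\beta^2_k}<\infty$. $\mathbf{C}^{\alpha,\boldsymbol\beta_2}([0,T]\times V;V)$ is the set of pairs $(W,\mathbb{W})$ with $W\in\mathcal{C}^{\alpha,\boldsymbol\beta_2}$, $\mathbb{W}\in\mathcal{C}_2^{2\alpha,\boldsymbol\beta^*_1,\boldsymbol\beta^{**}_1}$, $\boldsymbol\beta^*_1=(\beta_0,\max\{\beta_0,\beta_1\})$, $\boldsymbol\beta^{**}_1=(\beta_1,\max\{\beta_1,\beta_2\})$, and $\mathbb{W}_{s,t}(x,y)-\mathbb{W}_{s,u}(x,y)-\mathbb{W}_{u,t}(x,y)=DW_{u,t}(y)(W_{s,u}(x))$. $\mathcal{E}^{2\alpha}_W$ is the set of pairs $(Y,\dot Y)$ of $\alpha$-Hölder paths $[0,T]\to V$ with $\sup_{s\ne t}\|Y_{s,t}-W_{s,t}(\dot Y_s)\|_V/|t-s|^{2\alpha}<\infty$. The nonlinear rough integral is $\int_s^tW(dr,Y_r)=\lim_{|\pi|\to0}\sum_k[W_{t_{k-1},t_k}(Y_{t_{k-1}})+\mathbb{W}_{t_{k-1},t_k}(\dot Y_{t_{k-1}},Y_{t_{k-1}})]$. *)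

(* Defs.v *)
From HB Require Import structures.
From mathcomp Require Import all_boot all_order all_algebra.
From mathcomp Require Import all_classical all_reals all_analysis.
Import Order.TTheory GRing.Theory Num.Theory.
Import numFieldNormedType.Exports.

Set Implicit Arguments.
Unset Strict Implicit.
Unset Printing Implicit Defensive.

Local Open Scope classical_set_scope.
Local Open Scope ring_scope.

Section Operators.
Context {R : realType} (U K : normedModType R).

Definition is_oper : {pred U -> K} := [pred f | `[< linear f /\ continuous f >]].

Lemma is_operP (f : U -> K) : reflect (linear f /\ continuous f) (f \in is_oper).
Proof. exact: asboolP. Qed.

Fact is_oper_submod : submod_closed is_oper.
Proof.
split=> [|a f g /is_operP [lf cf] /is_operP [lg cg]]; apply/is_operP; split.
- by move=> a x y; rewrite /= scaler0 addr0.
- exact: cst_continuous.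
- move=> b x y /=; rewrite !fctE lf lg !scalerDr !scalerA (mulrC a b) !addrA.
  by congr (_ + _); rewrite -!addrA; congr (_ + _); rewrite addrC.
- move=> x; apply: (@continuousD _ _ _ (a \*: f) g); last exact: cg.
  by apply: continuousZl_tmp; exact: cf.
Qed.

HB.instance Definition _ :=
  GRing.isSubmodClosed.Build R (U -> K) is_oper is_oper_submod.

Record oper := Oper { oper_fun :> U -> K ; oper_subproof : oper_fun \in is_oper }.

HB.instance Definition _ := [isSub for oper_fun].
HB.instance Definition _ := gen_eqMixin oper.
HB.instance Definition _ := gen_choiceMixin oper.
HB.instance Definition _ := [SubChoice_isSubLmodule of oper by <:].

Definition opnorm (f : oper) : R := sup [set `|f x| | x in [set x | `|x| <= 1]].

Lemma oper_linear (f : oper) : linear f.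
Proof. by case: f => f /= /is_operP []. Qed.

Lemma oper_continuous (f : oper) : continuous f.
Proof. by case: f => f /= /is_operP []. Qed.

Lemma oper0 (f : oper) : f 0 = 0.
Proof. by have := oper_linear f (-1) 0 0; rewrite scaler0 addr0 scaleN1r addNr. Qed.

Lemma operZ (f : oper) a x : f (a *: x) = a *: f x.
Proof. by have := oper_linear f a x 0; rewrite !addr0 oper0 addr0. Qed.

Lemma opnorm_has_sup (f : oper) :
  has_sup [set `|f x| | x in [set x | `|x| <= 1]].
Proof.
split; first by exists `|f 0|, 0 => //=; rewrite normr0 ler01.
have /cvgrPdist_lt/(_ 1 ltr01) := @oper_continuous f 0.
rewrite oper0 => /nbhs_normP[e /= e0 He].
have e2 : 0 < e / 2 by rewrite divr_gt0.
exists (e / 2)^-1 => _ [x /= x1 <-].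
suff : `|f ((e / 2) *: x)| <= 1.
  by rewrite operZ normrZ gtr0_norm// -ler_pdivlMl// mulr1.
apply/ltW; rewrite -normrN -sub0r; apply: He => /=.
rewrite sub0r normrN normrZ gtr0_norm//.
rewrite (@le_lt_trans _ _ (e / 2))// ?ler_piMr// ?ltW//.
by rewrite ltr_pdivrMr// ltr_pMr// ltr1n.
Qed.

Lemma opnorm_ub (f : oper) x : `|x| <= 1 -> `|f x| <= opnorm f.
Proof.
by move=> x1; apply: (sup_upper_bound (opnorm_has_sup f)); exists x.
Qed.

Lemma opnorm_le (f : oper) M :
  (forall x, `|x| <= 1 -> `|f x| <= M) -> opnorm f <= M.
Proof.
move=> fM; apply: ge_sup; first by case: (opnorm_has_sup f).
by move=> _ [x /= /fM ? <-].
Qed.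

Fact ler_opnormD f g : opnorm (f + g) <= opnorm f + opnorm g.
Proof.
apply: opnorm_le => x x1.
by apply: (le_trans (ler_normD (f x) (g x))); rewrite lerD// opnorm_ub.
Qed.

Fact ler_opnormZ a f : opnorm (a *: f) <= `|a| * opnorm f.
Proof.
apply: opnorm_le => x x1; rewrite -[(a *: f) x]/(a *: f x) normrZ.
by rewrite ler_wpM2l// opnorm_ub.
Qed.

Fact opnormZ a f : opnorm (a *: f) = `|a| * opnorm f.
Proof.
apply/eqP; rewrite eq_le ler_opnormZ /=.
have [->|a0] := eqVneq a 0.
  rewrite normr0 mul0r (le_trans _ (@opnorm_ub _ 0 _))//.
  by rewrite normr0 ler01.
rewrite -ler_pdivlMl ?normr_gt0// -normfV.
by apply: le_trans (ler_opnormZ _ _); rewrite scalerA mulVf// scale1r.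
Qed.

Fact opnorm0_eq0 f : opnorm f = 0 -> f = 0.
Proof.
move=> f0; apply/val_inj/funext => x /=.
have [->|x0] := eqVneq x 0; first exact: oper0.
have nx : `|(`|x|^-1 *: x)| <= 1 by rewrite normrZV// unitfE normr_eq0.
have := opnorm_ub f nx.
rewrite f0 normr_le0 operZ scaler_eq0 invr_eq0 normr_eq0 (negPf x0) /=.
by move=> /eqP.
Qed.

HB.instance Definition _ :=
  @Lmodule_isNormed.Build R oper opnorm ler_opnormD opnormZ opnorm0_eq0.

End Operators.

Arguments is_oper {R} U K.
Arguments oper {R} U K.

Notation "''L' ( U , K )" := (oper U K)
  (at level 8, format "''L' ( U ,  K )") : type_scope.

Section Composition.
Context {R : realType} {U V K : normedModType R}.

Fact oper_comp_subproof (A : 'L(V, K)) (B : 'L(U, V)) :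
  (fun u => A (B u)) \in is_oper U K.
Proof.
apply/is_operP; split=> [a x y|x]; first by rewrite !oper_linear.
by apply: continuous_comp; exact: oper_continuous.
Qed.

Definition oper_comp (A : 'L(V, K)) (B : 'L(U, V)) : 'L(U, K) :=
  Oper (oper_comp_subproof A B).

End Composition.

Section Derivatives.
Context {R : realType}.
Implicit Types (U V K : normedModType R).

(* Meaningful where [f] is differentiable ([insubd] then returns ['d f x]). *)
Definition frechet {U K} (f : U -> K) (x : U) : 'L(U, K) :=
  insubd (0 : 'L(U, K)) ('d f x : U -> K).

(* [opers n U K] is L(U; L(U; ... L(U; K))); the iterated operator norm is the
   usual norm of n-linear maps. *)
Fixpoint opers (n : nat) (U K : normedModType R) : normedModType R :=
  if n is m.+1 then 'L(U, opers m U K) else K.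

Fixpoint Dn {U K} (n : nat) (f : U -> K) : U -> opers n U K :=
  if n is m.+1 then frechet (Dn m f) else f.

Definition Cn {U K} (n : nat) (f : U -> K) : Prop :=
  (forall k x, (k < n)%N -> differentiable (Dn k f) x) /\
  (forall k, (k <= n)%N -> continuous (Dn k f)).

(* In [D1 g z y v] and [D2 g z y a] the first argument after the point is the
   direction of the derivative taken last; e.g. in [D2 (D1 f) z y a w] the
   vector [a] is the direction in the second variable, [w] in the first. *)
Definition D1 {U V K} (f : U -> V -> K) (x : U) (y : V) : 'L(U, K) :=
  frechet (fun z => f z y) x.

Definition D2 {U V K} (f : U -> V -> K) (x : U) (y : V) : 'L(V, K) :=
  frechet (f x) y.

Fixpoint D1n {U V K} (j : nat) (f : U -> V -> K) : U -> V -> opers j U K :=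
  if j is i.+1 then D1 (D1n i f) else f.

Fixpoint D2n {U V K} (k : nat) (f : U -> V -> K) : U -> V -> opers k V K :=
  if k is i.+1 then D2 (D2n i f) else f.

Definition C_loc {V} (m n : nat) (beta : 'I_n.+1 -> R) (f : V -> V -> V) : Prop :=
  [/\ forall j x y, (j < m)%N -> differentiable (fun z => D1n j f z y) x,
      forall j k x y, (j <= m)%N -> (k < n)%N ->
        differentiable (D2n k (D1n j f) x) y,
      forall j k, (j <= m)%N -> (k <= n)%N ->
        continuous (fun p : V * V => D2n k (D1n j f) p.1 p.2)
    & forall A : set V, compact A ->
        (\sum_(j < m.+1) \sum_(k < n.+1)
           ereal_sup [set (`|D2n k (D1n j f) p.1 p.2|
                            * (1 + `|p.2|) `^ (- beta k))%:E
                     | p in A `*` setT] < +oo)%E].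

Definition separable (V : normedModType R) : Prop :=
  exists2 S : set V, countable S & dense S.

End Derivatives.

Section Tensor.
Context {R : realType}.

(* A formal sum [:: (v1, w1); ...] stands for v1 (x) w1 + ... ; two of them
   represent the same element of the algebraic tensor product iff no bilinear
   map distinguishes them. *)
Definition eq_tens {V : normedModType R} (s s' : seq (V * V)) : Prop :=
  forall (E : lmodType R) (b : V -> V -> E),
    (forall v, linear (b v)) -> (forall w, linear (b ^~ w)) ->
    \sum_(p <- s) b p.1 p.2 = \sum_(p <- s') b p.1 p.2.

Definition proj_norm {V : normedModType R} (s : seq (V * V)) : R :=
  inf [set \sum_(p <- s') `|p.1| * `|p.2| | s' in [set s' | eq_tens s s']].

(* A completion of the algebraic tensor product of [V] with itself for the
   projective norm, which is unique up to isometric isomorphism. *)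
Record proj_tensor (V : normedModType R) := ProjTensor {
  tens_space :> completeNormedModType R ;
  tens : V -> V -> tens_space ;
  tens_linear_r : forall v, linear (tens v) ;
  tens_linear_l : forall w, linear (tens ^~ w) ;
  tens_norm : forall s : seq (V * V),
    `|\sum_(p <- s) tens p.1 p.2| = proj_norm s ;
  tens_dense : dense (range (fun s : seq (V * V) =>
    \sum_(p <- s) tens p.1 p.2)) }.

(* The extension of a bounded bilinear map to the tensor product, i.e. the
   unique bounded operator sending v (x) w to [B v w]. *)
Definition tens_lift {V K : normedModType R} (VV : proj_tensor V)
    (B : 'L(V, 'L(V, K))) : 'L(VV, K) :=
  xget (0 : 'L(VV, K)) [set L : 'L(VV, K) | forall v w, L (tens VV v w) = B v w].

End Tensor.

Arguments tens {R V} _ _ _.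

Section RiemannSums.
Context {R : realType} {K : normedModType R}.
Implicit Types (Xi : R -> R -> K) (s t : R) (p : seq R).

(* A partition [s = t_0 < t_1 < ... < t_n = t] is the sequence
   [:: t_1; ...; t_n]. *)
Definition mesh s p : R :=
  \big[Num.max/0]_(u <- zip (s :: p) p) (u.2 - u.1).

Definition mesh_filter s t : set_system (seq R) :=
  filter_from [set d : R | 0 < d]
    (fun d => [set p | itv_partition s t p /\ mesh s p < d]).

Definition riemann_sum Xi s p : K :=
  \sum_(u <- zip (s :: p) p) Xi u.1 u.2.

Definition integral_exists Xi s t : Prop :=
  cvg (riemann_sum Xi s p @[p --> mesh_filter s t]).

(* Oriented: the integral from s to t is minus the one from t to s if t < s. *)
Definition germ_integral Xi s t : K :=
  if s <= t then lim (riemann_sum Xi s p @[p --> mesh_filter s t])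
  else - lim (riemann_sum Xi t p @[p --> mesh_filter t s]).

End RiemannSums.

Section LinearRoughPaths.
Context {R : realType}.
Implicit Types (V K : normedModType R).

Definition time_pairs (T : R) : set (R * R) :=
  [set u | [/\ 0 <= u.1 <= T, 0 <= u.2 <= T & u.1 != u.2]].

Definition time_norm {K} (a T : R) (Xi : R -> R -> K) : \bar R :=
  ereal_sup [set (`|Xi u.1 u.2| / `|u.2 - u.1| `^ a)%:E | u in time_pairs T].

Definition time_bounded {K} (a T : R) (Xi : R -> R -> K) : Prop :=
  (time_norm a T Xi < +oo)%E.

Definition holder {K} (a T : R) (Y : R -> K) : Prop :=
  time_bounded a T (fun s t => Y t - Y s).

Definition rough_path {V} (a T : R) (VV : proj_tensor V)
    (X : R -> V) (XX : R -> R -> VV) : Prop :=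
  [/\ holder a T X, time_bounded (2 * a) T XX
    & forall s u t, 0 <= s <= T -> 0 <= u <= T -> 0 <= t <= T ->
        XX s t - XX s u - XX u t = tens VV (X u - X s) (X t - X u)].

Definition bracket {V} (VV : proj_tensor V) (X : R -> V) (XX : R -> R -> VV)
    (s t : R) : VV :=
  tens VV (X t - X s) (X t - X s) - 2 *: XX s t.

Definition controlled {V K} (a T : R) (X : R -> V)
    (Y : R -> K) (Y' : R -> 'L(V, K)) : Prop :=
  [/\ holder a T Y, holder a T Y'
    & time_bounded (2 * a) T
        (fun s t => (Y t - Y s) - Y' s (X t - X s))].

Definition rough_germ {V K} (VV : proj_tensor V) (X : R -> V)
    (XX : R -> R -> VV) (H : R -> 'L(V, K)) (H' : R -> 'L(V, 'L(V, K)))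
    (s t : R) : K :=
  H s (X t - X s) + tens_lift VV (H' s) (XX s t).

Definition young_germ {V K} (VV : proj_tensor V) (X : R -> V)
    (XX : R -> R -> VV) (A : R -> 'L(V, 'L(V, K))) (s t : R) : K :=
  tens_lift VV (A s) (bracket X XX s t).

End LinearRoughPaths.

Section NonlinearRoughPaths.
Context {R : realType} {V : normedModType R}.
Implicit Types (W : R -> V -> V) (WW : R -> R -> V -> V -> V).

Definition C_space (a T : R) (n : nat) (beta : 'I_n.+1 -> R) W : Prop :=
  (forall t, 0 <= t <= T -> Cn n (W t)) /\
  (\sum_(k < n.+1)
     ereal_sup [set (`|Dn k (fun z => W u.1.2 z - W u.1.1 z) u.2|
                      * `|u.1.2 - u.1.1| `^ (- a)
                      * (1 + `|u.2|) `^ (- beta k))%:E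
               | u in time_pairs T `*` setT] < +oo)%E.

(* C_2^{a, beta1, beta2}, with time exponent [a] *)
Definition C2_space (a T : R) (m : nat) (beta1 beta2 : 'I_m.+1 -> R) WW : Prop :=
  (forall s t, 0 <= s <= T -> 0 <= t <= T ->
     Cn m (fun p : V * V => WW s t p.1 p.2)) /\
  (\sum_(k < m.+1)
     ereal_sup [set (`|Dn k (fun p : V * V => WW u.1.1 u.1.2 p.1 p.2) u.2|
                      * `|u.1.2 - u.1.1| `^ (- a)
                      * (1 + `|u.2.1|) `^ (- beta1 k)
                      * (1 + `|u.2.2|) `^ (- beta2 k))%:E
               | u in time_pairs T `*` setT] < +oo)%E.

Definition beta_star (beta : 'I_3 -> R) (k : 'I_2) : R :=
  if k == 0 then beta 0 else Num.max (beta 0) (beta 1).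

Definition beta_star2 (beta : 'I_3 -> R) (k : 'I_2) : R :=
  if k == 0 then beta 1 else Num.max (beta 1) (beta 2).

Definition nonlinear_rough_path (a T : R) (beta : 'I_3 -> R) W WW : Prop :=
  [/\ C_space a T beta W,
      C2_space (2 * a) T (beta_star beta) (beta_star2 beta) WW
    & forall s u t x y, 0 <= s <= T -> 0 <= u <= T -> 0 <= t <= T ->
        WW s t x y - WW s u x y - WW u t x y
        = frechet (fun z => W t z - W u z) y (W u x - W s x)].

(* the set E_W^{2a}; [Yd] is the path written Y with a dot *)
Definition nl_controlled (a T : R) W (Y Yd : R -> V) : Prop :=
  [/\ holder a T Y, holder a T Yd
    & time_bounded (2 * a) T
        (fun s t => (Y t - Y s) - (W t (Yd s) - W s (Yd s)))].

Definition nl_germ W WW (Y Yd : R -> V) (s t : R) : V :=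
  (W t (Y s) - W s (Y s)) + WW s t (Yd s) (Y s).

End NonlinearRoughPaths.

Section Lift.
Context {R : realType} {V : normedModType R} (VV : proj_tensor V).
Variables (f : V -> V -> V) (X : R -> V) (XX : R -> R -> VV).

Definition W_of (t : R) (x : V) : V := f (X t) x.

Definition h_of (x y z : V) : 'L(V, V) := D2 (D1 f) z y (f z x).

Definition WW_rough_germ (x y : V) : R -> R -> V :=
  rough_germ X XX (fun r => h_of x y (X r)) (fun r => frechet (h_of x y) (X r)).

Definition WW_young_germ (x y : V) : R -> R -> V :=
  young_germ X XX (fun r => D2 (D1 (D1 f)) (X r) y (f (X r) x)).

Definition WW_of (s t : R) (x y : V) : V :=
  germ_integral (WW_rough_germ x y) s t
  + 2^-1 *: germ_integral (WW_young_germ x y) s t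
  - (D2 f (X t) y - D2 f (X s) y) (f (X s) x).

End Lift.

(* Main.v *)
Require Import Defs.
From HB Require Import structures.
From mathcomp Require Import all_boot all_order all_algebra.
From mathcomp Require Import all_classical all_reals all_analysis.
From mathcomp Require Import ring lra.
Import Order.TTheory GRing.Theory Num.Theory.
Import numFieldNormedType.Exports.

Set Implicit Arguments.
Unset Strict Implicit.
Unset Printing Implicit Defensive.

Local Open Scope classical_set_scope.
Local Open Scope ring_scope.

(** Every integral of the statement is a limit of Riemann sums of a germ
   [Xi s t], and two germs which differ by [O((t - s) `^ (3 * alpha))] have the
   same integral, because [3 * alpha > 1] ([sews_equiv]).  A germ whose defect
   of additivity is of that order has an integral, which it approximates to the
   same order: this is the sewing lemma ([sewing_exists], [sewing_bound]).  The
   rough and the Young germs are such germs ([rough_germ_almost_additive],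
   [young_germ_almost_additive]); for the latter the symmetry of the integrand
   is essential, since the bracket is additive only up to antisymmetric tensors.

   The second level of the lift.  A Taylor expansion of [D2 f] in its first
   variable shows that the two integrals in the definition of [WW] add up to the
   rough integral of the controlled path [f(X, x)] against the controlled path
   [D2 f(X, y)], so that [WW s t x y] is the iterated integral of these two
   paths ([WW_of_iter]).  It is therefore bilinear and bounded, of order
   [2 * alpha], in the pair of controlled paths.  The controlled path [f(X, x)]
   is a C1 function of [x], and [D2 f(X, y)] one of [y], for the norm of
   controlled paths ([value_path_family], [slope_path_family]): the remainders
   are small uniformly over a compact set containing the segments between the
   points of [X].  The Leibniz rule ([bilinear_has_frechet]) then yields the
   differentiability and the growth of [WW] in [(x, y)], and the additivity of
   integrals yields its Chen relation.

   The formula.  Expanding [f(., Y s)] to second order at [X s] and replacing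
   [WW s t] by its local approximation
   [D2 D1 f(X s, Y s) (D1 f(X s, Yd s)) (XX s t)], the germ of the nonlinear
   integral becomes, up to [O((t - s) `^ (3 * alpha))],
   [D1 f X_st + (1/2) D11 f (X_st (x) X_st) + D2 D1 f Y' XX_st],
   with the derivatives of [f] taken at [(X s, Y s)].
   Writing [X_st (x) X_st = <X>_st + 2 XX_st] this is the germ of the rough
   integral plus half of the germ of the Young integral ([nl_germ_formula]). *)

(** * Identities in modules *)

Section ModuleIdentities.
Context {R : realType} {V : lmodType R}.

Inductive mexp :=
  | MVar of nat | MZero | MAdd of mexp & mexp | MOpp of mexp
  | MScale of R & mexp.

Fixpoint meval (env : seq V) e : V :=
  match e with
  | MVar i => nth 0 env i
  | MZero => 0
  | MAdd a b => meval env a + meval env b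
  | MOpp a => - meval env a
  | MScale k a => k *: meval env a
  end.

Fixpoint mcoef e (i : nat) : R :=
  match e with
  | MVar j => if Nat.eqb i j then 1 else 0
  | MZero => 0
  | MAdd a b => mcoef a i + mcoef b i
  | MOpp a => - mcoef a i
  | MScale k a => k * mcoef a i
  end.

Fixpoint same_coef n a b : Prop :=
  if n is m.+1 then mcoef a m = mcoef b m /\ same_coef m a b else True.

Lemma meval_coef env e :
  meval env e = \sum_(i < size env) mcoef e i *: nth 0 env i.
Proof.
elim: e => [j||a IHa b IHb|a IHa|k a IHa] /=.
- have [jn|jn] := ltnP j (size env).
    rewrite (bigD1 (Ordinal jn))//= PeanoNat.Nat.eqb_refl scale1r big1 ?addr0//.
    move=> i /eqP ij; case: PeanoNat.Nat.eqb_spec => [E|]; last by rewrite scale0r.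
    by case: ij; exact: val_inj.
  rewrite nth_default// big1// => i _; case: PeanoNat.Nat.eqb_spec.
    by move=> E; move: (ltn_ord i); rewrite E ltnNge jn.
  by rewrite scale0r.
- by rewrite big1// => i _; rewrite scale0r.
- by rewrite IHa IHb -big_split/=; apply: eq_bigr => i _; rewrite scalerDl.
- by rewrite IHa -sumrN; apply: eq_bigr => i _; rewrite scaleNr.
- by rewrite IHa scaler_sumr; apply: eq_bigr => i _; rewrite scalerA.
Qed.

(** This reduces an identity between vectors to ring identities between their
   scalar coefficients, one for each atom. *)
Lemma same_coef_meval env a b :
  same_coef (size env) a b -> meval env a = meval env b.
Proof.
rewrite !meval_coef; elim: (size env) => [|n IH] /=; first by rewrite !big_ord0.
by move=> [ab /IH Eab]; rewrite !big_ord_recr/= ab Eab.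
Qed.

End ModuleIdentities.

(* Atoms are compared up to unification: the same vector may occur with
   different but convertible structures on its type. *)
Ltac mod_index x env :=
  match env with
  | ?y :: _ => let _ := match constr:(O) with _ => unify x y end in constr:(O)
  | _ :: ?e => let n := mod_index x e in constr:(S n)
  end.

Ltac mod_add x env :=
  match env with
  | _ => let _ := mod_index x env in env
  | _ => constr:(x :: env)
  end.

Ltac mod_atoms e env :=
  lazymatch e with
  | ?a + ?b => let env := mod_atoms a env in mod_atoms b env
  | - ?a => mod_atoms a env
  | ?k *: ?a => mod_atoms a env
  | 0 => env
  | _ => mod_add e env
  end.

Ltac mod_quote R e env :=
  lazymatch e with
  | ?a + ?b =>
      let a := mod_quote R a env in let b := mod_quote R b env in
      constr:(MAdd a b)
  | - ?a => let a := mod_quote R a env in constr:(MOpp a)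
  | ?k *: ?a => let a := mod_quote R a env in constr:(MScale k a)
  | 0 => constr:(@MZero R)
  | _ => let n := mod_index e env in constr:(@MVar R n)
  end.

Ltac module_eq :=
  lazymatch goal with
  | |- @eq ?T ?a ?b =>
    let nil := constr:(@nil T) in
    let env := mod_atoms a nil in let env := mod_atoms b env in
    let R := lazymatch goal with R0 : realType |- _ => R0 end in
    let a' := mod_quote R a env in let b' := mod_quote R b env in
    refine (@same_coef_meval R _ env a' b' _);
    cbn [same_coef mcoef size Nat.eqb]; repeat split; first [ring | field]
  end.

(** * Bounded operators and Frechet derivatives *)

Section OperatorCalculus.
Context {R : realType}.
Implicit Types (U V K : normedModType R).

Lemma oper_addE {U K} (f g : 'L(U, K)) x : (f + g) x = f x + g x.
Proof. by []. Qed.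

Lemma oper_subE {U K} (f g : 'L(U, K)) x : (f - g) x = f x - g x.
Proof. by []. Qed.

Lemma oper_scaleE {U K} a (f : 'L(U, K)) x : (a *: f) x = a *: f x.
Proof. by []. Qed.

Lemma oper_zeroE {U K} x : (0 : 'L(U, K)) x = 0.
Proof. by []. Qed.

Lemma operD {U K} (f : 'L(U, K)) x y : f (x + y) = f x + f y.
Proof. by rewrite -[x]scale1r oper_linear !scale1r. Qed.

Lemma operN {U K} (f : 'L(U, K)) x : f (- x) = - f x.
Proof. by rewrite -scaleN1r operZ scaleN1r. Qed.

Lemma operB {U K} (f : 'L(U, K)) x y : f (x - y) = f x - f y.
Proof. by rewrite operD operN. Qed.

Lemma oper_eqP {U K} (f g : 'L(U, K)) : (forall x, f x = g x) -> f = g.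
Proof. by move=> fg; apply/val_inj/funext. Qed.

Lemma oper_norm_le {U K} (f : 'L(U, K)) x : `|f x| <= `|f| * `|x|.
Proof.
have [->|x0] := eqVneq x 0; first by rewrite oper0 !normr0 mulr0.
have nx : 0 < `|x| by rewrite normr_gt0.
rewrite -ler_pdivrMr// mulrC -[`|x|^-1]gtr0_norm ?invr_gt0// -normrZ -operZ.
by apply: opnorm_ub; rewrite normrZV// unitfE normr_eq0.
Qed.

Lemma oper_norm_leM {U K} (f : 'L(U, K)) x M N :
  `|f| <= M -> `|x| <= N -> `|f x| <= M * N.
Proof.
move=> fM xN; apply: le_trans (oper_norm_le f x) _.
by apply: ler_pM.
Qed.

Lemma oper_le {U K} (f : 'L(U, K)) M :
  0 <= M -> (forall x, `|f x| <= M * `|x|) -> `|f| <= M.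
Proof.
move=> M0 fM; apply: opnorm_le => x x1; apply: le_trans (fM x) _.
by rewrite ler_piMr.
Qed.

Lemma is_oper_bound {U K} (g : U -> K) M :
  linear g -> (forall x, `|g x| <= M * `|x|) -> g \in is_oper U K.
Proof.
move=> lg gM; apply/is_operP; split=> // x; apply/cvgrPdist_lt => e e0.
have M0 : 0 < `|M| + 1 by rewrite ltr_wpDl.
have gB y z : g y - g z = g (y - z).
  by rewrite addrC -scaleN1r -lg scaleN1r addrC.
near=> y; rewrite gB (@le_lt_trans _ _ ((`|M| + 1) * `|x - y|))//.
  by rewrite (le_trans (gM _))// ler_wpM2r// (le_trans (ler_norm M))// lerDl.
rewrite -ltr_pdivlMl//; near: y; apply/nbhs_normP.
by exists ((`|M| + 1)^-1 * e) => //=; rewrite mulr_gt0// invr_gt0.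
Unshelve. all: by end_near. Qed.

Lemma oper_compE {U V K} (A : 'L(V, K)) (B : 'L(U, V)) u :
  oper_comp A B u = A (B u).
Proof. by []. Qed.

Lemma oper_comp_norm {U V K} (A : 'L(V, K)) (B : 'L(U, V)) :
  `|oper_comp A B| <= `|A| * `|B|.
Proof.
apply: oper_le => [|x]; first by rewrite mulr_ge0.
by rewrite -mulrA /=; apply: (oper_norm_leM (f := A)) => //; exact: oper_norm_le.
Qed.

End OperatorCalculus.

Section EpsilonDelta.
Context {R : realType} {U K : normedModType R}.
Implicit Types (f : U -> K).

Lemma continuous_at_eps f x : (forall e, 0 < e -> exists2 d, 0 < d &
    forall h, `|h| < d -> `|f (x + h) - f x| <= e) -> {for x, continuous f}.
Proof.
move=> H; apply/cvgrPdist_le => e /H[d d0 Hd].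
apply/nbhs_normP; exists d => // y yd.
have := Hd (y - x); rewrite [x + _]addrC subrK distrC => H'.
by rewrite /= distrC in yd *; rewrite distrC; apply: H'; rewrite distrC.
Qed.

Lemma eps_continuous_at f x e : {for x, continuous f} -> 0 < e ->
  exists2 d, 0 < d & forall h, `|h| < d -> `|f (x + h) - f x| <= e.
Proof.
move=> /cvgrPdist_le H /H/nbhs_normP[d /= d0 Hd]; exists d => // h hd.
by rewrite distrC; apply: Hd; rewrite /= opprD addrA subrr sub0r normrN.
Qed.

End EpsilonDelta.

Lemma continuous_oper_comp {R : realType} {P U V K : normedModType R}
    (A : 'L(V, K)) (g : P -> 'L(U, V)) :
  continuous g -> continuous (fun z => oper_comp A (g z)).
Proof.
move=> gc z; apply: continuous_at_eps => e e0.
have a0 : 0 < `|A| + 1 by rewrite ltr_wpDl.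
have [d d0 Hd] := eps_continuous_at (gc z) (divr_gt0 e0 a0).
exists d => // h /Hd hE.
have -> : oper_comp A (g (z + h)) - oper_comp A (g z) =
    oper_comp A (g (z + h) - g z).
  apply: oper_eqP => u.
  by rewrite -[RHS]/(A (g (z + h) u - g z u)) operB.
apply: le_trans (oper_comp_norm _ _) _.
apply: (@le_trans _ _ ((`|A| + 1) * (e / (`|A| + 1)))).
  by apply: ler_pM => //; rewrite lerDl.
by rewrite mulrC divfK// gt_eqF.
Qed.

Section FrechetDerivative.
Context {R : realType}.
Implicit Types (U V K : normedModType R).

(** The derivative is an explicit argument: a derivative is computed by proposing
   [L] and estimating, and [frechet f x] is rewritten to [L] afterwards. *)
Definition has_frechet {U K} (f : U -> K) (x : U) (L : 'L(U, K)) : Prop :=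
  forall e, 0 < e -> exists2 d, 0 < d &
    forall h, `|h| < d -> `|f (x + h) - f x - L h| <= e * `|h|.

Lemma has_frechet_frechet {U K} (f : U -> K) x :
  differentiable f x -> has_frechet f x (frechet f x).
Proof.
move=> df; have dc := diff_continuous df.
have op : ('d f x : U -> K) \in is_oper U K.
  by apply/is_operP; split=> // a u v; rewrite linearP.
have fE : (frechet f x : U -> K) = 'd f x by rewrite /frechet insubdK.
move=> e e0.
have /eqaddoP/(_ e e0) := diff_locally df.
move=> /nbhs_normP[d /= d0 Hd]; exists d => // h hd.
have := Hd h; rewrite /= sub0r normrN => /(_ hd).
rewrite -[X in `|X| <= _ -> _]/(f (h + x) - (f x + 'd f x h)).
by rewrite fE [h + x]addrC opprD addrA.
Qed.

Lemma has_frechet_diff {U K} (f : U -> K) x L :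
  has_frechet f x L -> differentiable f x /\ frechet f x = L.
Proof.
move=> fL.
pose lL := GRing.isLinear.Build R U K *:%R L (oper_linear L).
pose L' : {linear U -> K} := HB.pack (L : U -> K) lL.
have fL' : f \o shift x = cst (f x) + L' +o_ 0 id.
  apply/eqaddoP => e e0; have [d d0 Hd] := fL e e0.
  apply/nbhs_normP; exists d => //= h; rewrite /= sub0r normrN => /Hd.
  rewrite -[X in _ -> `|X| <= _]/(f (h + x) - (f x + L h)).
  by rewrite [h + x]addrC opprD addrA.
have dE : 'd f x = L :> (U -> K).
  by apply: (diff_unique _ fL'); exact: oper_continuous.
split.
  by apply/diff_locallyP; rewrite dE; split=> //; exact: oper_continuous.
apply/val_inj; rewrite /frechet insubdK//= dE.
by apply/is_operP; split; [exact: oper_linear|exact: oper_continuous].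
Qed.

Lemma has_frechetE {U K} (f : U -> K) x L : has_frechet f x L -> frechet f x = L.
Proof. by move=> /has_frechet_diff[]. Qed.

Lemma has_frechet_differentiable {U K} (f : U -> K) x L :
  has_frechet f x L -> differentiable f x.
Proof. by move=> /has_frechet_diff[]. Qed.

Lemma has_frechetD {U K} (f g : U -> K) x L M :
  has_frechet f x L -> has_frechet g x M ->
  has_frechet (fun z => f z + g z) x (L + M).
Proof.
move=> fL gM e e0; have e2 : 0 < e / 2 by rewrite divr_gt0.
have [d d0 fd] := fL _ e2; have [d' d'0 gd] := gM _ e2.
exists (Num.min d d'); first by rewrite lt_min d0 d'0.
move=> h; rewrite lt_min => /andP[/fd hf /gd hg].
rewrite [e]splitr mulrDl; apply: le_trans (lerD hf hg).
apply: le_trans (ler_normD _ _); rewrite le_eqVlt; apply/orP; left.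
by apply/eqP; congr (`|_|); rewrite oper_addE; module_eq.
Qed.

Lemma has_frechetZ {U K} (f : U -> K) x L a :
  has_frechet f x L -> has_frechet (fun z => a *: f z) x (a *: L).
Proof.
move=> fL e e0; have a0 : 0 < `|a| + 1 by rewrite ltr_wpDl.
have [d d0 fd] := fL (e / (`|a| + 1)) (divr_gt0 e0 a0).
exists d => // h /fd hf; rewrite oper_scaleE -!scalerBr normrZ.
rewrite (@le_trans _ _ ((`|a| + 1) * (e / (`|a| + 1) * `|h|)))//.
  by apply: ler_pM => //; rewrite lerDl.
by rewrite !mulrA [_ * e]mulrC mulfK// gt_eqF.
Qed.

Lemma has_frechetB {U K} (f g : U -> K) x L M :
  has_frechet f x L -> has_frechet g x M ->
  has_frechet (fun z => f z - g z) x (L - M).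
Proof.
move=> fL gM; have := has_frechetD fL (has_frechetZ (-1) gM).
rewrite scaleN1r; congr (has_frechet _ x _).
by apply/funext => z; rewrite scaleN1r.
Qed.

Lemma has_frechet_oper {U K} (L : 'L(U, K)) x : has_frechet L x L.
Proof.
move=> e e0; exists 1 => // h _.
rewrite (_ : _ - _ = 0) ?normr0 ?mulr_ge0// ?ltW//.
by rewrite operD; module_eq.
Qed.

Lemma has_frechet_comp_oper {U V K} (A : 'L(V, K)) (f : U -> V) x L :
  has_frechet f x L -> has_frechet (fun z => A (f z)) x (oper_comp A L).
Proof.
move=> fL e e0; have a0 : 0 < `|A| + 1 by rewrite ltr_wpDl.
have [d d0 fd] := fL (e / (`|A| + 1)) (divr_gt0 e0 a0).
exists d => // h /fd hf; rewrite /= -!operB.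
rewrite (@le_trans _ _ ((`|A| + 1) * (e / (`|A| + 1) * `|h|)))//.
  by apply: oper_norm_leM => //; rewrite lerDl.
by rewrite !mulrA [_ * e]mulrC mulfK// gt_eqF.
Qed.

Lemma has_frechet_shift {U K} (f : U -> K) x c L :
  has_frechet f (x + c) L -> has_frechet (fun z => f (z + c)) x L.
Proof.
move=> fL e e0; have [d d0 fd] := fL e e0; exists d => // h hd.
by rewrite [x + h + c]addrAC fd.
Qed.

(** A derivative is bounded by any local Lipschitz constant.  This is how
   estimates on differences of a family pass to its derivatives. *)
Lemma has_frechet_norm_le {U K} (f : U -> K) x L M d : 0 < d ->
  has_frechet f x L -> (forall h, `|h| < d -> `|f (x + h) - f x| <= M * `|h|) ->
  forall a, `|L a| <= M * `|a|.
Proof.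
move=> d0 fL fM a.
have [->|a0] := eqVneq a 0; first by rewrite oper0 !normr0 mulr0.
have na : 0 < `|a| by rewrite normr_gt0.
apply/ler_addgt0Pr => e e0.
have [d' d'0 fd'] := fL (e / `|a|) (divr_gt0 e0 na).
pose D := Num.min d d'; have D0 : 0 < D by rewrite lt_min d0 d'0.
have [t t0 hta] : exists2 t, 0 < t & `|t *: a| < D.
  exists (D / 2 / `|a|); first by rewrite !divr_gt0.
  rewrite normrZ gtr0_norm ?divr_gt0// divfK ?gt_eqF// ltr_pdivrMr//.
  by rewrite ltr_pMr// ltr1n.
move: (hta); rewrite lt_min => /andP[/fM h1 /fd' h2].
have : `|L (t *: a)| <= (M + e / `|a|) * `|t *: a|.
  rewrite mulrDl; apply: le_trans (lerD h1 h2).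
  rewrite -{1}[L _](subrK (f (x + t *: a) - f x)) addrC.
  by apply: le_trans (ler_normD _ _) _; rewrite lerD// distrC.
rewrite operZ 2!normrZ gtr0_norm// mulrCA ler_pM2l//.
by rewrite mulrDl divfK// gt_eqF.
Qed.

Lemma has_frechet_unique {U K} (f : U -> K) x L M :
  has_frechet f x L -> has_frechet f x M -> L = M.
Proof. by move=> /has_frechetE <- /has_frechetE <-. Qed.

Lemma has_frechet_continuous {U K} (f : U -> K) x L :
  has_frechet f x L -> {for x, continuous f}.
Proof.
by move=> /has_frechet_differentiable/differentiable_continuous.
Qed.

End FrechetDerivative.

Section MeanValue.
Context {R : realType}.
Implicit Types (U V K : normedModType R).

(** A vector-valued curve has no mean value equality; the inequality, with the
   slack [e], is propagated from [0] to the supremum of the times up to which it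
   holds. *)
Lemma mean_value_curve {K} (phi : R -> K) M :
  (forall t, 0 <= t <= 1 -> exists2 L : K, `|L| <= M &
     forall e, 0 < e -> exists2 d, 0 < d &
       forall h, `|h| < d -> `|phi (t + h) - phi t - h *: L| <= e * `|h|) ->
  `|phi 1 - phi 0| <= M.
Proof.
move=> dphi; apply/ler_addgt0Pr => e e0.
pose P t := `|phi t - phi 0| <= (M + e) * t.
pose S := [set t | 0 <= t <= 1 /\ forall u, 0 <= u <= t -> P u].
have S0 : S 0.
  split=> [|u]; first by rewrite lexx ler01.
  by move=> /le_anti <-; rewrite /P subrr normr0 mulr0.
have Sub : has_sup S by split; [exists 0|exists 1 => t [/andP[]]].
pose c := sup S.
have c0 : 0 <= c by apply: (sup_upper_bound Sub).
have c1 : c <= 1 by apply: ge_sup => [|t [/andP[]//]]; exists 0.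
have [L LM /(_ e e0)[d d0 Hd]] : exists2 L : K, `|L| <= M &
    forall e, 0 < e -> exists2 d, 0 < d &
    forall h, `|h| < d -> `|phi (c + h) - phi c - h *: L| <= e * `|h|.
  by apply: dphi; rewrite c0 c1.
have near u : `|u - c| < d -> `|phi u - phi c| <= (M + e) * `|u - c|.
  move=> /Hd; rewrite (_ : c + _ = u) => [ud|]; last by ring.
  rewrite mulrDl -[phi u - phi c](subrK ((u - c) *: L)) addrC.
  apply: le_trans (ler_normD _ _) _; rewrite lerD// normrZ mulrC.
  by rewrite ler_wpM2r.
have Pc : P c.
  have [t St] := sup_adherent d0 Sub; rewrite -/c => tc.
  have tc' : t <= c by apply: (sup_upper_bound Sub).
  have /near : `|t - c| < d by rewrite distrC ger0_norm ?subr_ge0//; lra.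
  rewrite distrC [`|t - c|]distrC [`|c - t|]ger0_norm ?subr_ge0// => h.
  have Pt : P t by case: St => /andP[? ?]; apply; lra.
  rewrite /P -[phi c](subrK (phi t)) -addrA.
  apply: le_trans (ler_normD _ _) _; apply: le_trans (lerD h Pt) _; lra.
have Sc : forall u, 0 <= u <= c -> P u.
  move=> u /andP[u0]; rewrite le_eqVlt => /predU1P[->//|uc].
  have := @sup_adherent _ S (c - u); rewrite subr_gt0 => /(_ uc Sub)[t [_ St] tu].
  by apply: St; rewrite u0/=; move: tu; rewrite subKr => /ltW.
have [c1'|] := ltP c 1; last first.
  move=> c1'; have c1E : c = 1 by apply/le_anti; rewrite c1.
  by move: Pc; rewrite c1E /P mulr1.
pose u := Num.min 1 (c + d / 2).
have cu : c < u by rewrite lt_min c1'/= ltrDl divr_gt0.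
suff : S u by move=> /(sup_upper_bound Sub); rewrite leNgt cu.
split=> [|v /andP[v0 vu]].
  by rewrite (le_trans c0 (ltW cu)) /= /u ge_min lexx.
have [vc|cv] := leP v c; first by apply: Sc; rewrite v0.
have /near : `|v - c| < d.
  rewrite gtr0_norm ?subr_gt0//; move: vu; rewrite /u le_min => /andP[_]; lra.
rewrite [`|v - c|]gtr0_norm ?subr_gt0// => h.
rewrite /P -[phi v](subrK (phi c)) -addrA.
apply: le_trans (ler_normD _ _) _; apply: le_trans (lerD h Pc) _; lra.
Qed.

Lemma mean_value {U K} (f : U -> K) (df : R -> 'L(U, K)) x v M :
  (forall t, 0 <= t <= 1 -> has_frechet f (x + t *: v) (df t)) ->
  (forall t, 0 <= t <= 1 -> `|df t v| <= M) ->
  `|f (x + v) - f x| <= M.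
Proof.
move=> dfE dfM.
rewrite -{1}[v]scale1r -{2}[x]addr0 -(scale0r v).
apply: (@mean_value_curve _ (fun t => f (x + t *: v))) => t t01.
exists (df t v); first exact: dfM.
move=> e e0; have v0 : 0 < `|v| + 1 by rewrite ltr_wpDl.
have [d d0 Hd] := dfE t t01 (e / (`|v| + 1)) (divr_gt0 e0 v0).
exists (d / (`|v| + 1)); first exact: divr_gt0.
move=> h; rewrite ltr_pdivlMr// => hd.
have hv : `|h *: v| <= `|h| * (`|v| + 1) by rewrite normrZ ler_wpM2l// lerDl.
have := Hd (h *: v) (le_lt_trans hv hd).
rewrite -operZ -[x + _ + _]addrA -scalerDl => /le_trans; apply.
rewrite (@le_trans _ _ (e / (`|v| + 1) * (`|h| * (`|v| + 1))))//.
  by rewrite ler_wpM2l// divr_ge0// ltW.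
by rewrite mulrA mulrAC divfK// gt_eqF.
Qed.

Lemma mean_value_le {U K} (f : U -> K) (f1 : U -> 'L(U, K)) x v M :
  (forall t, 0 <= t <= 1 -> has_frechet f (x + t *: v) (f1 (x + t *: v))) ->
  (forall t, 0 <= t <= 1 -> `|f1 (x + t *: v)| <= M) ->
  `|f (x + v) - f x| <= M * `|v|.
Proof.
move=> f1E f1M; apply: (mean_value f1E) => t t01.
by apply: oper_norm_leM => //; exact: f1M.
Qed.

(** The mean value inequality for [f] minus the linear map [f1 x]. *)
Lemma taylor1 {U K} (f : U -> K) (f1 : U -> 'L(U, K)) x v M :
  (forall t, 0 <= t <= 1 -> has_frechet f (x + t *: v) (f1 (x + t *: v))) ->
  (forall t, 0 <= t <= 1 -> `|f1 (x + t *: v) - f1 x| <= M) ->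
  `|f (x + v) - f x - f1 x v| <= M * `|v|.
Proof.
move=> f1E f1M.
have -> : f (x + v) - f x - f1 x v =
    (f (x + v) - f1 x (x + v)) - (f x - f1 x x).
  by rewrite operD; module_eq.
apply: (@mean_value _ _ (fun z => f z - f1 x z)
  (fun t => f1 (x + t *: v) - f1 x)) => t t01.
  by apply: has_frechetB; [exact: f1E|exact: has_frechet_oper].
by apply: oper_norm_leM => //; exact: f1M.
Qed.

(** The mean value inequality for the remainder along the segment, whose
   derivative at time [t] is the first-order remainder of [f1] at [t *: v]. *)
Lemma taylor2 {U K} (f : U -> K) (f1 : U -> 'L(U, K))
    (f2 : U -> 'L(U, 'L(U, K))) x v M :
  (forall t, 0 <= t <= 1 -> has_frechet f (x + t *: v) (f1 (x + t *: v))) ->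
  (forall t, 0 <= t <= 1 -> has_frechet f1 (x + t *: v) (f2 (x + t *: v))) ->
  (forall t, 0 <= t <= 1 -> `|f2 (x + t *: v) - f2 x| <= M) ->
  `|f (x + v) - f x - f1 x v - 2^-1 *: f2 x v v| <= M * `|v| ^+ 2.
Proof.
move=> f1E f2E f2M.
have M0 : 0 <= M.
  by apply: le_trans (f2M 0 _) => //; rewrite lexx ler01.
pose q := f2 x v v.
pose phi t := f (x + t *: v) - t *: f1 x v - (2^-1 * t ^+ 2) *: q.
have -> : f (x + v) - f x - f1 x v - 2^-1 *: f2 x v v = phi 1 - phi 0.
  rewrite /phi -/q expr1n mulr1 !scale1r !scale0r expr0n/= mulr0 scale0r addr0.
  by module_eq.
apply: mean_value_curve => t t01; exists (f1 (x + t *: v) v - f1 x v - t *: q).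
  have -> : f1 (x + t *: v) v - f1 x v - t *: q =
      (f1 (x + t *: v) - f1 x - f2 x (t *: v)) v.
    by rewrite !oper_subE operZ oper_scaleE.
  rewrite exprS mulrA expr1; apply: oper_norm_leM => //.
  have /andP[t0 t1] := t01.
  rewrite (@le_trans _ _ (M * `|t *: v|))//; last first.
    by rewrite normrZ ger0_norm// ler_wpM2l// ler_piMl.
  have sub u : 0 <= u <= 1 -> 0 <= u * t <= 1.
    by move=> /andP[u0 u1]; rewrite mulr_ge0//= mulr_ile1.
  by apply: taylor1 => u u01; rewrite scalerA; [apply: f2E|apply: f2M];
    exact: sub.
move=> e e0; have q0 : 0 < `|q| + 1 by rewrite ltr_wpDl.
have e2 : 0 < e / 2 by rewrite divr_gt0.
have v0 : 0 < `|v| + 1 by rewrite ltr_wpDl.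
have [d d0 Hd] := f1E t t01 (e / 2 / (`|v| + 1)) (divr_gt0 e2 v0).
exists (Num.min (d / (`|v| + 1)) (e / 2 / (`|q| + 1))).
  by rewrite lt_min !divr_gt0.
move=> h; rewrite lt_min !ltr_pdivlMr// => /andP[hd he].
have hv : `|h *: v| <= `|h| * (`|v| + 1) by rewrite normrZ ler_wpM2l// lerDl.
have H := Hd (h *: v) (le_lt_trans hv hd).
have {}H : `|f (x + (t + h) *: v) - f (x + t *: v) - h *: f1 (x + t *: v) v|
    <= e / 2 * `|h|.
  rewrite -operZ scalerDl addrA (le_trans H)//.
  rewrite (@le_trans _ _ (e / 2 / (`|v| + 1) * (`|h| * (`|v| + 1))))//.
    by rewrite ler_wpM2l// divr_ge0// ltW.
  by rewrite mulrA mulrAC divfK// gt_eqF.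
have Q : `|(2^-1 * h ^+ 2) *: q| <= e / 2 * `|h|.
  rewrite normrZ normrM normrX gtr0_norm ?invr_gt0// expr2.
  have : `|h| * `|q| <= e / 2.
    by have := normr_ge0 h; have := normr_ge0 q; nra.
  move=> /(ler_wpM2l (normr_ge0 h)).
  have : 0 <= `|h| * (`|h| * `|q|) by rewrite !mulr_ge0.
  lra.
rewrite [e]splitr mulrDl; apply: le_trans (lerD H Q).
apply: le_trans (ler_normB _ _).
rewrite le_eqVlt; apply/orP; left; apply/eqP; congr (`|_|).
by rewrite /phi; module_eq.
Qed.

(** Symmetry of the second derivative: both [f2 x v w] and [f2 x w v] are the
   leading term of the same second difference. *)
Lemma second_derivative_sym {U K} (f : U -> K) (f1 : U -> 'L(U, K))
    (f2 : U -> 'L(U, 'L(U, K))) x :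
  (forall z, has_frechet f z (f1 z)) -> (forall z, has_frechet f1 z (f2 z)) ->
  {for x, continuous f2} -> forall v w, f2 x v w = f2 x w v.
Proof.
move=> f1E f2E f2c.
have diff2 e : 0 < e -> exists2 d, 0 < d & forall v w, `|v| < d -> `|w| < d ->
    `|f (x + v + w) - f (x + v) - f (x + w) + f x - f2 x v w|
      <= e * `|v| * `|w|.
  move=> e0; have /cvgrPdist_le/(_ e e0) := f2c.
  move=> /nbhs_normP[d /= d0 Hd]; exists (d / 2); first exact: divr_gt0.
  move=> v w vd wd.
  have -> : f (x + v + w) - f (x + v) - f (x + w) + f x - f2 x v w =
      (f (x + w + v) - f (x + w) - f2 x v (x + w)) -
      (f (x + v) - f x - f2 x v x).
    by rewrite operD [x + w + v]addrAC; module_eq.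
  apply: (@mean_value _ _ (fun z => f (z + v) - f z - f2 x v z)
    (fun t => f1 (x + t *: w + v) - f1 (x + t *: w) - f2 x v)) => t t01.
    apply: has_frechetB; last exact: has_frechet_oper.
    by apply: has_frechetB; [apply: has_frechet_shift|].
  apply: oper_norm_leM => //.
  have -> : f1 (x + t *: w + v) - f1 (x + t *: w) - f2 x v =
     (f1 (x + t *: w + v) - f2 x (x + t *: w + v)) -
     (f1 (x + t *: w) - f2 x (x + t *: w)).
    by rewrite ![f2 x (_ + v)]operD; module_eq.
  apply: (@mean_value _ _ (fun z => f1 z - f2 x z)
    (fun u => f2 (x + t *: w + u *: v) - f2 x)) => u u01.
    by apply: has_frechetB; [|exact: has_frechet_oper].
  apply: oper_norm_leM => //; rewrite distrC; apply: Hd => /=.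
  rewrite -addrA opprD addrA subrr add0r normrN.
  apply: le_lt_trans (ler_normD _ _) _; rewrite [d]splitr ltr_leD//.
    move: t01 => /andP[t0 t1]; rewrite normrZ ger0_norm//.
    by apply: le_lt_trans wd; rewrite ler_piMl.
  move: u01 => /andP[u0 u1]; rewrite normrZ ger0_norm//.
  by apply: le_trans (ltW vd); rewrite ler_piMl.
move=> v w; apply/eqP; rewrite -subr_eq0 -normr_le0.
apply/ler_addgt0Pr => e e0; rewrite add0r.
pose N := (`|v| + 1) * (`|w| + 1).
have v0 : 0 < `|v| + 1 by rewrite ltr_wpDl.
have w0 : 0 < `|w| + 1 by rewrite ltr_wpDl.
have N0 : 0 < N by rewrite mulr_gt0.
have [d d0 Hd] := diff2 (e / 2 / N) (divr_gt0 (divr_gt0 e0 (ltr0Sn _ 1)) N0).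
(* the second difference is only controlled for small increments *)
pose r := d / 2 / N.
have r0 : 0 < r by rewrite !divr_gt0.
have small (u : U) : `|u| <= N -> `|r *: u| < d.
  move=> uN; rewrite normrZ gtr0_norm// (@le_lt_trans _ _ (d / 2))//.
    by rewrite /r mulrAC ler_pdivrMr// ler_wpM2l// divr_ge0// ltW.
  by rewrite ltr_pdivrMr// ltr_pMr// ltr1n.
have vN : `|v| <= N.
  by rewrite (@le_trans _ _ (`|v| + 1)) ?lerDl// ler_peMr ?lerDr// ltW.
have wN : `|w| <= N.
  by rewrite (@le_trans _ _ (`|w| + 1)) ?lerDl// ler_peMl ?lerDr// ltW.
clearbody r.
have h1 := Hd _ _ (small v vN) (small w wN).
have h2 := Hd _ _ (small w wN) (small v vN).
have : `|f2 x (r *: v) (r *: w) - f2 x (r *: w) (r *: v)| <=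
    e / N * (r * `|v|) * (r * `|w|).
  rewrite -[r in leRHS]gtr0_norm// -!normrZ.
  have -> : e / N * `|r *: v| * `|r *: w| =
      e / 2 / N * `|r *: w| * `|r *: v| + e / 2 / N * `|r *: v| * `|r *: w|.
    by rewrite {1}[e]splitr; ring.
  apply: le_trans (lerD h2 h1); apply: le_trans (ler_normB _ _); rewrite le_eqVlt; apply/orP; left.
  by apply/eqP; congr (`|_|); rewrite [x + r *: w + _]addrAC; module_eq.
rewrite !operZ !oper_scaleE -!scalerBr !normrZ gtr0_norm//.
have -> : e / N * (r * `|v|) * (r * `|w|) = r * (r * (e / N * (`|v| * `|w|))).
  by ring.
rewrite !ler_pM2l// => /le_trans; apply.
rewrite mulrAC ler_pdivrMr//; apply: ler_wpM2l; first exact: ltW.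
by apply: ler_pM; rewrite ?lerDl.
Qed.

Fact oper_eval_subproof {U K} (v : U) :
  (fun A : 'L(U, K) => A v) \in is_oper 'L(U, K) K.
Proof.
apply: (@is_oper_bound _ _ _ _ `|v|) => [a A B //|A].
by rewrite mulrC oper_norm_le.
Qed.

Definition oper_eval {U K} (v : U) : 'L('L(U, K), K) :=
  Oper (oper_eval_subproof v).

(** Interchange of partial derivatives.  For a small increment [v] of the first
   variable the function [g (z + v) - g z - g1 z v] of the second variable has
   a Lipschitz constant [o(v)], by two applications of the mean value
   inequality; hence its derivative in a direction [a] is [o(v)] too, which is
   the differentiability of the partial derivative [g2]. *)
Lemma frechet_swap {U V K} (g : U -> V -> K) (g1 : U -> V -> 'L(U, K))
    (g2 : U -> V -> 'L(V, K)) (g12 : U -> V -> 'L(V, 'L(U, K))) :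
  (forall z y, has_frechet (g ^~ y) z (g1 z y)) ->
  (forall z y, has_frechet (g z) y (g2 z y)) ->
  (forall z y, has_frechet (g1 z) y (g12 z y)) ->
  continuous (fun p : U * V => g12 p.1 p.2) ->
  forall a z y, has_frechet (fun z => g2 z y a) z (g12 z y a).
Proof.
move=> g1E g2E g12E g12c a z y e e0.
have a0 : 0 < `|a| + 1 by rewrite ltr_wpDl.
pose e' := e / 2 / (`|a| + 1).
have e'0 : 0 < e' by rewrite !divr_gt0.
have [d d0 Hd] := eps_continuous_at (g12c (z, y)) e'0.
have near v b : `|v| < d -> `|b| < d -> `|g12 (z + v) (y + b) - g12 z y| <= e'.
  by move=> vd bd; apply: (Hd (v, b)); rewrite prod_normE/= gt_max vd bd.
exists d => // v vd.
pose E y' := g (z + v) y' - g z y' - g1 z y' v.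
have EE : has_frechet E y
    (g2 (z + v) y - g2 z y - oper_comp (oper_eval v) (g12 z y)).
  apply: has_frechetB; first by apply: has_frechetB.
  exact: (has_frechet_comp_oper (oper_eval v)).
have := has_frechet_norm_le d0 EE (M := 2 * e' * `|v|) _ a.
rewrite !oper_subE /=; move=> H; apply: le_trans (H _) _; last first.
  rewrite mulrAC ler_wpM2r// /e'.
  rewrite (_ : 2 * _ = e / (`|a| + 1)); last by field; rewrite gt_eqF.
  by rewrite mulrAC ler_pdivrMr// ler_wpM2l ?ltW// ltrDl.
move=> b bd.
have bt t : 0 <= t <= 1 -> `|t *: b| < d.
  move=> /andP[t0 t1]; rewrite normrZ ger0_norm//.
  by apply: le_lt_trans bd; rewrite ler_piMl.
have vt t : 0 <= t <= 1 -> `|t *: v| < d.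
  move=> /andP[t0 t1]; rewrite normrZ ger0_norm//.
  by apply: le_lt_trans vd; rewrite ler_piMl.
pose L := g1 z (y + b) - g1 z y.
have -> : E (y + b) - E y = (g (z + v) (y + b) - g (z + v) y - L (z + v)) -
    (g z (y + b) - g z y - L z).
  by rewrite /E operD /L !oper_subE; module_eq.
rewrite mulrAC.
apply: (@mean_value _ _ (fun z => g z (y + b) - g z y - L z)
   (fun t => g1 (z + t *: v) (y + b) - g1 (z + t *: v) y - L)) => t t01.
  apply: has_frechetB; last exact: has_frechet_oper.
  by apply: has_frechetB; exact: g1E.
apply: oper_norm_leM => //.
have -> : g1 (z + t *: v) (y + b) - g1 (z + t *: v) y - L =
    (g1 (z + t *: v) (y + b) - g1 z (y + b)) - (g1 (z + t *: v) y - g1 z y).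
  by rewrite /L; module_eq.
apply: (@mean_value _ _ (fun y => g1 (z + t *: v) y - g1 z y)
  (fun u => g12 (z + t *: v) (y + u *: b) - g12 z (y + u *: b))) => u u01.
  by apply: has_frechetB; exact: g12E.
apply: oper_norm_leM => //.
rewrite -[X in X - _](subrK (g12 z y)) -addrA.
apply: le_trans (ler_normD _ _) _; rewrite mulr2n mulrDl !mul1r lerD//.
  by apply: near; [exact: vt|exact: bt].
rewrite distrC -{1}[z]addr0; apply: near; last exact: bt.
by rewrite normr0.
Qed.

End MeanValue.

(** * Extension of bilinear operators to the projective tensor product *)

Section TensorLift.
Context {R : realType} {V : normedModType R} (VV : proj_tensor V).

Lemma tens0l w : tens VV 0 w = 0.
Proof.
have := tens_linear_l VV w (-1) 0 0.
by rewrite scaleN1r oppr0 addr0 scaleN1r addNr.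
Qed.

Lemma tensZl a v w : tens VV (a *: v) w = a *: tens VV v w.
Proof. by have := tens_linear_l VV w a v 0; rewrite !addr0 tens0l addr0. Qed.

Lemma tensNl v w : tens VV (- v) w = - tens VV v w.
Proof. by rewrite -scaleN1r tensZl scaleN1r. Qed.

Lemma tensDl v v' w : tens VV (v + v') w = tens VV v w + tens VV v' w.
Proof. by rewrite -[v]scale1r tens_linear_l !scale1r. Qed.

Lemma tensDr v w w' : tens VV v (w + w') = tens VV v w + tens VV v w'.
Proof. by rewrite -[w]scale1r tens_linear_r !scale1r. Qed.

Let tens_sum (s : seq (V * V)) : VV := \sum_(p <- s) tens VV p.1 p.2.

Lemma tens_sum_dense (xi : VV) e : 0 < e -> exists s, `|tens_sum s - xi| < e.
Proof.
move=> e0; have [||eta [/= eta1 [s _ sE]]] := @tens_dense _ _ VV (ball xi e).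
- by exists xi; exact: ballxx.
- exact: ball_open.
by exists s; rewrite /tens_sum sE distrC; move: eta1; rewrite -ball_normE.
Qed.

Section Extension.
Context {K : completeNormedModType R} (B : 'L(V, 'L(V, K))).

Let bil_sum (s : seq (V * V)) : K := \sum_(p <- s) B p.1 p.2.

(** The projective norm is the infimum of [\sum |v| * |w|] over all representatives,
   and the left-hand side is bounded by [`|B|] times each of these sums. *)
Lemma bil_sum_le s : `|bil_sum s| <= `|B| * `|tens_sum s|.
Proof.
have le s' : eq_tens s s' -> `|bil_sum s| <= `|B| * \sum_(p <- s') `|p.1| * `|p.2|.
  move=> ss'; rewrite /bil_sum (ss' K (fun v w => B v w)); last 2 first.
  - by move=> v a x y; rewrite oper_linear.
  - by move=> w a x y; rewrite oper_linear.
  apply: le_trans (ler_norm_sum _ _ _) _; rewrite mulr_sumr; apply: ler_sum.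
  by move=> p _; rewrite mulrA; apply: oper_norm_leM => //; exact: oper_norm_le.
rewrite tens_norm /proj_norm.
have [B0|B0] := eqVneq `|B| 0.
  by have := le s (fun _ _ _ _ => erefl); rewrite B0 !mul0r.
have Bp : 0 < `|B| by rewrite lt_def B0 normr_ge0.
rewrite -ler_pdivrMl//; apply: lb_le_inf.
  by exists (\sum_(p <- s) `|p.1| * `|p.2|), s.
by move=> _ [s' /le ? <-]; rewrite ler_pdivrMl.
Qed.

(** The graph of the extension of [B] is the closure of the graph of [B] on finite
   sums; the estimate on finite sums makes it the graph of a map, everywhere
   defined since the target is complete. *)
Let graph (xi : VV) (z : K) := forall e, 0 < e ->
  exists2 s, `|tens_sum s - xi| <= e & `|bil_sum s - z| <= e.

Let graph_bound xi z : graph xi z -> `|z| <= `|B| * `|xi|.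
Proof.
move=> G; apply/ler_addgt0Pr => e e0.
have b0 : 0 < `|B| + 1 by rewrite ltr_wpDl.
have [s s1 s2] := G (e / (`|B| + 1)) (divr_gt0 e0 b0).
have -> : z = bil_sum s - (bil_sum s - z) by module_eq.
apply: le_trans (ler_normB _ _) _.
have : `|tens_sum s| <= `|xi| + e / (`|B| + 1).
  have -> : tens_sum s = xi + (tens_sum s - xi) by module_eq.
  by apply: le_trans (ler_normD _ _) _; rewrite lerD2l.
move=> /(ler_wpM2l (normr_ge0 B)); rewrite mulrDr => h.
apply: le_trans (lerD (le_trans (bil_sum_le s) h) s2) _.
rewrite -addrA lerD2l -[X in _ + X]mul1r -mulrDl mulrC divfK//.
Qed.

Let graph_ex xi : exists z, graph xi z.
Proof.
pose F : set_system K := filter_from [set e : R | 0 < e]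
  (fun e => [set bil_sum s | s in [set s | `|tens_sum s - xi| < e]]).
have FF : ProperFilter F.
  apply: filter_from_proper => [|e /= e0]; last first.
    by have [s sxi] := tens_sum_dense xi e0; exists (bil_sum s), s.
  apply: filter_from_filter => [|e e' /= e0 e'0]; first by exists 1 => /=.
  exists (Num.min e e') => /=; first by rewrite lt_min e0 e'0.
  move=> z [s /= se <-]; move: se; rewrite lt_min => /andP[? ?].
  by split; exists s.
have /cauchy_cvgP/cvg_ex[z Fz] : cauchy F.
  apply: cauchy_exP => e e0.
  have b0 : 0 < 2 * (`|B| + 1) by rewrite mulr_gt0// ltr_wpDl.
  have d0 : 0 < e / (2 * (`|B| + 1)) by rewrite divr_gt0.
  have [s sxi] := tens_sum_dense xi d0.
  exists (bil_sum s), (e / (2 * (`|B| + 1))) => // _ [s' /= s'xi <-].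
  rewrite -ball_normE /=.
  have -> : bil_sum s - bil_sum s' = bil_sum (s ++ map (fun p => (- p.1, p.2)) s').
    rewrite /bil_sum big_cat big_map -sumrN/=; congr (_ + _); apply: eq_bigr.
    by move=> p _; rewrite operN.
  apply: le_lt_trans (bil_sum_le _) _.
  have -> : tens_sum (s ++ map (fun p => (- p.1, p.2)) s') =
      (tens_sum s - xi) - (tens_sum s' - xi).
    rewrite opprB addrA subrK /tens_sum big_cat big_map -sumrN/=; congr (_ + _).
    apply: eq_bigr => p _.
    by rewrite tensNl.
  apply: (@le_lt_trans _ _ (`|B| * (2 * (e / (2 * (`|B| + 1)))))).
    rewrite ler_wpM2l// mulr2n mulrDl !mul1r.
    by apply: le_trans (ler_normB _ _) _; rewrite lerD// ltW.
  have -> : `|B| * (2 * (e / (2 * (`|B| + 1)))) = e * (`|B| / (`|B| + 1)).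
    by field; rewrite gt_eqF// ltr_wpDl.
  by rewrite -[ltRHS]mulr1 ltr_pM2l// ltr_pdivrMr ?mul1r ?ltrDl// ltr_wpDl.
exists z => e e0.
have [d /= d0 Hd] : F (ball z e) := Fz _ (nbhsx_ballx z e e0).
have m0 : 0 < Num.min d e by rewrite lt_min d0.
have [s] := tens_sum_dense xi m0; rewrite lt_min => /andP[sd se].
exists s; rewrite ltW// distrC.
have : ball z e (bil_sum s) by apply: Hd; exists s.
by rewrite -ball_normE.
Qed.

Let graph_linear a xi z xi' z' :
  graph xi z -> graph xi' z' -> graph (a *: xi + xi') (a *: z + z').
Proof.
move=> G G' e e0.
have a0 : 0 < `|a| + 1 by rewrite ltr_wpDl.
have [s s1 s2] := G (e / (`|a| + 1)  / 2) (divr_gt0 (divr_gt0 e0 a0) (ltr0Sn _ 1)).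
have [s' s'1 s'2] := G' (e / 2) (divr_gt0 e0 (ltr0Sn _ 1)).
have le (E : normedModType R) (x x' y y' : E) :
    `|x - y| <= e / (`|a| + 1) / 2 -> `|x' - y'| <= e / 2 ->
    `|(a *: x + x') - (a *: y + y')| <= e.
  move=> h h'; have -> : (a *: x + x') - (a *: y + y') =
    a *: (x - y) + (x' - y') by module_eq.
  apply: le_trans (ler_normD _ _) _; rewrite [e]splitr lerD// normrZ.
  apply: (@le_trans _ _ ((`|a| + 1) * (e / (`|a| + 1) / 2))).
    by apply: ler_pM => //; rewrite lerDl.
  by rewrite mulrA [_ * (e / _)]mulrC divfK// gt_eqF.
exists (map (fun p => (a *: p.1, p.2)) s ++ s').
  rewrite /tens_sum big_cat big_map/=.
  rewrite (_ : \sum_(p <- s) _ = a *: tens_sum s); first exact: le.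
  rewrite scaler_sumr; apply: eq_bigr => p _.
  by rewrite tensZl.
rewrite /bil_sum big_cat big_map/=.
rewrite (_ : \sum_(p <- s) _ = a *: bil_sum s); first exact: le.
by rewrite scaler_sumr; apply: eq_bigr => p _; rewrite operZ.
Qed.

Let graph_inj xi z z' : graph xi z -> graph xi z' -> z = z'.
Proof.
move=> G G'; apply/eqP; rewrite -subr_eq0 -normr_le0.
have /graph_bound := graph_linear (-1) G' G.
by rewrite !scaleN1r addNr normr0 mulr0 addrC.
Qed.

Lemma tens_lift_ex : exists2 L : 'L(VV, K),
  (forall v w, L (tens VV v w) = B v w) & forall xi, `|L xi| <= `|B| * `|xi|.
Proof.
have [g gG] := choice graph_ex.
have gl : linear g.
  by move=> a x y; apply: (graph_inj (gG _)); exact: graph_linear.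
have gb xi : `|g xi| <= `|B| * `|xi| by exact: graph_bound.
exists (Oper (is_oper_bound gl gb)) => // v w /=.
apply: (graph_inj (gG _)) => e e0; exists [:: (v, w)].
  by rewrite /tens_sum big_seq1 subrr normr0 ltW.
by rewrite /bil_sum big_seq1 subrr normr0 ltW.
Qed.

End Extension.

(** Finite sums of elementary tensors are dense. *)
Lemma tens_oper_inj {K : normedModType R} (L L' : 'L(VV, K)) :
  (forall v w, L (tens VV v w) = L' (tens VV v w)) -> L = L'.
Proof.
move=> LL'; apply: oper_eqP => xi; apply/eqP; rewrite -subr_eq0 -normr_le0.
apply/ler_addgt0Pr => e e0; rewrite add0r.
have b0 : 0 < `|L - L'| + 1 by rewrite ltr_wpDl.
have [s sxi] := tens_sum_dense xi (divr_gt0 e0 b0).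
have E (M : 'L(VV, K)) : M (tens_sum s) = \sum_(p <- s) M (tens VV p.1 p.2).
  rewrite /tens_sum; elim: s {sxi} => [|p s IH]; first by rewrite !big_nil oper0.
  by rewrite !big_cons operD IH.
have -> : L xi - L' xi = (L - L') (xi - tens_sum s).
  rewrite operB oper_subE [(L - L') (tens_sum s)]oper_subE !E.
  by rewrite (eq_bigr _ (fun p _ => LL' p.1 p.2)) subrr subr0.
apply: (@le_trans _ _ ((`|L - L'| + 1) * (e / (`|L - L'| + 1)))).
  by apply: oper_norm_leM; [rewrite lerDl|rewrite distrC ltW].
by rewrite mulrC divfK// gt_eqF.
Qed.

Context {K : completeNormedModType R}.
Implicit Types B : 'L(V, 'L(V, K)).

Lemma tens_liftE B v w : tens_lift VV B (tens VV v w) = B v w.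
Proof.
have [L LE _] := tens_lift_ex B.
by have := @xgetPex _ (0 : 'L(VV, K)) [set L : 'L(VV, K) |
  forall v w, L (tens VV v w) = B v w] (ex_intro _ L LE); apply.
Qed.

Lemma tens_lift_le B xi : `|tens_lift VV B xi| <= `|B| * `|xi|.
Proof.
have [L LE LB] := tens_lift_ex B.
by rewrite (@tens_oper_inj _ (tens_lift VV B) L) // => v w; rewrite tens_liftE LE.
Qed.

Lemma tens_liftD B B' xi :
  tens_lift VV (B + B') xi = tens_lift VV B xi + tens_lift VV B' xi.
Proof.
rewrite (@tens_oper_inj _ (tens_lift VV (B + B')) (tens_lift VV B + tens_lift VV B'))//.
by move=> v w; rewrite oper_addE !tens_liftE.
Qed.

Lemma tens_liftZ a B xi : tens_lift VV (a *: B) xi = a *: tens_lift VV B xi.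
Proof.
rewrite (@tens_oper_inj _ (tens_lift VV (a *: B)) (a *: tens_lift VV B))//.
by move=> v w; rewrite oper_scaleE !tens_liftE.
Qed.

Lemma tens_liftB B B' xi :
  tens_lift VV (B - B') xi = tens_lift VV B xi - tens_lift VV B' xi.
Proof. by rewrite -scaleN1r tens_liftD tens_liftZ scaleN1r. Qed.

End TensorLift.

(** * Riemann sums along partitions and the sewing lemma *)

Section Partitions.
Context {R : realType}.
Implicit Types (s t u x d : R) (p q r : seq R).

Lemma mesh_cons s x p : mesh s (x :: p) = Num.max (x - s) (mesh x p).
Proof. by rewrite /mesh /= big_cons. Qed.

Lemma mesh_cat s p q d : mesh s p < d -> mesh (last s p) q < d ->
  mesh s (p ++ q) < d.
Proof.
elim: p s => [//|x p IH] s /=; rewrite !mesh_cons !gt_max => /andP[-> /=].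
exact: IH.
Qed.

Lemma itv_partition_consE s t x p :
  itv_partition s t (x :: p) <-> s < x /\ itv_partition x t p.
Proof.
split=> [[/= /andP[sx xp] l]|[sx [xp l]]] //; split=> //=.
by rewrite sx xp.
Qed.

Lemma itv_partition_catE s t p q :
  itv_partition s t (p ++ q) ->
  itv_partition s (last s p) p /\ itv_partition (last s p) t q.
Proof. by case; rewrite cat_path last_cat => /andP[sp lq] l; split. Qed.

Lemma partition_mesh_ex s t d : s <= t -> 0 < d ->
  exists2 p, itv_partition s t p & mesh s p < d.
Proof.
move=> st d0; have d2 : 0 < d / 2 by rewrite divr_gt0.
have [n] : exists n : nat, t - s < n%:R * (d / 2).
  exists (Num.truncn ((t - s) / (d / 2))).+1.
  by rewrite -ltr_pdivrMr// truncnS_gt.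
elim: n s st => [|n IH] s st.
  by rewrite mul0r subr_lt0 ltNge st.
move=> tsn; move: st; rewrite le_eqVlt => /predU1P[->|st].
  by exists [::]; [split=> /=|rewrite /mesh big_nil].
have [tsd|dts] := ltP (t - s) d.
  exists [:: t]; first exact: itv_partition1.
  by rewrite mesh_cons /mesh big_nil gt_max tsd d0.
have [||p pP pd] := IH (s + d / 2).
- lra.
- by move: tsn; rewrite -[n.+1]addn1 natrD mulrDl mul1r; lra.
exists (s + d / 2 :: p); first by apply/itv_partition_consE; split=> //; lra.
by rewrite mesh_cons gt_max pd andbT; lra.
Qed.

Lemma partition_insert s t x p : s < x -> x <= t -> itv_partition s t p ->
  exists r, itv_partition s t r /\ {subset x :: p <= r}.
Proof.
move=> sx xt; elim: p s sx => [s sx /itv_partition_nil E|y p IH s sx].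
  by move: xt; rewrite -E leNgt sx.
move=> /itv_partition_consE[sy yp]; have [xy|yx|xy] := ltgtP x y.
- exists (x :: y :: p); split=> //.
  by apply/itv_partition_consE; split=> //; apply/itv_partition_consE.
- have [r [rP sub]] := IH y yx yp.
  exists (y :: r); split; first by apply/itv_partition_consE.
  move=> z; rewrite !inE => /or3P[zx|->//|zp].
    by rewrite sub ?orbT// inE zx.
  by rewrite sub ?orbT// inE zp orbT.
- exists (y :: p); split; first by apply/itv_partition_consE.
  by move=> z; rewrite xy !inE => /or3P[->|->|->]; rewrite ?orbT.
Qed.

Lemma itv_partition_mem s t p x : itv_partition s t p -> x \in p -> s < x <= t.
Proof.
elim: p s => // y p IH s /itv_partition_consE[sy yp].
rewrite inE => /predU1P[->|xp]; first by rewrite sy (itv_partition_le yp).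
by have /andP[yx ->] := IH y yp xp; rewrite (lt_trans sy yx).
Qed.

(** The points of [q] are inserted into [p] one after the other. *)
Lemma common_refinement s t p q : itv_partition s t p -> itv_partition s t q ->
  exists r, [/\ itv_partition s t r, {subset p <= r} & {subset q <= r}].
Proof.
move=> pP qP; have : {in q, forall x, s < x <= t}.
  by move=> x; exact: itv_partition_mem.
elim: q {qP} => [|x q IH] xq.
  by exists p; split=> // x; rewrite in_nil.
have [r [rP pr qr]] : exists r,
    [/\ itv_partition s t r, {subset p <= r} & {subset q <= r}].
  by apply: IH => y yq; apply: xq; rewrite inE yq orbT.
have /andP[sx xt] := xq x (mem_head _ _).
have [r' [r'P sub]] := partition_insert sx xt rP.
exists r'; split=> // y => [/pr|].
  by move=> yr; apply: sub; rewrite inE yr orbT.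
rewrite inE => /predU1P[->|/qr yr]; first by apply: sub; rewrite mem_head.
by apply: sub; rewrite inE yr orbT.
Qed.

Lemma powR_small (g e : R) : 0 < g -> 0 < e -> exists2 d : R, 0 < d & d `^ g <= e.
Proof.
move=> g0 e0; exists (e `^ g^-1); first exact: powR_gt0.
by rewrite -powRrM mulVf ?gt_eqF// powRr1// ltW.
Qed.

(** The constant of the sewing bound solves [M = 2 * (M * 2^-1 `^ g) + 2 * C]. *)
Definition sewing_const (C g : R) : R := 2 * C / (1 - 2 * 2^-1 `^ g).

Lemma half_powR_lt1 (g : R) : 1 < g -> 2 * 2^-1 `^ g < 1 :> R.
Proof.
move=> g1; rewrite (_ : g = (g - 1) + 1); last by ring.
rewrite powRD; last by apply/implyP => _; rewrite gt_eqF// invr_gt0.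
rewrite powRr1 ?invr_ge0// mulrCA mulfV// mulr1.
rewrite [ltRHS](_ : 1 = 1 `^ (g - 1)); last by rewrite powR1.
apply: gt0_ltr_powR; rewrite ?nnegrE ?subr_gt0//; lra.
Qed.

Lemma sewing_const_ge0 (C g : R) : 0 <= C -> 1 < g -> 0 <= sewing_const C g.
Proof.
move=> C0 g1; rewrite divr_ge0 ?mulr_ge0// subr_ge0.
by apply: ltW; exact: half_powR_lt1.
Qed.

End Partitions.

Section Sewing.
Context {R : realType} {K : normedModType R}.
Implicit Types (Xi : R -> R -> K) (s t u x d : R) (p q r : seq R).

Lemma riemann_sum_cons Xi s x p :
  riemann_sum Xi s (x :: p) = Xi s x + riemann_sum Xi x p.
Proof. by rewrite /riemann_sum /= big_cons. Qed.

Lemma riemann_sum_nil Xi s : riemann_sum Xi s [::] = 0.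
Proof. by rewrite /riemann_sum big_nil. Qed.

Lemma riemann_sum_cat Xi s p q :
  riemann_sum Xi s (p ++ q) = riemann_sum Xi s p + riemann_sum Xi (last s p) q.
Proof.
elim: p s => [s|x p IH s] /=; first by rewrite riemann_sum_nil add0r.
by rewrite !riemann_sum_cons IH addrA.
Qed.

Lemma riemann_sum_linear c Xi Xi' s p :
  riemann_sum (fun u v => c *: Xi u v + Xi' u v) s p =
  c *: riemann_sum Xi s p + riemann_sum Xi' s p.
Proof.
elim: p s => [s|x p IH s]; first by rewrite !riemann_sum_nil scaler0 addr0.
by rewrite !riemann_sum_cons IH; module_eq.
Qed.

(** The epsilon-delta form of convergence along [mesh_filter s t]. *)
Definition sews Xi s t (l : K) := forall e, 0 < e -> exists2 d, 0 < d &
  forall p, itv_partition s t p -> mesh s p < d -> `|riemann_sum Xi s p - l| <= e.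

Lemma mesh_filter_proper s t : s <= t -> ProperFilter (mesh_filter s t).
Proof.
move=> st; apply: filter_from_proper => [|d /= d0]; last first.
  by have [p ? ?] := partition_mesh_ex st d0; exists p.
apply: filter_from_filter => [|d d' /= d0 d'0]; first by exists 1 => /=.
exists (Num.min d d') => /=; first by rewrite lt_min d0 d'0.
by move=> p [pP]; rewrite lt_min => /andP[? ?]; split.
Qed.

Lemma sews_cvgP Xi s t l : s <= t ->
  sews Xi s t l <-> riemann_sum Xi s p @[p --> mesh_filter s t] --> l.
Proof.
move=> st; have FF := mesh_filter_proper st; split=> [H|].
  apply/cvgrPdist_le => e e0; have [d d0 Hd] := H e e0.
  by exists d => // p [pP pd]; rewrite distrC; exact: Hd.
move=> /cvgrPdist_le H e /H[d /= d0 Hd]; exists d => // p pP pd.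
by rewrite distrC; apply: Hd; split.
Qed.

Lemma sews_germ_integral Xi s t l : s <= t -> sews Xi s t l ->
  integral_exists Xi s t /\ germ_integral Xi s t = l.
Proof.
move=> st /(sews_cvgP _ _ st) H; have FF := mesh_filter_proper st.
split; first by apply/cvg_ex; exists l.
by rewrite /germ_integral st; apply/cvg_lim.
Qed.

Lemma sews_xx Xi s : sews Xi s s 0.
Proof.
move=> e e0; exists 1 => // p /itv_partitionxx -> _.
by rewrite riemann_sum_nil subr0 normr0 ltW.
Qed.

Lemma sews_additive Xi s u t l m n : s <= u -> u <= t ->
  sews Xi s u l -> sews Xi u t m -> sews Xi s t n -> n = l + m.
Proof.
move=> su ut Hl Hm Hn; apply/eqP; rewrite -subr_eq0 -normr_le0.
apply/ler_addgt0Pr => e e0; rewrite add0r.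
have e3 : 0 < e / 3 by rewrite divr_gt0.
have [d d0 Hd] := Hl _ e3; have [d' d'0 Hd'] := Hm _ e3.
have [d'' d''0 Hd''] := Hn _ e3.
pose D := Num.min d (Num.min d' d'').
have D0 : 0 < D by rewrite !lt_min d0 d'0 d''0.
have [p pP] := partition_mesh_ex su D0; rewrite !lt_min => /and3P[pd pd' pd''].
have [q qP] := partition_mesh_ex ut D0; rewrite !lt_min => /and3P[qd qd' qd''].
have lp : last s p = u by case: pP => _ /eqP.
have h1 := Hd p pP pd; have h2 := Hd' q qP qd'.
have := Hd'' (p ++ q) (itv_partition_cat pP qP).
rewrite mesh_cat ?lp// => /(_ isT); rewrite riemann_sum_cat lp => h3.
have -> : n - (l + m) = (riemann_sum Xi s p - l) + (riemann_sum Xi u q - m) -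
   (riemann_sum Xi s p + riemann_sum Xi u q - n) by module_eq.
apply: le_trans (ler_normB _ _) _.
have := ler_normD (riemann_sum Xi s p - l) (riemann_sum Xi u q - m).
lra.
Qed.

Lemma sews_linear c Xi Xi' s t l l' : sews Xi s t l -> sews Xi' s t l' ->
  sews (fun u v => c *: Xi u v + Xi' u v) s t (c *: l + l').
Proof.
move=> H H' e e0; have c0 : 0 < `|c| + 1 by rewrite ltr_wpDl.
have e2 : 0 < e / 2 by rewrite divr_gt0.
have [d d0 Hd] := H _ (divr_gt0 e2 c0); have [d' d'0 Hd'] := H' _ e2.
exists (Num.min d d'); first by rewrite lt_min d0 d'0.
move=> p pP; rewrite lt_min => /andP[pd pd'].
rewrite riemann_sum_linear.
have -> : c *: riemann_sum Xi s p + riemann_sum Xi' s p - (c *: l + l') =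
   c *: (riemann_sum Xi s p - l) + (riemann_sum Xi' s p - l') by module_eq.
apply: le_trans (ler_normD _ _) _; rewrite [e]splitr lerD ?Hd'// normrZ.
apply: (@le_trans _ _ ((`|c| + 1) * (e / 2 / (`|c| + 1)))).
  by apply: ler_pM => //; [rewrite lerDl|exact: Hd].
by rewrite mulrC divfK// gt_eqF.
Qed.

Lemma sewsD Xi Xi' s t l l' : sews Xi s t l -> sews Xi' s t l' ->
  sews (fun u v => Xi u v + Xi' u v) s t (l + l').
Proof.
move=> H H'; have := sews_linear 1 H H'; rewrite scale1r.
congr (sews _ s t _); apply/funext => u; apply/funext => v.
by rewrite scale1r.
Qed.

(** Increments of order larger than one are invisible to the integral: their
   Riemann sums are bounded by a positive power of the mesh. *)
Lemma riemann_sum_small g C Xi a b s t p d : 1 < g -> 0 <= C ->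
  (forall u v, a <= u -> u <= v -> v <= b -> `|Xi u v| <= C * (v - u) `^ g) ->
  a <= s -> t <= b -> itv_partition s t p -> mesh s p < d ->
  `|riemann_sum Xi s p| <= C * d `^ (g - 1) * (t - s).
Proof.
move=> g1 C0 XiC as_ tb; elim: p s as_ => [s as_ /itv_partition_nil <- _|x p IH s as_].
  by rewrite riemann_sum_nil normr0 subrr mulr0.
move=> /itv_partition_consE[sx xp]; rewrite mesh_cons gt_max => /andP[xsd pd].
rewrite riemann_sum_cons (_ : t - s = (x - s) + (t - x)); last by ring.
have xt := itv_partition_le xp.
rewrite mulrDr; apply: le_trans (ler_normD _ _) _; apply: lerD; last first.
  by apply: IH => //; rewrite (le_trans as_)// ltW.
apply: le_trans (XiC _ _ as_ (ltW sx) (le_trans xt tb)) _.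
have xs0 : 0 < x - s by rewrite subr_gt0.
rewrite -mulrA ler_wpM2l// -{2}[x - s](powRr1 (ltW xs0)).
rewrite {1}(_ : g = (g - 1) + 1); last by ring.
rewrite powRD; last by apply/implyP => _; rewrite gt_eqF.
apply: ler_wpM2r; first exact: powR_ge0.
by apply: ge0_ler_powR; rewrite ?nnegrE; lra.
Qed.

Lemma sews_small g C Xi a b s t : 1 < g -> 0 <= C ->
  (forall u v, a <= u -> u <= v -> v <= b -> `|Xi u v| <= C * (v - u) `^ g) ->
  a <= s -> s <= t -> t <= b -> sews Xi s t 0.
Proof.
move=> g1 C0 XiC as_ st tb e e0.
have c0 : 0 < C * (t - s) + 1 by rewrite ltr_wpDl// mulr_ge0// subr_ge0.
have [||d d0 dg] := @powR_small R (g - 1) (e / (C * (t - s) + 1)).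
- by rewrite subr_gt0.
- by rewrite divr_gt0.
exists d => // p pP pd; rewrite subr0.
apply: le_trans (riemann_sum_small g1 C0 XiC as_ tb pP pd) _.
rewrite mulrAC; apply: (@le_trans _ _ ((C * (t - s) + 1) * (e / (C * (t - s) + 1)))).
  by apply: ler_pM => //; rewrite ?powR_ge0 ?lerDl// mulr_ge0// subr_ge0.
by rewrite mulrC divfK// gt_eqF.
Qed.

Lemma sews_equiv g C Xi Xi' a b s t l : 1 < g -> 0 <= C ->
  (forall u v, a <= u -> u <= v -> v <= b ->
     `|Xi' u v - Xi u v| <= C * (v - u) `^ g) ->
  a <= s -> s <= t -> t <= b -> sews Xi s t l -> sews Xi' s t l.
Proof.
move=> g1 C0 XiC as_ st tb H; have := sewsD H (sews_small g1 C0 XiC as_ st tb).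
rewrite addr0; congr (sews _ s t _); apply/funext => u; apply/funext => v.
by rewrite addrC subrK.
Qed.

Definition almost_additive C g a b Xi := forall s u t,
  a <= s -> s <= u -> u <= t -> t <= b ->
  `|Xi s t - Xi s u - Xi u t| <= C * (t - s) `^ g.

Lemma partition_split s t p m : itv_partition s t p -> s <= m -> m < t ->
  exists q x r, [/\ p = q ++ x :: r, last s q <= m & m < x].
Proof.
elim: p s => [s /itv_partition_nil <- sm|x p IH s].
  by rewrite ltNge sm.
move=> /itv_partition_consE[sx xp] sm mt; have [xm|mx] := leP x m.
  by have [q [y [r [-> l my]]]] := IH x xp xm mt; exists (x :: q), y, r.
by exists [::], x, p.
Qed.

(** The maximal inequality of sewing.  The partition is cut at the interval
   containing the midpoint of [[s, t]]: both remaining pieces are at most half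
   as long, and the gain [2 * 2 `^ - g < 1] closes the induction. *)
Lemma sewing_max C g a b Xi : 0 <= C -> 1 < g -> almost_additive C g a b Xi ->
  forall p s t, a <= s -> t <= b -> itv_partition s t p ->
  `|riemann_sum Xi s p - Xi s t| <= sewing_const C g * (t - s) `^ g.
Proof.
move=> C0 g1 XiC p; have [n] := ubnP (size p).
have M0 := sewing_const_ge0 C0 g1; set M := sewing_const C g in M0 *.
have g0 : 0 < g by rewrite (lt_trans _ g1).
have ME : 2 * (M * 2^-1 `^ g) + 2 * C = M.
  have h := half_powR_lt1 g1; rewrite /M /sewing_const; field.
  by rewrite gt_eqF// subr_gt0.
have Xi0 s : a <= s -> s <= b -> Xi s s = 0.
  move=> as_ sb; have := XiC s s s as_ (lexx _) (lexx _) sb.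
  rewrite [s - s]subrr powR0 ?gt_eqF// mulr0 subrr sub0r normrN normr_le0.
  by move=> /eqP.
elim: n p => // n IH p pn s t as_ tb pP.
have := itv_partition_le pP; rewrite le_eqVlt => /predU1P[E|st].
  move: pP; rewrite -E => /itv_partitionxx ->.
  rewrite riemann_sum_nil Xi0//; last by rewrite E.
  by rewrite subrr normr0 mulr_ge0// powR_ge0.
pose m := (s + t) / 2.
have [||q [x [r [pE lm mx]]]] := partition_split pP (m := m).
- by rewrite /m; lra.
- by rewrite /m; lra.
move: pP pn; rewrite pE size_cat/= addnS ltnS => pP pn.
have [qP] := itv_partition_catE pP; set l := last s q in lm qP *.
move=> /itv_partition_consE[lx xr].
have xt := itv_partition_le xr; have sl := itv_partition_le qP.
have lt_ : l <= t by rewrite (le_trans (ltW lx)).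
have half u v : u <= v -> v - u <= (t - s) / 2 ->
    M * (v - u) `^ g <= M * 2^-1 `^ g * (t - s) `^ g.
  move=> uv uvd; rewrite -mulrA -powRM ?invr_ge0 ?subr_ge0//; last exact: ltW.
  rewrite ler_wpM2l//; apply: ge0_ler_powR; rewrite ?nnegrE; lra.
have h1 : `|riemann_sum Xi s q - Xi s l| <= M * 2^-1 `^ g * (t - s) `^ g.
  apply: (le_trans (IH q _ s l as_ (le_trans lt_ tb) qP)).
    by apply: leq_trans pn; rewrite ltnS leq_addr.
  by apply: half => //; move: lm; rewrite /m; lra.
have h2 : `|riemann_sum Xi x r - Xi x t| <= M * 2^-1 `^ g * (t - s) `^ g.
  apply: (le_trans (IH r _ x t _ tb xr)).
  - by apply: leq_trans pn; rewrite ltnS leq_addl.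
  - by rewrite (le_trans as_)// (le_trans sl)// ltW.
  by apply: half => //; move: mx; rewrite /m; lra.
have h3 := XiC _ _ _ as_ sl lt_ tb.
have h4 : `|Xi l t - Xi l x - Xi x t| <= C * (t - s) `^ g.
  apply: le_trans (XiC _ _ _ (le_trans as_ sl) (ltW lx) xt tb) _.
  by rewrite ler_wpM2l//; apply: ge0_ler_powR; rewrite ?nnegrE; lra.
rewrite riemann_sum_cat riemann_sum_cons -/l.
have -> : riemann_sum Xi s q + (Xi l x + riemann_sum Xi x r) - Xi s t =
   ((riemann_sum Xi s q - Xi s l) + (riemann_sum Xi x r - Xi x t)) -
   ((Xi s t - Xi s l - Xi l t) + (Xi l t - Xi l x - Xi x t)) by module_eq.
apply: le_trans (ler_normB _ _) _.
rewrite -[M in leRHS]ME mulrDl; apply: lerD.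
  by apply: le_trans (ler_normD _ _) _; move: (lerD h1 h2); lra.
by apply: le_trans (ler_normD _ _) _; move: (lerD h3 h4); lra.
Qed.

(** The maximal inequality on each interval of the coarse partition; the factor
   [d `^ (g - 1)] is what remains of the power [g] once one power of the lengths
   has been summed. *)
Lemma riemann_sum_refine C g a b Xi s t p r d : 0 <= C -> 1 < g ->
  almost_additive C g a b Xi -> a <= s -> t <= b ->
  itv_partition s t p -> itv_partition s t r -> {subset p <= r} ->
  mesh s p < d ->
  `|riemann_sum Xi s r - riemann_sum Xi s p|
    <= sewing_const C g * d `^ (g - 1) * (t - s).
Proof.
move=> C0 g1 XiC + tb; have M0 := sewing_const_ge0 C0 g1.
elim: p s r => [s r as_ /itv_partition_nil -> /itv_partitionxx -> _ _|].
  by rewrite !subrr normr0 mulr0.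
move=> x p IH s r as_ /itv_partition_consE[sx xp] rP sub.
rewrite mesh_cons gt_max => /andP[xsd pd].
have xr : x \in r by apply: sub; rewrite mem_head.
case/splitPr: xr => r1 r2 in rP sub *.
rewrite -cat_rcons in rP sub *.
have [r1P] := itv_partition_catE rP; rewrite last_rcons => r2P.
rewrite last_rcons in r1P.
have xt := itv_partition_le xp.
rewrite riemann_sum_cons riemann_sum_cat last_rcons.
have -> : riemann_sum Xi s (rcons r1 x) + riemann_sum Xi x r2 -
  (Xi s x + riemann_sum Xi x p) = (riemann_sum Xi s (rcons r1 x) - Xi s x) +
  (riemann_sum Xi x r2 - riemann_sum Xi x p) by module_eq.
apply: le_trans (ler_normD _ _) _.
rewrite (_ : t - s = (x - s) + (t - x)); last by ring.
rewrite mulrDr; apply: lerD; last first.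
  apply: IH => //; first by rewrite (le_trans as_)// ltW.
  move=> y yp; have /andP[xy _] := itv_partition_mem xp yp.
  have : y \in rcons r1 x ++ r2 by apply: sub; rewrite inE yp orbT.
  rewrite mem_cat => /orP[/(itv_partition_mem r1P)/andP[_]|//].
  by rewrite leNgt xy.
apply: le_trans (sewing_max C0 g1 XiC as_ (le_trans xt tb) r1P) _.
rewrite -mulrA ler_wpM2l//.
have xs0 : 0 <= x - s by rewrite subr_ge0 ltW.
rewrite -{2}[x - s]powRr1// {1}(_ : g = (g - 1) + 1); last by ring.
rewrite powRD; last by apply/implyP => _; rewrite gt_eqF// subr_gt0.
apply: ler_wpM2r; first exact: powR_ge0.
by apply: ge0_ler_powR; rewrite ?nnegrE; lra.
Qed.

End Sewing.

Section SewingLemma.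
Context {R : realType} {K : completeNormedModType R}.
Context (C g a b : R) (Xi : R -> R -> K).
Hypotheses (C0 : 0 <= C) (g1 : 1 < g) (XiC : almost_additive C g a b Xi).

(** Riemann sums of two fine partitions are compared through a common refinement,
   so they form a Cauchy family. *)
Lemma sewing_exists s t : a <= s -> s <= t -> t <= b ->
  exists l, sews Xi s t l.
Proof using C0 g1 XiC.
move=> as_ st tb; have FF := mesh_filter_proper st.
suff /cauchy_cvgP/cvg_ex[l H] : cauchy (riemann_sum Xi s p @[p --> mesh_filter s t]).
  by exists l; apply/sews_cvgP.
apply: cauchy_exP => e e0.
have M0 := sewing_const_ge0 C0 g1.
pose M := 2 * sewing_const C g * (t - s) + 1.
have Mp : 0 < M by rewrite /M; move: M0 st; nra.
have [||d d0 dg] := @powR_small R (g - 1) (e / 2 / M).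
- by rewrite subr_gt0.
- by rewrite !divr_gt0.
have [p pP pd] := partition_mesh_ex st d0.
exists (riemann_sum Xi s p), d => // q [qP qd]; rewrite -ball_normE /=.
have [r [rP pr qr]] := common_refinement pP qP.
have h1 := riemann_sum_refine C0 g1 XiC as_ tb pP rP pr pd.
have h2 := riemann_sum_refine C0 g1 XiC as_ tb qP rP qr qd.
have -> : riemann_sum Xi s p - riemann_sum Xi s q =
  (riemann_sum Xi s r - riemann_sum Xi s q) -
  (riemann_sum Xi s r - riemann_sum Xi s p) by module_eq.
apply: le_lt_trans (ler_normB _ _) _; apply: le_lt_trans (lerD h2 h1) _.
have : M * d `^ (g - 1) <= e / 2.
  by rewrite mulrC -ler_pdivlMr.
have := powR_ge0 d (g - 1); rewrite /M; lra.
Qed.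

Lemma sewing_bound s t l : a <= s -> s <= t -> t <= b -> sews Xi s t l ->
  `|l - Xi s t| <= sewing_const C g * (t - s) `^ g.
Proof using C0 g1 XiC.
move=> as_ st tb H; apply/ler_addgt0Pr => e e0.
have [d d0 Hd] := H e e0; have [p pP /(Hd p pP) h] := partition_mesh_ex st d0.
have -> : l - Xi s t = (riemann_sum Xi s p - Xi s t) - (riemann_sum Xi s p - l)
  by module_eq.
apply: le_trans (ler_normB _ _) _; apply: lerD => //.
exact: (sewing_max C0 g1 XiC as_ tb pP).
Qed.

End SewingLemma.

(** * Germs of rough and Young integrals *)

Section TimeBounds.
Context {R : realType}.
Implicit Types (K : normedModType R) (a T M s u t : R).

(** An explicit bound in place of the extended real [time_norm]; unlike the latter
   it includes [s = t], where it says that [Xi] vanishes (if [a] is not [0]). *)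
Definition time_le {K} T a M (Xi : R -> R -> K) := forall s t,
  0 <= s <= T -> 0 <= t <= T -> `|Xi s t| <= M * `|t - s| `^ a.

Lemma time_boundedP {K} T a (Xi : R -> R -> K) :
  (forall s, 0 <= s <= T -> Xi s s = 0) -> time_bounded a T Xi ->
  exists2 M, 0 <= M & time_le T a M Xi.
Proof.
move=> Xi0 XiB.
have [M HM] : exists M : R, forall u : R * R, time_pairs T u ->
    `|Xi u.1 u.2| / `|u.2 - u.1| `^ a <= M.
  move: XiB; rewrite /time_bounded /time_norm; set S := ereal_sup _ => SB.
  have SM (u : R * R) : time_pairs T u -> ((`|Xi u.1 u.2| / `|u.2 - u.1| `^ a)%:E <= S)%E.
    by move=> Tu; apply: ereal_sup_ubound; exists u.
  case: S SB SM => [M _ SM|//|_ SM]; first by exists M => u /SM; rewrite lee_fin.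
  by exists 0 => u /SM.
exists `|M| => // s t sT tT; have [<-|st] := eqVneq s t.
  by rewrite Xi0// normr0 mulr_ge0// powR_ge0.
have w0 : 0 < `|t - s| `^ a by rewrite powR_gt0// normr_gt0 subr_eq0 eq_sym.
rewrite -ler_pdivrMr//; apply: le_trans (ler_norm M).
by apply: (HM (s, t)); split.
Qed.

Lemma time_boundedW {K} T a M (Xi : R -> R -> K) :
  time_le T a M Xi -> time_bounded a T Xi.
Proof.
move=> XiM; rewrite /time_bounded /time_norm.
apply: (@le_lt_trans _ _ M%:E); last by rewrite ltry.
apply: ge_ereal_sup => _ [[s t] [/= sT tT st] <-]; rewrite lee_fin.
rewrite ler_pdivrMr ?XiM//.
by rewrite powR_gt0// normr_gt0 subr_eq0 eq_sym.
Qed.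

Lemma holderP {K} T a (Y : R -> K) : holder a T Y ->
  exists2 M, 0 <= M & time_le T a M (fun s t => Y t - Y s).
Proof. by apply: time_boundedP => s _; rewrite subrr. Qed.

Lemma powR2M (x a : R) : x `^ (2 * a) = (x `^ a) ^+ 2.
Proof. by rewrite mulrC powRrM powR_mulrn// powR_ge0. Qed.

Lemma powR3M (x a : R) : x `^ (3 * a) = (x `^ a) ^+ 3.
Proof. by rewrite mulrC powRrM powR_mulrn// powR_ge0. Qed.

Lemma time_le_mono a s t s' t' : 0 <= a -> s' <= s -> s <= t -> t <= t' ->
  `|t - s| `^ a <= `|t' - s'| `^ a.
Proof.
move=> a0 ss st tt; rewrite !ger0_norm ?subr_ge0//; last first.
  by rewrite (le_trans ss)// (le_trans st).
by apply: ge0_ler_powR; rewrite ?nnegrE; lra.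
Qed.

End TimeBounds.

Section RoughCalculus.
Context {R : realType} {V : completeNormedModType R} (VV : proj_tensor V).
Context (T alpha : R) (X : R -> V) (XX : R -> R -> VV) (N : R).

Definition rough_path_le :=
  [/\ 0 <= N, time_le T alpha N (fun s t => X t - X s),
      time_le T (2 * alpha) N XX
    & forall s u t, 0 <= s <= T -> 0 <= u <= T -> 0 <= t <= T ->
        XX s t - XX s u - XX u t = tens VV (X u - X s) (X t - X u)].

Hypothesis XN : rough_path_le.
Hypotheses (T0 : 0 <= T) (a13 : 3^-1 < alpha).

Let N0 : 0 <= N. Proof. by case: XN. Qed.
Let a0 : 0 <= alpha. Proof. by move: a13; lra. Qed.
Let g1 : 1 < 3 * alpha. Proof. by move: a13; lra. Qed.

Local Notation w s t := (`|t - s : R| `^ alpha).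

Let w0 (s t : R) : 0 <= w s t. Proof. exact: powR_ge0. Qed.
Let X1 (s t : R) : 0 <= s <= T -> 0 <= t <= T -> `|X t - X s| <= N * w s t.
Proof. by case: XN => _ h _ _; exact: h. Qed.
Let X2 (s t : R) : 0 <= s <= T -> 0 <= t <= T -> `|XX s t| <= N * w s t ^+ 2.
Proof. by case: XN => _ _ h _; rewrite -powR2M; exact: h. Qed.
Let chen (s u t : R) : 0 <= s <= T -> 0 <= u <= T -> 0 <= t <= T ->
  XX s t - XX s u - XX u t = tens VV (X u - X s) (X t - X u).
Proof. by case: XN => _ _ _; apply. Qed.

Lemma almost_additive_cube C (Xi : R -> R -> V) :
  (forall s u t, 0 <= s -> s <= u -> u <= t -> t <= T ->
     `|Xi s t - Xi s u - Xi u t| <= C * w s t ^+ 3) ->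
  almost_additive C (3 * alpha) 0 T Xi.
Proof.
move=> H s u t s0 su ut tT; apply: le_trans (H s u t s0 su ut tT) _.
by rewrite -powR3M ger0_norm// subr_ge0 (le_trans su).
Qed.

Let in_T s u t : 0 <= s -> s <= u -> u <= t -> t <= T ->
  [/\ 0 <= s <= T, 0 <= u <= T & 0 <= t <= T].
Proof.
by move=> s0 su ut tT; split; apply/andP; split; lra.
Qed.

Let cube_le s u t (k l : nat) : s <= u -> u <= t -> (k + l = 3)%N ->
  w s u ^+ k * w u t ^+ l <= w s t ^+ 3.
Proof.
move=> su ut <-; have wsu := time_le_mono a0 (lexx s) su ut.
have wut := time_le_mono a0 su ut (lexx t).
by rewrite exprD; apply: ler_pM; rewrite ?exprn_ge0// lerXn2r// nnegrE.
Qed.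

(** By the Chen relation the defect over [s <= u <= t] is, up to the sign,
   [(H u - H s - H' s X_su) X_ut + (H' u - H' s) XX_ut], a sum of two terms of
   order [3 * alpha]. *)
Lemma rough_germ_almost_additive M (H : R -> 'L(V, V)) (H' : R -> 'L(V, 'L(V, V))) :
  0 <= M -> time_le T (2 * alpha) M (fun s t => H t - H s - H' s (X t - X s)) ->
  time_le T alpha M (fun s t => H' t - H' s) ->
  almost_additive (2 * (M * N)) (3 * alpha) 0 T (rough_germ X XX H H').
Proof.
move=> M0 HM H'M; apply: almost_additive_cube => s u t s0 su ut tT.
have [sT uT tT'] := in_T s0 su ut tT.
have [Xd XdE] : exists d, d = X u - X s by exists (X u - X s).
have [Xe XeE] : exists d, d = X t - X u by exists (X t - X u).
have -> : rough_germ X XX H H' s t - rough_germ X XX H H' s u -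
    rough_germ X XX H H' u t =
    - ((H u - H s - H' s Xd) Xe) - tens_lift VV (H' u - H' s) (XX u t).
  have XE : X t - X s = Xd + Xe by rewrite XdE XeE; module_eq.
  have XXE : XX s t = XX s u + XX u t + tens VV Xd Xe.
    by rewrite XdE XeE -(chen sT uT tT'); module_eq.
  rewrite /rough_germ -XdE -XeE XE XXE.
  by rewrite !operD tens_liftB tens_liftE !oper_subE; module_eq.
rewrite {}XdE {}XeE -opprD normrN; apply: le_trans (ler_normD _ _) _.
rewrite mulr2n !mulrDl !mul1r; apply: lerD.
  apply: le_trans (oper_norm_leM (HM _ _ sT uT) (X1 uT tT')) _.
  rewrite powR2M [leLHS](_ : _ = M * N * (w s u ^+ 2 * w u t ^+ 1)); last by ring.
  by rewrite ler_wpM2l ?mulr_ge0// cube_le.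
apply: le_trans (tens_lift_le _ _) _.
apply: le_trans (ler_pM _ _ (H'M _ _ sT uT) (X2 uT tT')) _ => //.
rewrite [leLHS](_ : _ = M * N * (w s u ^+ 1 * w u t ^+ 2)); last by ring.
by rewrite ler_wpM2l ?mulr_ge0// cube_le.
Qed.

(** A single tensor is one of its own representatives. *)
Lemma norm_tens (v v' : V) : `|tens VV v v'| <= `|v| * `|v'|.
Proof.
have := tens_norm VV [:: (v, v')]; rewrite big_seq1 /= => ->.
rewrite /proj_norm; apply: ge_inf; last first.
  by exists [:: (v, v')]; rewrite ?big_seq1.
exists 0 => _ [s _ <-]; apply: sumr_ge0 => p _.
by rewrite mulr_ge0.
Qed.

Lemma bracket_le s t : 0 <= s <= T -> 0 <= t <= T ->
  `|bracket X XX s t| <= (N ^+ 2 + 2 * N) * w s t ^+ 2.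
Proof.
move=> sT tT; apply: le_trans (ler_normB _ _) _; rewrite mulrDl.
apply: lerD; last by rewrite normrZ gtr0_norm// -mulrA ler_wpM2l// X2.
apply: le_trans (norm_tens _ _) _; rewrite -exprMn -expr2.
by rewrite lerXn2r ?nnegrE ?mulr_ge0// X1.
Qed.

(** The bracket is additive up to an antisymmetric tensor, which a symmetric
   integrand does not see. *)
Lemma young_germ_almost_additive M (A : R -> 'L(V, 'L(V, V))) :
  0 <= M -> time_le T alpha M (fun s t => A t - A s) ->
  (forall s v v', 0 <= s <= T -> A s v v' = A s v' v) ->
  almost_additive (M * (N ^+ 2 + 2 * N)) (3 * alpha) 0 T (young_germ X XX A).
Proof.
move=> M0 AM Asym; apply: almost_additive_cube => s u t s0 su ut tT.
have [sT uT tT'] := in_T s0 su ut tT.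
have -> : young_germ X XX A s t - young_germ X XX A s u - young_germ X XX A u t =
    - tens_lift VV (A u - A s) (bracket X XX u t).
  rewrite /young_germ.
  have -> : bracket X XX s t = bracket X XX s u + bracket X XX u t +
      (tens VV (X t - X u) (X u - X s) - tens VV (X u - X s) (X t - X u)).
    rewrite /bracket.
    have -> : XX s t = XX s u + XX u t + tens VV (X u - X s) (X t - X u).
      by rewrite -(chen sT uT tT'); module_eq.
    have -> : X t - X s = (X u - X s) + (X t - X u) by module_eq.
    by rewrite !tensDl !tensDr; module_eq.
  move: (bracket X XX s u) (bracket X XX u t) => b b'.
  rewrite !operD operN tens_liftB !tens_liftE.
  by rewrite (Asym s (X t - X u))//; module_eq.
rewrite normrN; apply: le_trans (tens_lift_le _ _) _.
apply: le_trans (ler_pM _ _ (AM _ _ sT uT) (bracket_le uT tT')) _ => //.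
have NN : 0 <= N ^+ 2 + 2 * N by rewrite addr_ge0 ?exprn_ge0 ?mulr_ge0.
rewrite [leLHS](_ : _ = M * (N ^+ 2 + 2 * N) * (w s u ^+ 1 * w u t ^+ 2)); last by ring.
by rewrite ler_wpM2l ?mulr_ge0// cube_le.
Qed.

(** A path and its Gubinelli derivative are paired, so that controlled paths are
   the elements of a vector space, of size at most [M] in the controlled norm. *)
Definition ctrl_le (M : R) (p : (R -> V) * (R -> 'L(V, V))) :=
  [/\ 0 <= M, forall s, 0 <= s <= T -> `|p.2 s| <= M,
      time_le T alpha M (fun s t => p.1 t - p.1 s),
      time_le T alpha M (fun s t => p.2 t - p.2 s)
    & time_le T (2 * alpha) M (fun s t => p.1 t - p.1 s - p.2 s (X t - X s))].

(** The same for an operator-valued path, whose derivative is written with the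
   direction of [X] as last argument. *)
Definition oper_ctrl_le (M : R) (q : (R -> 'L(V, V)) * (R -> 'L(V, 'L(V, V)))) :=
  [/\ 0 <= M, forall s, 0 <= s <= T -> `|q.2 s| <= M,
      time_le T alpha M (fun s t => q.1 t - q.1 s),
      time_le T alpha M (fun s t => q.2 t - q.2 s)
    & forall s t a, 0 <= s <= T -> 0 <= t <= T ->
        `|q.1 t a - q.1 s a - q.2 s a (X t - X s)|
          <= M * `|t - s| `^ (2 * alpha) * `|a|].

(** The germ of the rough integral [int d q_r p_r] of [p] against [q].  As
   [XX s t] is [int (X_r - X_s) (x) d X_r], the derivative of [p] acts on its first
   factor and the derivative of [q] on the second. *)
Definition iter_germ (q : (R -> 'L(V, V)) * (R -> 'L(V, 'L(V, V))))
    (p : (R -> V) * (R -> 'L(V, V))) (s t : R) : V :=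
  (q.1 t - q.1 s) (p.1 s) + tens_lift VV (oper_comp (q.2 s) (p.2 s)) (XX s t).

(** The defect over [s <= u <= t] splits into the remainder of [q] at [p_su], the
   remainder of [p] against [X_ut], the increment of the derivative of [q] against
   [p_su] and [X_ut], and the increment of the composed derivatives against
   [XX_ut]. *)
Lemma iter_germ_almost_additive M M' p q : ctrl_le M p -> oper_ctrl_le M' q ->
  almost_additive ((1 + 4 * N) * (M * M')) (3 * alpha) 0 T (iter_germ q p).
Proof.
case=> M0 P'M PM dP'M rPM [M'0 Q'M QM dQ'M rQM].
pose P := p.1; pose P' := p.2; pose Q := q.1; pose Q' := q.2.
apply: almost_additive_cube => s u t s0 su ut tT.
have [sT uT tT'] := in_T s0 su ut tT.
have [Pd PdE] : exists d, d = P u - P s by exists (P u - P s).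
have [Xd XdE] : exists d, d = X u - X s by exists (X u - X s).
have [Xe XeE] : exists d, d = X t - X u by exists (X t - X u).
pose B s := oper_comp (Q' s) (P' s).
have -> : iter_germ q p s t - iter_germ q p s u - iter_germ q p u t =
  - (((Q t Pd - Q u Pd - Q' u Pd Xe) + (Q' u - Q' s) Pd Xe) +
     (Q' s (Pd - P' s Xd) Xe + tens_lift VV (B u - B s) (XX u t))).
  have XXE : XX s t = XX s u + XX u t + tens VV Xd Xe.
    by rewrite XdE XeE -(chen sT uT tT'); module_eq.
  have PE : P u = P s + Pd by rewrite PdE; module_eq.
  rewrite /iter_germ -/P -/P' -/Q -/Q' -/(B s) -/(B u) XXE PE.
  rewrite operB !operD tens_liftB tens_liftE !oper_subE oper_compE.
  by module_eq.
have PdM : `|Pd| <= M * w s u by rewrite PdE; exact: PM.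
have XeN : `|Xe| <= N * w u t by rewrite XeE; exact: X1.
have h1 : `|Q t Pd - Q u Pd - Q' u Pd Xe| <= M * M' * w s t ^+ 3.
  rewrite XeE; apply: le_trans (rQM _ _ _ uT tT') _; rewrite powR2M.
  apply: (@le_trans _ _ (M' * w u t ^+ 2 * (M * w s u))).
    by rewrite ler_wpM2l// mulr_ge0// exprn_ge0.
  rewrite (_ : _ * (M * _) = M * M' * (w s u ^+ 1 * w u t ^+ 2)); last by ring.
  by rewrite ler_wpM2l ?mulr_ge0// cube_le.
have h2 : `|(Q' u - Q' s) Pd Xe| <= N * (M * M') * w s t ^+ 3.
  have h := oper_norm_leM (oper_norm_leM (dQ'M _ _ sT uT) PdM) XeN.
  apply: (le_trans h).
  rewrite (_ : _ * (N * _) = N * (M * M') * (w s u ^+ 2 * w u t ^+ 1)); last by ring.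
  by rewrite ler_wpM2l ?mulr_ge0// cube_le.
have h3 : `|Q' s (Pd - P' s Xd) Xe| <= N * (M * M') * w s t ^+ 3.
  have h := oper_norm_leM (oper_norm_leM (Q'M _ sT) (rPM _ _ sT uT)) XeN.
  rewrite PdE XdE.
  apply: (le_trans h); rewrite powR2M.
  rewrite (_ : _ * (N * _) = N * (M * M') * (w s u ^+ 2 * w u t ^+ 1)); last by ring.
  by rewrite ler_wpM2l ?mulr_ge0// cube_le.
have BB : `|B u - B s| <= 2 * (M * M') * w s u.
  have -> : B u - B s = oper_comp (Q' u - Q' s) (P' u) + oper_comp (Q' s) (P' u - P' s).
    apply: oper_eqP => v.
    rewrite -[LHS]/(Q' u (P' u v) - Q' s (P' s v)).
    rewrite -[RHS]/((Q' u (P' u v) - Q' s (P' u v)) + Q' s (P' u v - P' s v)).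
    by rewrite operB; module_eq.
  apply: le_trans (ler_normD _ _) _.
  rewrite [leRHS](_ : _ = M' * w s u * M + M' * (M * w s u)); last by ring.
  by apply: lerD; apply: le_trans (oper_comp_norm _ _) _; apply: ler_pM => //;
    [exact: dQ'M|exact: P'M|exact: Q'M|exact: dP'M].
have h4 : `|tens_lift VV (B u - B s) (XX u t)| <= 2 * N * (M * M') * w s t ^+ 3.
  apply: le_trans (tens_lift_le _ _) _.
  apply: le_trans (ler_pM _ _ BB (X2 uT tT')) _ => //.
  rewrite (_ : _ * (N * _) = 2 * N * (M * M') * (w s u ^+ 1 * w u t ^+ 2)); last by ring.
  by rewrite ler_wpM2l ?mulr_ge0// cube_le.
rewrite normrN; apply: le_trans (ler_normD _ _) _.
apply: le_trans (lerD (ler_normD _ _) (ler_normD _ _)) _.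
apply: le_trans (lerD (lerD h1 h2) (lerD h3 h4)) _.
by rewrite le_eqVlt; apply/orP; left; apply/eqP; ring.
Qed.

End RoughCalculus.

(** * Iterated integrals of controlled paths *)

Section OrientedIntegral.
Context {R : realType} {K : normedModType R} (T : R) (Xi : R -> R -> K).
Hypothesis XiS : forall s t, 0 <= s -> s <= t -> t <= T -> exists l, sews Xi s t l.

Lemma germ_integral_sews s t : 0 <= s -> s <= t -> t <= T ->
  sews Xi s t (germ_integral Xi s t).
Proof using XiS.
move=> s0 st tT; have [l Xil] := XiS s0 st tT.
by have [_ ->] := sews_germ_integral st Xil.
Qed.

Lemma germ_integral_swap (Xi' : R -> R -> K) s t : t < s ->
  germ_integral Xi' s t = - germ_integral Xi' t s.
Proof. by move=> ts; rewrite /germ_integral leNgt ts/= (ltW ts). Qed.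

Lemma germ_integral_from0 s t : 0 <= s <= T -> 0 <= t <= T ->
  germ_integral Xi s t = germ_integral Xi 0 t - germ_integral Xi 0 s.
Proof using XiS.
have add u v : 0 <= u -> u <= v -> v <= T ->
    germ_integral Xi 0 v = germ_integral Xi 0 u + germ_integral Xi u v.
  move=> u0 uv vT; apply: (sews_additive (K := K) u0 uv);
    apply: germ_integral_sews => //; lra.
move=> /andP[s0 sT] /andP[t0 tT]; have [st|ts] := leP s t.
  by rewrite (add s t)//; module_eq.
rewrite germ_integral_swap//.
by rewrite (add t s t0 (ltW ts) sT); module_eq.
Qed.

Lemma germ_integral_additive s u t :
  0 <= s <= T -> 0 <= u <= T -> 0 <= t <= T ->
  germ_integral Xi s t = germ_integral Xi s u + germ_integral Xi u t.
Proof using XiS.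
move=> sT uT tT; rewrite (germ_integral_from0 sT tT) (germ_integral_from0 sT uT).
by rewrite (germ_integral_from0 uT tT); module_eq.
Qed.

End OrientedIntegral.

Lemma germ_integral_linear {R : realType} {K : normedModType R} (T : R)
    (Xi Xi' : R -> R -> K) c s t :
  (forall s t, 0 <= s -> s <= t -> t <= T -> exists l, sews Xi s t l) ->
  (forall s t, 0 <= s -> s <= t -> t <= T -> exists l, sews Xi' s t l) ->
  0 <= s <= T -> 0 <= t <= T ->
  germ_integral (fun u v => c *: Xi u v + Xi' u v) s t
  = c *: germ_integral Xi s t + germ_integral Xi' s t.
Proof.
move=> XiS XiS'.
have fwd u v : 0 <= u -> u <= v -> v <= T ->
    germ_integral (fun u v => c *: Xi u v + Xi' u v) u v
    = c *: germ_integral Xi u v + germ_integral Xi' u v.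
  move=> u0 uv vT; apply: (sews_germ_integral uv _).2.
  by apply: sews_linear; apply: (germ_integral_sews (T := T)).
move=> /andP[s0 sT] /andP[t0 tT]; have [st|ts] := leP s t; first exact: fwd.
by rewrite ![germ_integral _ s t]germ_integral_swap// fwd ?(ltW ts)//; module_eq.
Qed.

Section IteratedIntegral.
Context {R : realType} {V : completeNormedModType R} (VV : proj_tensor V).
Context (T alpha : R) (X : R -> V) (XX : R -> R -> VV) (N : R).
Hypothesis XN : rough_path_le T alpha X XX N.
Hypotheses (T0 : 0 <= T) (a13 : 3^-1 < alpha).
Implicit Types (p : (R -> V) * (R -> 'L(V, V)))
  (q : (R -> 'L(V, V)) * (R -> 'L(V, 'L(V, V)))) (s u t M : R).

Let N0 : 0 <= N. Proof. by case: XN. Qed.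
Let g1 : 1 < 3 * alpha. Proof. by move: a13; lra. Qed.

Local Notation w s t := (`|t - s : R| `^ alpha).
Local Notation ctrl := (ctrl_le T alpha X).
Local Notation oper_ctrl := (oper_ctrl_le T alpha X).

Lemma iter_germ_sews p q M M' s t : ctrl M p -> oper_ctrl M' q ->
  0 <= s -> s <= t -> t <= T -> exists l, sews (iter_germ XX q p) s t l.
Proof using XN a13.
move=> pM qM; have [M0 M'0] : 0 <= M /\ 0 <= M' by case: pM; case: qM.
apply: (sewing_exists _ g1 (iter_germ_almost_additive XN a13 pM qM)).
by rewrite !mulr_ge0// addr_ge0// mulr_ge0.
Qed.

(** The second-level integral [int d q_r (p_r - p_s)], oriented as
   [germ_integral] is. *)
Definition iter_int q p s t : V :=
  germ_integral (iter_germ XX q p) s t - (q.1 t - q.1 s) (p.1 s).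

(** The integral itself is additive: the whole defect comes from the subtracted
   product of increments. *)
Lemma iter_int_chen p q M M' s u t : ctrl M p -> oper_ctrl M' q ->
  0 <= s <= T -> 0 <= u <= T -> 0 <= t <= T ->
  iter_int q p s t - iter_int q p s u - iter_int q p u t
  = (q.1 t - q.1 u) (p.1 u - p.1 s).
Proof using XN a13.
move=> pM qM sT uT tT; rewrite /iter_int.
rewrite (germ_integral_additive _ sT uT tT); last first.
  by move=> s' t' s'0 st' t'T; exact: (iter_germ_sews pM qM s'0 st' t'T).
by rewrite operB !oper_subE; module_eq.
Qed.

Definition iter_const : R := sewing_const (1 + 4 * N) (3 * alpha).

Let iter_const_ge0 : 0 <= iter_const.
Proof. by apply: sewing_const_ge0 => //; rewrite addr_ge0// mulr_ge0. Qed.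

Lemma iter_int_local p q M M' s t : ctrl M p -> oper_ctrl M' q ->
  0 <= s -> s <= t -> t <= T ->
  `|iter_int q p s t - tens_lift VV (oper_comp (q.2 s) (p.2 s)) (XX s t)|
    <= iter_const * (M * M') * w s t ^+ 3.
Proof using XN a13.
move=> pM qM s0 st tT; have [M0 M'0] : 0 <= M /\ 0 <= M' by case: pM; case: qM.
have C0 : 0 <= (1 + 4 * N) * (M * M').
  by rewrite !mulr_ge0// addr_ge0// mulr_ge0.
have S : sews (iter_germ XX q p) s t (germ_integral (iter_germ XX q p) s t).
  apply: (germ_integral_sews (T := T)) => //.
  by move=> s' t' s'0 st' t'T; exact: (iter_germ_sews pM qM s'0 st' t'T).
have h := sewing_bound C0 g1 (iter_germ_almost_additive XN a13 pM qM) s0 st tT S.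
rewrite /iter_int -addrA -opprD [`|t - s|]ger0_norm ?subr_ge0// -powR3M.
rewrite [iter_const * _](_ : _ = sewing_const ((1 + 4 * N) * (M * M')) (3 * alpha)) //.
by rewrite /iter_const /sewing_const; ring.
Qed.

Definition iter_bound : R := iter_const * T `^ alpha + N + 1.

Lemma iter_bound_ge0 : 0 <= iter_bound.
Proof using XN a13 T0. by rewrite /iter_bound !addr_ge0// mulr_ge0// powR_ge0. Qed.

(** For [t < s] the iterated integral is not the opposite of the one from [t] to
   [s]; the Chen relation over [s], [t], [s] computes it from the latter. *)
Lemma iter_int_le p q M M' s t : ctrl M p -> oper_ctrl M' q ->
  0 <= s <= T -> 0 <= t <= T ->
  `|iter_int q p s t| <= iter_bound * (M * M') * w s t ^+ 2.
Proof using XN a13 T0.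
move=> pM qM; have [M0 M'0] : 0 <= M /\ 0 <= M' by case: pM; case: qM.
have fwd s' t' : 0 <= s' -> s' <= t' -> t' <= T ->
    `|iter_int q p s' t'| <= (iter_bound - 1) * (M * M') * w s' t' ^+ 2.
  move=> s0 st tT; have h := iter_int_local pM qM s0 st tT.
  have s'T : 0 <= s' <= T by rewrite s0 (le_trans st).
  have t'T : 0 <= t' <= T by rewrite (le_trans s0).
  have hB : `|tens_lift VV (oper_comp (q.2 s') (p.2 s')) (XX s' t')|
      <= N * (M * M') * w s' t' ^+ 2.
    apply: le_trans (tens_lift_le _ _) _.
    rewrite [leRHS](_ : _ = M' * M * (N * w s' t' ^+ 2)); last by ring.
    apply: ler_pM => //; last first.
      by case: XN => _ _ X2 _; rewrite -powR2M; exact: X2.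
    apply: le_trans (oper_comp_norm _ _) _; apply: ler_pM => //.
      by case: qM => _ q2 _ _ _; exact: q2.
    by case: pM => _ p2 _ _ _; exact: p2.
  have wT : w s' t' <= T `^ alpha.
    have a0 : 0 <= alpha by move: a13; lra.
    rewrite ger0_norm ?subr_ge0//; apply: ge0_ler_powR; rewrite ?nnegrE//; lra.
  rewrite -[iter_int _ _ _ _](subrK
    (tens_lift VV (oper_comp (q.2 s') (p.2 s')) (XX s' t'))).
  apply: le_trans (ler_normD _ _) _; apply: le_trans (lerD h hB) _.
  rewrite /iter_bound addrK mulrDl mulrDl lerD2r.
  rewrite [leRHS](_ : _ = iter_const * (M * M') * (T `^ alpha * w s' t' ^+ 2)); last by ring.
  rewrite [w s' t' ^+ 3]exprS; apply: ler_wpM2l.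
    by rewrite mulr_ge0// mulr_ge0.
  by apply: ler_wpM2r => //; rewrite exprn_ge0// powR_ge0.
move=> sT tT; have w2 : 0 <= M * M' * w s t ^+ 2.
  by rewrite !mulr_ge0// exprn_ge0// powR_ge0.
have [st|ts] := leP s t.
  have /andP[s0 _] := sT; have /andP[_ tT'] := tT.
  apply: le_trans (fwd s t s0 st tT') _; rewrite -!mulrA; lra.
have /andP[t0 _] := tT; have /andP[_ sT'] := sT.
have ss : iter_int q p s s = 0.
  rewrite /iter_int subrr oper_zeroE subr0.
  by rewrite /germ_integral lexx; have [_] := sews_germ_integral (lexx s)
    (sews_xx (iter_germ XX q p) s); rewrite /germ_integral lexx.
have := iter_int_chen pM qM sT tT sT; rewrite ss sub0r.
have := fwd t s t0 (ltW ts) sT'; rewrite [`|s - t|]distrC => h1 h2.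
have -> : iter_int q p s t =
    - (iter_int q p t s + (q.1 s - q.1 t) (p.1 t - p.1 s)).
  by rewrite -h2; module_eq.
rewrite normrN; apply: le_trans (ler_normD _ _) _.
have h3 : `|(q.1 s - q.1 t) (p.1 t - p.1 s)| <= M * M' * w s t ^+ 2.
  rewrite [leRHS](_ : _ = M' * w s t * (M * w s t)); last by ring.
  apply: oper_norm_leM.
    by case: qM => _ _ q1 _ _; rewrite [`|t - s|]distrC; exact: q1.
  by case: pM => _ _ p1 _ _; exact: p1.
by apply: le_trans (lerD h1 h3) _; rewrite -!mulrA; lra.
Qed.

Lemma iter_int_linearl c p q q' M M1 M2 s t :
  ctrl M p -> oper_ctrl M1 q -> oper_ctrl M2 q' -> 0 <= s <= T -> 0 <= t <= T ->
  iter_int (c *: q + q') p s t = c *: iter_int q p s t + iter_int q' p s t.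
Proof using XN a13.
move=> pM qM qM'.
have germE : iter_germ XX (c *: q + q') p =
    (fun u v => c *: iter_germ XX q p u v + iter_germ XX q' p u v).
  apply/funext => u; apply/funext => v; rewrite /iter_germ.
  have -> : oper_comp ((c *: q + q').2 u) (p.2 u) =
     c *: oper_comp (q.2 u) (p.2 u) + oper_comp (q'.2 u) (p.2 u).
    exact: oper_eqP.
  rewrite tens_liftD tens_liftZ.
  rewrite -[X in X + _ = _]/((c *: q.1 v (p.1 u) + q'.1 v (p.1 u)) -
     (c *: q.1 u (p.1 u) + q'.1 u (p.1 u))).
  by rewrite !oper_subE; module_eq.
move=> sT tT; rewrite /iter_int germE (germ_integral_linear (T := T))//; last 2 first.
- by move=> s' t' s'0 st' t'T; exact: (iter_germ_sews pM qM s'0 st' t'T).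
- by move=> s' t' s'0 st' t'T; exact: (iter_germ_sews pM qM' s'0 st' t'T).
rewrite -[((c *: q + q').1 t - _) _]/((c *: q.1 t (p.1 s) + q'.1 t (p.1 s)) -
     (c *: q.1 s (p.1 s) + q'.1 s (p.1 s))).
by rewrite !oper_subE; module_eq.
Qed.

Lemma iter_int_linearr c p p' q M M1 M2 s t :
  ctrl M1 p -> ctrl M2 p' -> oper_ctrl M q -> 0 <= s <= T -> 0 <= t <= T ->
  iter_int q (c *: p + p') s t = c *: iter_int q p s t + iter_int q p' s t.
Proof using XN a13.
move=> pM pM' qM.
have germE : iter_germ XX q (c *: p + p') =
    (fun u v => c *: iter_germ XX q p u v + iter_germ XX q p' u v).
  apply/funext => u; apply/funext => v; rewrite /iter_germ.
  have -> : oper_comp (q.2 u) ((c *: p + p').2 u) =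
     c *: oper_comp (q.2 u) (p.2 u) + oper_comp (q.2 u) (p'.2 u).
    apply: oper_eqP => x.
    rewrite -[LHS]/(q.2 u (c *: p.2 u x + p'.2 u x)).
    by rewrite oper_linear.
  rewrite tens_liftD tens_liftZ -[(c *: p + p').1 u]/(c *: p.1 u + p'.1 u).
  by rewrite oper_linear; module_eq.
move=> sT tT; rewrite /iter_int germE (germ_integral_linear (T := T))//; last 2 first.
- by move=> s' t' s'0 st' t'T; exact: (iter_germ_sews pM qM s'0 st' t'T).
- by move=> s' t' s'0 st' t'T; exact: (iter_germ_sews pM' qM s'0 st' t'T).
rewrite -[(c *: p + p').1 s]/(c *: p.1 s + p'.1 s) oper_linear; module_eq.
Qed.

Lemma ctrl_leD p p' M M' : ctrl M p -> ctrl M' p' -> ctrl (M + M') (p + p').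
Proof.
case=> M0 p2 dp dp2 rp [M'0 p2' dp' dp2' rp']; split=> [|s sT|s t sT tT|s t sT tT|s t sT tT].
- exact: addr_ge0.
- by apply: le_trans (ler_normD _ _) _; rewrite lerD ?p2 ?p2'.
- rewrite mulrDl; apply: le_trans (lerD (dp s t sT tT) (dp' s t sT tT)).
  apply: le_trans (ler_normD _ _); rewrite le_eqVlt; apply/orP; left.
  apply/eqP; congr (`|_|).
  by rewrite -[LHS]/((p.1 t + p'.1 t) - (p.1 s + p'.1 s)); module_eq.
- rewrite mulrDl; apply: le_trans (lerD (dp2 s t sT tT) (dp2' s t sT tT)).
  apply: le_trans (ler_normD _ _); rewrite le_eqVlt; apply/orP; left.
  apply/eqP; congr (`|_|).
  by rewrite -[LHS]/((p.2 t + p'.2 t) - (p.2 s + p'.2 s)); module_eq.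
- rewrite mulrDl; apply: le_trans (lerD (rp s t sT tT) (rp' s t sT tT)).
  apply: le_trans (ler_normD _ _); rewrite le_eqVlt; apply/orP; left.
  apply/eqP; congr (`|_|).
  rewrite -[LHS]/((p.1 t + p'.1 t) - (p.1 s + p'.1 s) -
     (p.2 s (X t - X s) + p'.2 s (X t - X s))).
  by module_eq.
Qed.

Lemma oper_ctrl_leD q q' M M' :
  oper_ctrl M q -> oper_ctrl M' q' -> oper_ctrl (M + M') (q + q').
Proof.
case=> M0 p2 dp dp2 rp [M'0 p2' dp' dp2' rp']; split=> [|s sT|s t sT tT|s t sT tT|s t a sT tT].
- exact: addr_ge0.
- by apply: le_trans (ler_normD _ _) _; rewrite lerD ?p2 ?p2'.
- rewrite mulrDl; apply: le_trans (lerD (dp s t sT tT) (dp' s t sT tT)).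
  apply: le_trans (ler_normD _ _); rewrite le_eqVlt; apply/orP; left.
  apply/eqP; congr (`|_|).
  by rewrite -[LHS]/((q.1 t + q'.1 t) - (q.1 s + q'.1 s)); module_eq.
- rewrite mulrDl; apply: le_trans (lerD (dp2 s t sT tT) (dp2' s t sT tT)).
  apply: le_trans (ler_normD _ _); rewrite le_eqVlt; apply/orP; left.
  apply/eqP; congr (`|_|).
  by rewrite -[LHS]/((q.2 t + q'.2 t) - (q.2 s + q'.2 s)); module_eq.
- rewrite 2!mulrDl; apply: le_trans (lerD (rp s t a sT tT) (rp' s t a sT tT)).
  apply: le_trans (ler_normD _ _); rewrite le_eqVlt; apply/orP; left.
  apply/eqP; congr (`|_|).
  rewrite -[LHS]/((q.1 t a + q'.1 t a) - (q.1 s a + q'.1 s a) -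
     (q.2 s a (X t - X s) + q'.2 s a (X t - X s))).
  by module_eq.
Qed.

End IteratedIntegral.

(** * Bilinear maps of C1 families *)

Section BilinearC1.
Context {R : realType}.

(** A C1 map into a vector space of paths.  The space carries no norm: [n M e]
   says that the size of [e] is at most [M], and only such bounds, which are
   subadditive, are available. *)
Definition C1_family {U : normedModType R} {E : lmodType R} (n : R -> E -> Prop)
    (q : U -> E) (dq : U -> U -> E) (m0 m1 : U -> R) : Prop :=
  [/\ forall y, n (m0 y) (q y),
      forall y b, n (m1 y * `|b|) (dq y b),
      forall y c b b', dq y (c *: b + b') = c *: dq y b + dq y b',
      forall y e, 0 < e -> exists2 d, 0 < d & forall b, `|b| < d ->
        n (e * `|b|) (q (y + b) - q y - dq y b)
    & forall y e, 0 < e -> exists2 d, 0 < d & forall b, `|b| < d -> forall c,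
        n (e * `|c|) (dq (y + b) c - dq y c)].

Context {U1 U2 K : normedModType R} {E F : lmodType R}.
Context (nE : R -> E -> Prop) (nF : R -> F -> Prop) (J : E -> F -> K) (C : R).
Hypotheses (C0 : 0 <= C)
  (nE0 : forall M e, nE M e -> 0 <= M) (nF0 : forall M e, nF M e -> 0 <= M)
  (nED : forall M M' e e', nE M e -> nE M' e' -> nE (M + M') (e + e'))
  (nFD : forall M M' e e', nF M e -> nF M' e' -> nF (M + M') (e + e'))
  (JC : forall M N e f, nE M e -> nF N f -> `|J e f| <= C * (M * N))
  (Jl : forall M M' N c e e' f, nE M e -> nE M' e' -> nF N f ->
     J (c *: e + e') f = c *: J e f + J e' f)
  (Jr : forall M N N' c e f f', nE M e -> nF N f -> nF N' f' ->
     J e (c *: f + f') = c *: J e f + J e f').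
Context (q : U2 -> E) (dq : U2 -> U2 -> E) (mq0 mq1 : U2 -> R)
  (p : U1 -> F) (dp : U1 -> U1 -> F) (mp0 mp1 : U1 -> R).
Hypotheses (qC : C1_family nE q dq mq0 mq1) (pC : C1_family nF p dp mp0 mp1).

Let JDl M M' N e e' f : nE M e -> nE M' e' -> nF N f ->
  J (e + e') f = J e f + J e' f.
Proof. by move=> h h' h''; rewrite -{1}[e]scale1r (Jl _ h h' h'') scale1r. Qed.

Let JDr M N N' e f f' : nE M e -> nF N f -> nF N' f' ->
  J e (f + f') = J e f + J e f'.
Proof. by move=> h h' h''; rewrite -{1}[f]scale1r (Jr _ h h' h'') scale1r. Qed.

Let norm1 (w : U1 * U2) : `|w.1| <= `|w|.
Proof. by rewrite prod_normE le_max lexx. Qed.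

Let norm2 (w : U1 * U2) : `|w.2| <= `|w|.
Proof. by rewrite prod_normE le_max lexx orbT. Qed.

Definition bilinear_derivative_fun (z w : U1 * U2) : K :=
  J (q z.2) (dp z.1 w.1) + J (dq z.2 w.2) (p z.1).

Definition bilinear_derivative_bound (z : U1 * U2) : R :=
  C * (mq0 z.2 * mp1 z.1 + mq1 z.2 * mp0 z.1).

Let mp0_ge0 x : 0 <= mp0 x.
Proof. by case: pC => p0 _ _ _ _; exact: nF0 (p0 x). Qed.

Let mq0_ge0 x : 0 <= mq0 x.
Proof. by case: qC => q0 _ _ _ _; exact: nE0 (q0 x). Qed.

Let slope_le (U : normedModType R) (m : R) (b : U) (M : R) :
  0 <= m * `|b| -> `|b| <= M -> m * `|b| <= `|m| * M.
Proof.
move=> mb bM; rewrite -(ger0_norm mb) normrM normr_id.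
by apply: ler_pM.
Qed.

Lemma bilinear_derivative_le z w :
  `|bilinear_derivative_fun z w| <=
  C * (mq0 z.2 * `|mp1 z.1| + `|mq1 z.2| * mp0 z.1) * `|w|.
Proof using qC pC nE0 nF0 JC C0.
case: qC pC => q0 q1 _ _ _ [p0 p1 _ _ _].
apply: le_trans (ler_normD _ _) _.
apply: le_trans (lerD (JC (q0 _) (p1 _ _)) (JC (q1 _ _) (p0 _))) _.
rewrite -mulrDr -[leRHS]mulrA; apply: ler_wpM2l => //.
rewrite mulrDl [X in _ <= _ + X]mulrAC; apply: lerD.
  by rewrite -mulrA ler_wpM2l// slope_le// (nF0 (p1 _ _)).
by rewrite ler_wpM2r// slope_le// (nE0 (q1 _ _)).
Qed.

Fact bilinear_derivative_subproof z :
  bilinear_derivative_fun z \in is_oper (U1 * U2)%type K.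
Proof using All.
case: qC pC => q0 q1 ql _ _ [p0 p1 pl _ _].
apply: (is_oper_bound _ (bilinear_derivative_le z)).
move=> a [w1 w2] [w1' w2']; case: z => x y; rewrite /bilinear_derivative_fun /=.
rewrite pl ql (Jr _ (q0 y) (p1 x w1) (p1 x w1')).
by rewrite (Jl _ (q1 y w2) (q1 y w2') (p0 x)); module_eq.
Qed.

Definition bilinear_derivative z : 'L((U1 * U2)%type, K) :=
  Oper (bilinear_derivative_subproof z).

Lemma bilinear_derivative_norm z : (forall x, 0 <= mp1 x) -> (forall y, 0 <= mq1 y) ->
  `|bilinear_derivative z| <= bilinear_derivative_bound z.
Proof.
move=> mp1_ge0 mq1_ge0; apply: oper_le => [|w].
  by rewrite mulr_ge0// addr_ge0// mulr_ge0.
by have := bilinear_derivative_le z w; rewrite !ger0_norm.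
Qed.

(** Leibniz rule: bilinearity leaves the two first-order remainders and the
   product of the two increments. *)
Lemma bilinear_has_frechet z :
  has_frechet (fun z : U1 * U2 => J (q z.2) (p z.1)) z (bilinear_derivative z).
Proof.
case: qC pC => q0 q1 ql qd _ [p0 p1 pl pd _]; case: z => x y e e0.
pose A := C * (mp0 x + mq0 y + (`|mq1 y| + 1) * (`|mp1 x| + 1)) + 1.
have A0 : 0 < A.
  by rewrite /A ltr_wpDl// mulr_ge0// !addr_ge0// mulr_ge0// addr_ge0.
pose e' := Num.min 1 (e / A).
have e'0 : 0 < e' by rewrite lt_min ltr01 divr_gt0.
have e'1 : e' <= 1 by rewrite ge_min lexx.
have e'A : e' <= e / A by rewrite ge_min lexx orbT.
clearbody e'.
have [d d0 Hd] := qd y e' e'0; have [d' d'0 Hd'] := pd x e' e'0.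
exists (Num.min e' (Num.min d d')); first by rewrite !lt_min e'0 d0.
move=> [a b] /=; rewrite !lt_min => /and3P[he hd hd'].
set h := `|(a, b)| in he hd hd' *.
have ha : `|a| <= h by exact: (norm1 (a, b)).
have hb : `|b| <= h by exact: (norm2 (a, b)).
have {}Hd := Hd b (le_lt_trans hb hd); have {}Hd' := Hd' a (le_lt_trans ha hd').
set rq := q (y + b) - q y - dq y b in Hd; set rp := p (x + a) - p x - dp x a in Hd'.
have dqE : q (y + b) = q y + (dq y b + rq).
  by rewrite /rq; module_eq.
have dpE : p (x + a) = p x + (dp x a + rp).
  by rewrite /rp; module_eq.
clearbody rq rp; rewrite /bilinear_derivative_fun /=.
have nq := nED (q1 y b) Hd; have np := nFD (p1 x a) Hd'.
have -> : J (q (y + b)) (p (x + a)) - J (q y) (p x) -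
    (J (q y) (dp x a) + J (dq y b) (p x)) =
    J rq (p x) + J (q y) rp + J (dq y b + rq) (dp x a + rp).
  rewrite dqE dpE (JDl (q0 y) nq (nFD (p0 x) np)).
  rewrite (JDr (q0 y) (p0 x) np) (JDr nq (p0 x) np).
  by rewrite (JDr (q0 y) (p1 x a) Hd') (JDl (q1 y b) Hd (p0 x)); module_eq.
have hb1 : mq1 y * `|b| + e' * `|b| <= (`|mq1 y| + 1) * h.
  rewrite mulrDl lerD//; first by rewrite slope_le// (nE0 (q1 _ _)).
  by apply: ler_pM => //; exact: ltW.
have ha1 : mp1 x * `|a| + e' * `|a| <= (`|mp1 x| + 1) * h.
  rewrite mulrDl lerD//; first by rewrite slope_le// (nF0 (p1 _ _)).
  by apply: ler_pM => //; exact: ltW.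
have h0 : 0 <= h by exact: normr_ge0.
have e'h : e' * h * A <= e * h.
  by rewrite mulrAC ler_wpM2r// -ler_pdivlMr.
apply: le_trans (ler_normD _ _) _; apply: le_trans (lerD (ler_normD _ _) (lexx _)) _.
apply: le_trans (lerD (lerD (JC Hd (p0 x)) (JC (q0 y) Hd')) (JC nq np)) _.
apply: le_trans e'h.
rewrite -!mulrDr [leRHS](_ : _ = C * (e' * h * mp0 x + mq0 y * (e' * h) +
  (`|mq1 y| + 1) * e' * ((`|mp1 x| + 1) * h)) + e' * h); last first.
  by rewrite /A; ring.
rewrite -[leLHS]addr0 lerD ?mulr_ge0 ?(ltW e'0)//.
rewrite ler_wpM2l// lerD//.
  rewrite lerD//; first by rewrite ler_wpM2r// ler_wpM2l// ltW.
  by rewrite ler_wpM2l// ler_wpM2l// ltW.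
apply: ler_pM => //; [exact: nE0 nq|exact: nF0 np|].
by apply: le_trans hb1 _; rewrite ler_wpM2l ?addr_ge0// ltW.
Qed.

Lemma bilinear_derivative_continuous : continuous bilinear_derivative.
Proof.
case: qC pC => q0 q1 ql qd qc [p0 p1 pl pd pc] [x y].
apply: (@continuous_at_eps _ (U1 * U2)%type) => e e0.
pose A := C * ((`|mq1 y| + 1) * (`|mp1 x| + 1) * 2 + mp0 x + mq0 y) + 1.
have A0 : 0 < A.
  by rewrite /A ltr_wpDl// mulr_ge0// !addr_ge0// !mulr_ge0// addr_ge0.
pose e' := Num.min 1 (e / A).
have e'0 : 0 < e' by rewrite lt_min ltr01 divr_gt0.
have e'1 : e' <= 1 by rewrite ge_min lexx.
have e'A : e' <= e / A by rewrite ge_min lexx orbT.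
clearbody e'.
have [d d0 Hd] := qd y e' e'0; have [d' d'0 Hd'] := pd x e' e'0.
have [c c0 Hc] := qc y e' e'0; have [c' c'0 Hc'] := pc x e' e'0.
exists (Num.min e' (Num.min (Num.min d d') (Num.min c c'))).
  by rewrite !lt_min e'0 d0 d'0 c0 c'0.
move=> [a b]; rewrite !lt_min => /and3P[he /andP[hd hd'] /andP[hc hc']].
set h := `|(a, b)| in he hd hd' hc hc'.
have ha : `|a| <= h by exact: (norm1 (a, b)).
have hb : `|b| <= h by exact: (norm2 (a, b)).
have {}Hd := Hd b (le_lt_trans hb hd); have {}Hd' := Hd' a (le_lt_trans ha hd').
have {}Hc := Hc b (le_lt_trans hb hc); have {}Hc' := Hc' a (le_lt_trans ha hc').
have h0 : 0 <= h by exact: normr_ge0.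
have nq : nE (mq1 y * `|b| + e' * `|b|) (q (y + b) - q y).
  by have := nED (q1 y b) Hd; rewrite [X in nE _ X]addrC subrK.
have np : nF (mp1 x * `|a| + e' * `|a|) (p (x + a) - p x).
  by have := nFD (p1 x a) Hd'; rewrite [X in nF _ X]addrC subrK.
have hb1 : mq1 y * `|b| + e' * `|b| <= (`|mq1 y| + 1) * e'.
  rewrite mulrDl lerD//.
    by rewrite slope_le ?(nE0 (q1 _ _))// (le_trans hb)// ltW.
  by apply: ler_pM => //; rewrite ?(ltW e'0)// (le_trans hb)// ltW.
have ha1 : mp1 x * `|a| + e' * `|a| <= (`|mp1 x| + 1) * e'.
  rewrite mulrDl lerD//.
    by rewrite slope_le ?(nF0 (p1 _ _))// (le_trans ha)// ltW.
  by apply: ler_pM => //; rewrite ?(ltW e'0)// (le_trans ha)// ltW.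
apply: oper_le; first exact: ltW.
move=> w; set k := `|w|.
have wa : `|w.1| <= k by exact: norm1.
have wb : `|w.2| <= k by exact: norm2.
have np1 := nFD (p1 x w.1) (Hc' w.1).
have nq1 := nED (q1 y w.2) (Hc w.2).
rewrite [X in nF _ X]addrC subrK in np1; rewrite [X in nE _ X]addrC subrK in nq1.
rewrite oper_subE -[X in `|X|]/(
  (J (q (y + b)) (dp (x + a) w.1) + J (dq (y + b) w.2) (p (x + a))) -
  (J (q y) (dp x w.1) + J (dq y w.2) (p x))).
have E1 : J (q (y + b)) (dp (x + a) w.1) - J (q y) (dp x w.1) =
    J (q (y + b) - q y) (dp (x + a) w.1) + J (q y) (dp (x + a) w.1 - dp x w.1).
  rewrite -{1}(subrK (q y) (q (y + b))) (JDl nq (q0 y) np1).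
  rewrite -{2}(subrK (dp x w.1) (dp (x + a) w.1)).
  by rewrite (JDr (q0 y) (Hc' w.1) (p1 x w.1)); module_eq.
have E2 : J (dq (y + b) w.2) (p (x + a)) - J (dq y w.2) (p x) =
    J (dq (y + b) w.2) (p (x + a) - p x) + J (dq (y + b) w.2 - dq y w.2) (p x).
  rewrite -{1}(subrK (p x) (p (x + a))) (JDr nq1 np (p0 x)).
  rewrite -{2}(subrK (dq y w.2) (dq (y + b) w.2)).
  by rewrite (JDl (Hc w.2) (q1 y w.2) (p0 x)); module_eq.
rewrite opprD addrACA E1 E2 {E1 E2}.
have k0 : 0 <= k by exact: normr_ge0.
have hp1 : mp1 x * `|w.1| + e' * `|w.1| <= (`|mp1 x| + 1) * k.
  rewrite mulrDl lerD//; first by rewrite slope_le// (nF0 (p1 _ _)).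
  by apply: ler_pM => //; exact: ltW.
have hq1 : mq1 y * `|w.2| + e' * `|w.2| <= (`|mq1 y| + 1) * k.
  rewrite mulrDl lerD//; first by rewrite slope_le// (nE0 (q1 _ _)).
  by apply: ler_pM => //; exact: ltW.
have e'k : e' * k * A <= e * k by rewrite mulrAC ler_wpM2r// -ler_pdivlMr.
apply: le_trans (ler_normD _ _) _; apply: le_trans (lerD (ler_normD _ _) (ler_normD _ _)) _.
apply: le_trans (lerD (lerD (JC nq np1) (JC (q0 y) (Hc' w.1)))
  (lerD (JC nq1 np) (JC (Hc w.2) (p0 x)))) _.
apply: le_trans e'k.
rewrite -!mulrDr [leRHS](_ : _ = C * (((`|mq1 y| + 1) * e' * ((`|mp1 x| + 1) * k) +
  mq0 y * (e' * k)) + ((`|mq1 y| + 1) * k * ((`|mp1 x| + 1) * e') +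
  e' * k * mp0 x)) + e' * k); last first.
  by rewrite /A; ring.
rewrite -[leLHS]addr0 lerD ?mulr_ge0 ?(ltW e'0)//.
rewrite ler_wpM2l// lerD// lerD//.
- by apply: ler_pM => //; [exact: nE0 nq|exact: nF0 np1].
- by rewrite ler_wpM2l// ler_wpM2l// ltW.
- by apply: ler_pM => //; [exact: nE0 nq1|exact: nF0 np].
- by rewrite ler_wpM2r// ler_wpM2l// ltW.
Qed.

End BilinearC1.

(** * Smooth functions along the path *)

Lemma lt_sum_pinfty {R : realType} n (F : 'I_n -> \bar R) i :
  (forall i, (0 <= F i)%E) -> (\sum_(i < n) F i < +oo)%E -> (F i < +oo)%E.
Proof.
move=> F0; apply: le_lt_trans; rewrite (bigD1 i)//=; apply: leeDl.
by apply: sume_ge0 => j _; exact: F0.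
Qed.

Section SmoothFamilies.
Context {R : realType} {V : completeNormedModType R}.
Context (beta : 'I_3 -> R) (f : V -> V -> V).
Hypothesis f_C : @C_loc R V 3 2 beta f.
Local Notation F k j := (D2n k (D1n j f)).

Lemma D1n_has_frechet j z y : (j < 3)%N ->
  has_frechet (D1n j f ^~ y) z (D1n j.+1 f z y).
Proof.
by move=> j3; case: f_C => f1 _ _ _; apply: has_frechet_frechet; exact: f1.
Qed.

Lemma D2n_has_frechet k j z y : (j <= 3)%N -> (k < 2)%N ->
  has_frechet (F k j z) y (F k.+1 j z y).
Proof.
by move=> j3 k2; case: f_C => _ f2 _ _; apply: has_frechet_frechet; exact: f2.
Qed.

Lemma D2n_continuous k j : (j <= 3)%N -> (k <= 2)%N ->
  continuous (fun p : V * V => F k j p.1 p.2).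
Proof. by move=> j3 k2; case: f_C => _ _ fc _; exact: fc. Qed.

(** The hypotheses give the derivatives taken in the first variable before the
   second; here the first variable comes last.  Freezing a direction [a] turns
   the case of two derivatives in the second variable into that of one. *)
Lemma D21_has_frechet j a z y : (j < 3)%N ->
  has_frechet (fun z => D2 (D1n j f) z y a) z (D2 (D1n j.+1 f) z y a).
Proof.
move=> j3; apply: (@frechet_swap _ _ _ _ (D1n j f) (D1n j.+1 f)
  (D2 (D1n j f)) (D2 (D1n j.+1 f))) => [z' y'|z' y'|z' y'|].
- exact: D1n_has_frechet.
- by apply: (@D2n_has_frechet 0) => //; exact: ltnW.
- exact: (@D2n_has_frechet 0 j.+1).
- exact: (@D2n_continuous 1 j.+1).
Qed.

Lemma D22_has_frechet j a b z y : (j < 3)%N ->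
  has_frechet (fun z => F 2 j z y b a) z (F 2 j.+1 z y b a).
Proof.
move=> j3; apply: (@frechet_swap _ _ _ _ (fun z y => F 1 j z y a)
  (fun z y => F 1 j.+1 z y a)
  (fun z y => oper_comp (oper_eval a) (F 2 j z y))
  (fun z y => oper_comp (oper_eval a) (F 2 j.+1 z y))) => [z' y'|z' y'|z' y'|].
- exact: D21_has_frechet.
- apply: (has_frechet_comp_oper (oper_eval a)).
  by apply: (@D2n_has_frechet 1) => //; exact: ltnW.
- apply: (has_frechet_comp_oper (oper_eval a)).
  exact: (@D2n_has_frechet 1 j.+1).
- apply: continuous_oper_comp.
  exact: (@D2n_continuous 2 j.+1).
Qed.

Lemma D1n2_sym z y v w : D1 (D1 f) z y v w = D1 (D1 f) z y w v.
Proof.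
apply: (@second_derivative_sym _ _ _ (f ^~ y) (D1 f ^~ y) (D1 (D1 f) ^~ y)) => //.
- by move=> z'; exact: (@D1n_has_frechet 0).
- by move=> z'; exact: (@D1n_has_frechet 1).
- exact: has_frechet_continuous (@D1n_has_frechet 2 z y isT).
Qed.

(** Two derivatives in [y] of the same function, by the symmetry of [D1 (D1 f)]. *)
Lemma D2D1n2_sym z y a v w :
  D2 (D1 (D1 f)) z y a v w = D2 (D1 (D1 f)) z y a w v.
Proof.
have H := @D2n_has_frechet 0 2 z y isT isT.
have := has_frechet_unique
  (has_frechet_comp_oper (oper_eval w) (has_frechet_comp_oper (oper_eval v) H)).
move=> /(_ (oper_comp (oper_eval v) (oper_comp (oper_eval w) (F 1 2 z y)))).
have -> : (fun y => oper_eval w (oper_eval v (F 0 2 z y))) =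
    (fun y => oper_eval v (oper_eval w (F 0 2 z y))).
  by apply/funext => y'; exact: D1n2_sym.
move=> /(_ (has_frechet_comp_oper _ (has_frechet_comp_oper _ H))) E.
by have := congr1 (fun L : 'L(V, V) => L a) E.
Qed.

Section Bounds.
Context (A : set V) (A_compact : compact A) (A_nonempty : A !=set0).

Lemma C_loc_bound : exists2 C, 0 <= C &
  forall j k z y, (j <= 3)%N -> (k <= 2)%N -> A z ->
    `|F k j z y| <= C * (1 + `|y|) `^ beta (inord k).
Proof.
case: f_C => _ _ _ /(_ A A_compact) H.
pose S j k := ereal_sup [set (`|F k j p.1 p.2| *
  (1 + `|p.2|) `^ (- beta (inord k)))%:E | p in A `*` setT].
have Sge j k z y : A z ->
    ((`|F k j z y| * (1 + `|y|) `^ (- beta (inord k)))%:E <= S j k)%E.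
  by move=> Az; apply: ereal_sup_ubound; exists (z, y).
have S0 j k : (0 <= S j k)%E.
  case: A_nonempty => z Az; apply: le_trans (Sge j k z 0 Az).
  by rewrite lee_fin mulr_ge0// powR_ge0.
have Sfin j k : (j <= 3)%N -> (k <= 2)%N -> (S j k < +oo)%E.
  move=> j3 k2; have H' : (\sum_(i < 4) \sum_(l < 3) S i l < +oo)%E.
    rewrite (eq_bigr (fun i : 'I_4 => (\sum_(l < 3) ereal_sup [set
      (`|F l i p.1 p.2| * (1 + `|p.2|) `^ (- beta l))%:E | p in A `*` setT])%E))//.
    by move=> i _; apply: eq_bigr => l _; rewrite /S inord_val.
  have := lt_sum_pinfty (inord j) _ H'; rewrite inordK// => /(_ _) H1.
  have := lt_sum_pinfty (inord k) _ (H1 _); rewrite inordK//; apply => // i.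
  by apply: sume_ge0.
pose C := \sum_(j < 4) \sum_(k < 3) fine (S j k).
have fS0 j k : 0 <= fine (S j k) by exact: fine_ge0.
exists C; first by apply: sumr_ge0 => j _; apply: sumr_ge0.
move=> j k z y j3 k2 Az; have w0 : 0 < (1 + `|y|) `^ beta (inord k).
  by rewrite powR_gt0// ltr_pwDl.
rewrite -ler_pdivrMr// -powRN -lee_fin; apply: le_trans (Sge j k z y Az) _.
rewrite -[S j k]fineK ?ge0_fin_numE ?Sfin// lee_fin /C.
rewrite (bigD1 (inord j : 'I_4))//= (bigD1 (inord k : 'I_3))//= !inordK//.
rewrite -addrA lerDl addr_ge0//; first by apply: sumr_ge0.
by apply: sumr_ge0 => i _; apply: sumr_ge0.
Qed.

(** Joint continuity is uniform over a compact set of the first variable. *)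
Lemma tube {K : normedModType R} (G : V -> V -> K) y e :
  continuous (fun p : V * V => G p.1 p.2) -> 0 < e ->
  exists2 d, 0 < d & forall z b, A z -> `|b| < d -> `|G z (y + b) - G z y| <= e.
Proof using A_compact.
move=> Gc e0; have e2 : 0 < e / 2 by rewrite divr_gt0.
have : \forall y' \near y, A `<=` (fun z => `|G z y' - G z y| <= e).
  apply: (compact_near_coveringP A).1 => // z Az.
  have [d d0 Hd] := eps_continuous_at (Gc (z, y)) e2.
  exists (ball z d, ball y d); first by split; exact: nbhsx_ballx.
  move=> [z' y'] [/=]; rewrite -!ball_normE /= => zd yd.
  have h v w : `|v| < d -> `|w| < d -> `|G (z + v) (y + w) - G z y| <= e / 2.
    by move=> vd wd; apply: (Hd (v, w)); rewrite prod_normE/= gt_max vd wd.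
  have h1 := h (z' - z) (y' - y).
  have h2 := h (z' - z) 0.
  rewrite distrC in zd; rewrite distrC in yd.
  rewrite addr0 ![_ + (_ - _)]addrC !subrK in h1 h2.
  have -> : G z' y' - G z' y = (G z' y' - G z y) - (G z' y - G z y) by module_eq.
  rewrite [e]splitr; apply: le_trans (ler_normB _ _) _.
  by rewrite lerD ?h1 ?h2 ?normr0.
move=> /nbhs_normP[d /= d0 Hd]; exists d => // z b Az bd.
by apply: Hd => //=; rewrite opprD addrA subrr sub0r normrN.
Qed.

Lemma D2n_remainder k j y e : (j <= 3)%N -> (k < 2)%N -> 0 < e ->
  exists2 d, 0 < d & forall z b, A z -> `|b| < d ->
    `|F k j z (y + b) - F k j z y - F k.+1 j z y b| <= e * `|b|.
Proof using f_C A_compact.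
move=> j3 k2 e0.
have [d d0 Hd] := tube y (@D2n_continuous k.+1 j j3 k2) e0.
exists d => // z b Az bd; apply: taylor1 => t /andP[t0 t1].
  exact: D2n_has_frechet.
apply: Hd => //; rewrite normrZ ger0_norm//.
by apply: le_lt_trans bd; rewrite ler_piMl.
Qed.

End Bounds.
End SmoothFamilies.

Section Hull.
Context {R : realType} {V : completeNormedModType R} (T alpha N : R) (X : R -> V).
Hypotheses (T0 : 0 <= T) (a0 : 0 < alpha) (N0 : 0 <= N)
  (XN : time_le T alpha N (fun s t => X t - X s)).

(** All segments joining two points of the path: increments of a smooth
   function along the path are estimated on this compact set. *)
Definition path_hull : set V := [set z | exists s t u,
  [/\ 0 <= s <= T, 0 <= t <= T, 0 <= u <= 1 & z = X s + u *: (X t - X s)]].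

Lemma path_hull_segment s t u : 0 <= s <= T -> 0 <= t <= T -> 0 <= u <= 1 ->
  path_hull (X s + u *: (X t - X s)).
Proof. by exists s, t, u. Qed.

Lemma path_hull_subsegment s t u v : 0 <= s <= T -> 0 <= t <= T ->
  0 <= u <= 1 -> 0 <= v <= 1 -> path_hull (X s + v *: (u *: (X t - X s))).
Proof.
move=> sT tT /andP[u0 u1] /andP[v0 v1]; rewrite scalerA.
by apply: path_hull_segment => //; rewrite mulr_ge0//= mulr_ile1.
Qed.

Lemma path_hull_path s : 0 <= s <= T -> path_hull (X s).
Proof.
move=> sT; have := path_hull_segment sT sT (u := 0); rewrite scale0r addr0.
by apply; rewrite lexx ler01.
Qed.

(* [X] is arbitrary outside of [0, T]; composed with [clamp] it is continuous on
   the whole line. *)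
Let clamp (r : R) : R := Num.max 0 (Num.min T r).

Let clampT r : 0 <= clamp r <= T.
Proof. by rewrite /clamp le_max lexx ge_max T0 ge_min lexx. Qed.

Let clamp_lip r s : `|clamp r - clamp s| <= `|r - s|.
Proof.
rewrite /clamp; have := T0.
case: (leP T r) => h1; case: (leP T s) => h2; case: (leP 0 r) => h3;
  case: (leP 0 s) => h4 T0'; rewrite ?(max_r T0') ?(max_r h3) ?(max_r h4)
  ?(max_l (ltW h3)) ?(max_l (ltW h4));
  rewrite ler_norml; have := ler_norm (r - s); have := ler_norm (s - r);
  rewrite [`|s - r|]distrC; move=> *; apply/andP; split; lra.
Qed.

Let clamped_continuous : continuous (X \o clamp).
Proof.
move=> r; apply: continuous_at_eps => e e0.
have N1 : 0 < N + 1 by rewrite ltr_wpDl.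
have [d d0 dg] := powR_small a0 (divr_gt0 e0 N1).
exists d => // h hd /=; apply: le_trans (XN (clampT _) (clampT _)) _.
apply: (@le_trans _ _ ((N + 1) * (e / (N + 1)))); last first.
  by rewrite mulrC divfK// gt_eqF.
apply: ler_pM; rewrite ?powR_ge0 ?lerDl//.
apply: le_trans dg; apply: ge0_ler_powR; rewrite ?nnegrE ?(ltW a0) ?(ltW d0)//.
apply: le_trans (clamp_lip _ _) _.
by rewrite addrC addrA addNr add0r ltW.
Qed.

(** The hull is a continuous image of a cube. *)
Lemma path_hull_compact : compact path_hull.
Proof using T0 a0 N0 XN.
pose phi (p : R * R * R) : V :=
  (X \o clamp) p.1.1 + p.2 *: ((X \o clamp) p.1.2 - (X \o clamp) p.1.1).
have -> : path_hull = phi @` ((`[0, T] `*` `[0, T]) `*` `[0, 1])%classic.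
  have cE s : 0 <= s <= T -> clamp s = s.
    by move=> /andP[s0 sT]; rewrite /clamp min_r// max_r.
  apply/seteqP; split=> z.
    move=> [s [t [u [sT tT u1 ->]]]]; exists (s, t, u).
      by split; [split|]; rewrite /= in_itv.
    by rewrite /phi /= !cE.
  move=> [[[s t] u] [[/=]]]; rewrite !in_itv /= => sT tT u1 <-.
  by rewrite /phi /= !cE//; exists s, t, u.
apply: continuous_compact; last first.
  by apply: compact_setX; [apply: compact_setX|]; exact: segment_compact.
apply: continuous_subspaceT => p.
have c1 : {for p, continuous (fun p : R * R * R => (X \o clamp) p.1.1)}.
  apply: (@continuous_comp _ _ _ (fun p : R * R * R => p.1.1) (X \o clamp)).
    by apply: continuous_comp; exact: cvg_fst.
  exact: clamped_continuous.
have c2 : {for p, continuous (fun p : R * R * R => (X \o clamp) p.1.2)}.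
  apply: (@continuous_comp _ _ _ (fun p : R * R * R => p.1.2) (X \o clamp)).
    by apply: continuous_comp; [exact: cvg_fst|exact: cvg_snd].
  exact: clamped_continuous.
apply: (@continuousD _ _ _ (fun p : R * R * R => (X \o clamp) p.1.1)) => //.
apply: continuousZ; first exact: cvg_snd.
exact: continuousB.
Qed.

(** A smooth function along [X] is controlled by [X], with a bound that is linear
   in the size of its first two derivatives on the hull; this linearity transfers
   smallness of a family of functions to the controlled paths. *)
Lemma ctrl_le_comp M (phi0 : V -> V) (phi1 : V -> 'L(V, V))
    (phi2 : V -> 'L(V, 'L(V, V))) : 0 <= M ->
  (forall z, has_frechet phi0 z (phi1 z)) ->
  (forall z, has_frechet phi1 z (phi2 z)) ->
  (forall z, path_hull z -> `|phi1 z| <= M) ->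
  (forall z, path_hull z -> `|phi2 z| <= M) ->
  ctrl_le T alpha X ((1 + N) ^+ 2 * M) (fun r => phi0 (X r), fun r => phi1 (X r)).
Proof using N0 XN.
move=> M0 d0 d1 b1 b2.
have NN : 1 <= (1 + N) ^+ 2 by rewrite exprn_ege1// lerDl.
have N1 : N <= (1 + N) ^+ 2.
  by rewrite sqrrD expr1n mul1r; have := sqr_ge0 N; lra.
have N2 : N ^+ 2 <= (1 + N) ^+ 2.
  by rewrite lerXn2r ?nnegrE ?addr_ge0// lerDr.
have seg s t : 0 <= s <= T -> 0 <= t <= T ->
    forall u, 0 <= u <= 1 -> path_hull (X s + u *: (X t - X s)).
  by move=> sT tT u u1; exact: path_hull_segment.
have XE s t : X t = X s + (X t - X s) by rewrite addrC subrK.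
split=> [|s sT|s t sT tT|s t sT tT|s t sT tT] /=.
- by rewrite mulr_ge0// exprn_ge0// addr_ge0.
- apply: le_trans (b1 _ (path_hull_path sT)) _.
  by rewrite ler_peMl.
- rewrite {1}(XE s t); apply: le_trans (mean_value_le (f1 := phi1) (M := M) _ _) _.
  + by move=> *; exact: d0.
  + by move=> u u1; apply: b1; exact: seg.
  apply: le_trans (ler_wpM2l M0 (XN sT tT)) _.
  by rewrite mulrA ler_wpM2r ?powR_ge0// mulrC ler_wpM2r.
- rewrite {1}(XE s t); apply: le_trans (mean_value_le (f1 := phi2) (M := M) _ _) _.
  + by move=> *; exact: d1.
  + by move=> u u1; apply: b2; exact: seg.
  apply: le_trans (ler_wpM2l M0 (XN sT tT)) _.
  by rewrite mulrA ler_wpM2r ?powR_ge0// mulrC ler_wpM2r.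
- rewrite {1}(XE s t).
  apply: le_trans (taylor1 (f1 := phi1) (M := M * `|X t - X s|) _ _) _.
  + by move=> *; exact: d0.
  + move=> u u1; have u01 := u1; case/andP: u1 => u0 u1.
    apply: le_trans (mean_value_le (f1 := phi2) (M := M) _ _) _.
    * by move=> *; exact: d1.
    * move=> v /andP[v0 v1]; rewrite scalerA; apply: b2; apply: seg => //.
      by rewrite mulr_ge0//= mulr_ile1.
    by rewrite ler_wpM2l// normrZ ger0_norm// ler_piMl.
  rewrite powR2M -mulrA -expr2.
  apply: le_trans (ler_wpM2l M0 (_ : _ <= (N * `|t - s| `^ alpha) ^+ 2)) _.
    by rewrite lerXn2r ?nnegrE ?mulr_ge0 ?powR_ge0// XN.
  by rewrite exprMn mulrA ler_wpM2r ?exprn_ge0 ?powR_ge0// mulrC ler_wpM2r.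
Qed.

Lemma oper_ctrl_le_comp M (psi0 : V -> 'L(V, V)) (psi1 : V -> 'L(V, 'L(V, V)))
    (psi2 : V -> 'L(V, 'L(V, 'L(V, V)))) : 0 <= M ->
  (forall a z, has_frechet (fun z => psi0 z a) z (psi1 z a)) ->
  (forall a z, has_frechet (fun z => psi1 z a) z (psi2 z a)) ->
  (forall z, path_hull z -> `|psi1 z| <= M) ->
  (forall z, path_hull z -> `|psi2 z| <= M) ->
  oper_ctrl_le T alpha X ((1 + N) ^+ 2 * M)
    (fun r => psi0 (X r), fun r => psi1 (X r)).
Proof using N0 XN.
move=> M0 d0 d1 b1 b2.
have NN : 1 <= (1 + N) ^+ 2 by rewrite exprn_ege1// lerDl.
have c0 : 0 <= (1 + N) ^+ 2 * M by rewrite mulr_ge0// exprn_ge0// addr_ge0.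
have H a : ctrl_le T alpha X ((1 + N) ^+ 2 * (M * `|a|))
    (fun r => psi0 (X r) a, fun r => psi1 (X r) a).
  apply: (ctrl_le_comp (phi0 := fun z => psi0 z a) (phi1 := fun z => psi1 z a)
    (phi2 := fun z => psi2 z a)) => // [|z hz|z hz].
  - by rewrite mulr_ge0.
  - by apply: oper_norm_leM => //; exact: b1.
  - by apply: oper_norm_leM => //; exact: b2.
split=> [//|s sT|s t sT tT|s t sT tT|s t a sT tT] /=.
- by apply: le_trans (b1 _ (path_hull_path sT)) _; rewrite ler_peMl.
- apply: oper_le => [|a]; first by rewrite mulr_ge0// powR_ge0.
  case: (H a) => _ _ h _ _.
  rewrite [leRHS](_ : _ = (1 + N) ^+ 2 * (M * `|a|) * `|t - s| `^ alpha); last by ring.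
  exact: h.
- apply: oper_le => [|a]; first by rewrite mulr_ge0// powR_ge0.
  case: (H a) => _ _ _ h _.
  rewrite [leRHS](_ : _ = (1 + N) ^+ 2 * (M * `|a|) * `|t - s| `^ alpha); last by ring.
  exact: h.
- case: (H a) => _ _ _ _ h.
  rewrite [leRHS](_ : _ = (1 + N) ^+ 2 * (M * `|a|) * `|t - s| `^ (2 * alpha)).
    exact: h.
  by ring.
Qed.

End Hull.

Section PathFamilies.
Context {R : realType} {V : completeNormedModType R} (T alpha N : R) (X : R -> V).
Hypotheses (T0 : 0 <= T) (a0 : 0 < alpha) (N0 : 0 <= N)
  (XN : time_le T alpha N (fun s t => X t - X s)).
Context (beta : 'I_3 -> R) (f : V -> V -> V).
Hypothesis f_C : @C_loc R V 3 2 beta f.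
Local Notation F k j := (D2n k (D1n j f)).
Local Notation hull := (path_hull T X).

Context (C : R) (C0 : 0 <= C).
Hypothesis fC : forall j k z y, (j <= 3)%N -> (k <= 2)%N -> hull z ->
  `|F k j z y| <= C * (1 + `|y|) `^ beta (inord k).

Definition family_bound (k : nat) (y : V) : R :=
  (1 + N) ^+ 2 * (C * (1 + `|y|) `^ beta (inord k)).

(** Controlled paths are pairs of a path and its Gubinelli derivative.  The primed
   families are the directional derivatives in [x] along [a], and in [y] along
   [b], of the unprimed ones. *)
Definition value_path (x : V) : (R -> V) * (R -> 'L(V, V)) :=
  (fun r => f (X r) x, fun r => D1 f (X r) x).

Definition value_path' (x a : V) : (R -> V) * (R -> 'L(V, V)) :=
  (fun r => D2 f (X r) x a, fun r => D2 (D1 f) (X r) x a).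

Definition slope_path (y : V) : (R -> 'L(V, V)) * (R -> 'L(V, 'L(V, V))) :=
  (fun r => D2 f (X r) y, fun r => D2 (D1 f) (X r) y).

Definition slope_path' (y b : V) : (R -> 'L(V, V)) * (R -> 'L(V, 'L(V, V))) :=
  (fun r => F 2 0 (X r) y b, fun r => F 2 1 (X r) y b).

Let w0 k (y : V) : 0 <= C * (1 + `|y|) `^ beta (inord k).
Proof. by rewrite mulr_ge0// powR_ge0. Qed.

Let N1 : 0 < (1 + N) ^+ 2. Proof. by rewrite exprn_gt0// ltr_wpDr. Qed.

Let compact_hull : compact hull := path_hull_compact T0 a0 N0 XN.

Lemma value_path_ctrl x : ctrl_le T alpha X (family_bound 0 x) (value_path x).
Proof using All.
apply: (ctrl_le_comp N0 XN (phi0 := f ^~ x) (phi1 := D1 f ^~ x)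
  (phi2 := D1 (D1 f) ^~ x)) => // [z|z|z hz|z hz].
- exact: (@D1n_has_frechet _ _ _ _ f_C 0).
- exact: (@D1n_has_frechet _ _ _ _ f_C 1).
- exact: (fC (j := 1) (k := 0)).
- exact: (fC (j := 2) (k := 0)).
Qed.

Lemma slope_path_ctrl y : oper_ctrl_le T alpha X (family_bound 1 y) (slope_path y).
Proof using All.
apply: (oper_ctrl_le_comp N0 XN (psi0 := D2 f ^~ y) (psi1 := D2 (D1 f) ^~ y)
  (psi2 := D2 (D1 (D1 f)) ^~ y)) => // [a z|a z|z hz|z hz].
- exact: (@D21_has_frechet _ _ _ _ f_C 0).
- exact: (@D21_has_frechet _ _ _ _ f_C 1).
- exact: (fC (j := 1) (k := 1)).
- exact: (fC (j := 2) (k := 1)).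
Qed.

(** The remainder of first order in [x] is itself a smooth function of the first
   variable, composed with [X]; it and its derivatives are small uniformly over
   the compact hull, by the joint continuity of [D2 (D1n j f)] for [j <= 2]. *)
Lemma value_path_family : C1_family (ctrl_le T alpha X) value_path value_path'
  (family_bound 0) (family_bound 1).
Proof using All.
split=> [x|x a|x c a a'|x e e0|x e e0].
- exact: value_path_ctrl.
- rewrite /family_bound -mulrA; apply: (ctrl_le_comp N0 XN
    (phi0 := fun z => D2 f z x a) (phi1 := fun z => D2 (D1 f) z x a)
    (phi2 := fun z => D2 (D1 (D1 f)) z x a)) => // [|z|z|z hz|z hz].
  + by rewrite mulr_ge0.
  + exact: (@D21_has_frechet _ _ _ _ f_C 0).
  + exact: (@D21_has_frechet _ _ _ _ f_C 1).
  + by apply: oper_norm_leM => //; exact: (fC (j := 1) (k := 1)).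
  + by apply: oper_norm_leM => //; exact: (fC (j := 2) (k := 1)).
- by apply: (congr2 pair); apply/funext => r; exact: oper_linear.
- have e'0 : 0 < e / (1 + N) ^+ 2 by rewrite divr_gt0.
  have [d1 d10 H1] := D2n_remainder f_C compact_hull (j := 1) (k := 0) x isT isT e'0.
  have [d2 d20 H2] := D2n_remainder f_C compact_hull (j := 2) (k := 0) x isT isT e'0.
  exists (Num.min d1 d2); first by rewrite lt_min d10.
  move=> a; rewrite lt_min => /andP[ad1 ad2].
  rewrite (_ : e * `|a| = (1 + N) ^+ 2 * (e / (1 + N) ^+ 2 * `|a|)); last first.
    by rewrite mulrA [_ * (e / _)]mulrC divfK// gt_eqF.
  apply: (ctrl_le_comp N0 XN
    (phi0 := fun z => f z (x + a) - f z x - D2 f z x a)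
    (phi1 := fun z => D1 f z (x + a) - D1 f z x - D2 (D1 f) z x a)
    (phi2 := fun z => D1 (D1 f) z (x + a) - D1 (D1 f) z x - D2 (D1 (D1 f)) z x a)).
  + by rewrite mulr_ge0// ltW.
  + move=> z; apply: has_frechetB; last exact: (@D21_has_frechet _ _ _ _ f_C 0).
    by apply: has_frechetB; exact: (@D1n_has_frechet _ _ _ _ f_C 0).
  + move=> z; apply: has_frechetB; last exact: (@D21_has_frechet _ _ _ _ f_C 1).
    by apply: has_frechetB; exact: (@D1n_has_frechet _ _ _ _ f_C 1).
  + by move=> z hz; exact: H1.
  + by move=> z hz; exact: H2.
- have e'0 : 0 < e / (1 + N) ^+ 2 by rewrite divr_gt0.
  have [d1 d10 H1] := tube compact_hull x (@D2n_continuous _ _ _ _ f_C 1 1 isT isT) e'0.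
  have [d2 d20 H2] := tube compact_hull x (@D2n_continuous _ _ _ _ f_C 1 2 isT isT) e'0.
  exists (Num.min d1 d2); first by rewrite lt_min d10.
  move=> a; rewrite lt_min => /andP[ad1 ad2] c.
  rewrite (_ : e * `|c| = (1 + N) ^+ 2 * (e / (1 + N) ^+ 2 * `|c|)); last first.
    by rewrite mulrA [_ * (e / _)]mulrC divfK// gt_eqF.
  apply: (ctrl_le_comp N0 XN
    (phi0 := fun z => D2 f z (x + a) c - D2 f z x c)
    (phi1 := fun z => D2 (D1 f) z (x + a) c - D2 (D1 f) z x c)
    (phi2 := fun z => D2 (D1 (D1 f)) z (x + a) c - D2 (D1 (D1 f)) z x c)).
  + by rewrite mulr_ge0// ltW.
  + by move=> z; apply: has_frechetB; exact: (@D21_has_frechet _ _ _ _ f_C 0).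
  + by move=> z; apply: has_frechetB; exact: (@D21_has_frechet _ _ _ _ f_C 1).
  + move=> z hz; rewrite -oper_subE; apply: oper_norm_leM => //; exact: H1.
  + move=> z hz; rewrite -oper_subE; apply: oper_norm_leM => //; exact: H2.
Qed.

Lemma slope_path_family : C1_family (oper_ctrl_le T alpha X) slope_path slope_path'
  (family_bound 1) (family_bound 2).
Proof using All.
split=> [y|y b|y c b b'|y e e0|y e e0].
- exact: slope_path_ctrl.
- rewrite /family_bound -mulrA; apply: (oper_ctrl_le_comp N0 XN
    (psi0 := fun z => F 2 0 z y b) (psi1 := fun z => F 2 1 z y b)
    (psi2 := fun z => F 2 2 z y b)) => // [|a z|a z|z hz|z hz].
  + by rewrite mulr_ge0.
  + exact: (@D22_has_frechet _ _ _ _ f_C 0).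
  + exact: (@D22_has_frechet _ _ _ _ f_C 1).
  + by apply: oper_norm_leM => //; exact: (fC (j := 1) (k := 2)).
  + by apply: oper_norm_leM => //; exact: (fC (j := 2) (k := 2)).
- by apply: (congr2 pair); apply/funext => r; exact: oper_linear.
- have e'0 : 0 < e / (1 + N) ^+ 2 by rewrite divr_gt0.
  have [d1 d10 H1] := D2n_remainder f_C compact_hull (j := 1) (k := 1) y isT isT e'0.
  have [d2 d20 H2] := D2n_remainder f_C compact_hull (j := 2) (k := 1) y isT isT e'0.
  exists (Num.min d1 d2); first by rewrite lt_min d10.
  move=> b; rewrite lt_min => /andP[bd1 bd2].
  rewrite (_ : e * `|b| = (1 + N) ^+ 2 * (e / (1 + N) ^+ 2 * `|b|)); last first.
    by rewrite mulrA [_ * (e / _)]mulrC divfK// gt_eqF.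
  apply: (oper_ctrl_le_comp N0 XN
    (psi0 := fun z => D2 f z (y + b) - D2 f z y - F 2 0 z y b)
    (psi1 := fun z => D2 (D1 f) z (y + b) - D2 (D1 f) z y - F 2 1 z y b)
    (psi2 := fun z => D2 (D1 (D1 f)) z (y + b) - D2 (D1 (D1 f)) z y - F 2 2 z y b)).
  + by rewrite mulr_ge0// ltW.
  + move=> a z; apply: (has_frechetB (f := fun z => D2 f z (y + b) a - D2 f z y a)).
      by apply: has_frechetB; exact: (@D21_has_frechet _ _ _ _ f_C 0).
    exact: (@D22_has_frechet _ _ _ _ f_C 0).
  + move=> a z; apply: (has_frechetB
      (f := fun z => D2 (D1 f) z (y + b) a - D2 (D1 f) z y a)).
      by apply: has_frechetB; exact: (@D21_has_frechet _ _ _ _ f_C 1).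
    exact: (@D22_has_frechet _ _ _ _ f_C 1).
  + by move=> z hz; exact: H1.
  + by move=> z hz; exact: H2.
- have e'0 : 0 < e / (1 + N) ^+ 2 by rewrite divr_gt0.
  have [d1 d10 H1] := tube compact_hull y (@D2n_continuous _ _ _ _ f_C 2 1 isT isT) e'0.
  have [d2 d20 H2] := tube compact_hull y (@D2n_continuous _ _ _ _ f_C 2 2 isT isT) e'0.
  exists (Num.min d1 d2); first by rewrite lt_min d10.
  move=> b; rewrite lt_min => /andP[bd1 bd2] c.
  rewrite (_ : e * `|c| = (1 + N) ^+ 2 * (e / (1 + N) ^+ 2 * `|c|)); last first.
    by rewrite mulrA [_ * (e / _)]mulrC divfK// gt_eqF.
  apply: (oper_ctrl_le_comp N0 XN
    (psi0 := fun z => F 2 0 z (y + b) c - F 2 0 z y c)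
    (psi1 := fun z => F 2 1 z (y + b) c - F 2 1 z y c)
    (psi2 := fun z => F 2 2 z (y + b) c - F 2 2 z y c)).
  + by rewrite mulr_ge0// ltW.
  + by move=> a z; apply: has_frechetB; exact: (@D22_has_frechet _ _ _ _ f_C 0).
  + by move=> a z; apply: has_frechetB; exact: (@D22_has_frechet _ _ _ _ f_C 1).
  + move=> z hz; rewrite -oper_subE; apply: oper_norm_leM => //; exact: H1.
  + move=> z hz; rewrite -oper_subE; apply: oper_norm_leM => //; exact: H2.
Qed.

End PathFamilies.

(** * The second level of the lift as an iterated integral *)

Section ProductRule.
Context {R : realType} {U V K : normedModType R}.

(** Leibniz rule for the evaluation of an operator-valued map whose derivative is
   known at fixed arguments, as for mixed partial derivatives; its continuity for
   the operator norm accounts for the variation of the argument. *)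
Lemma has_frechet_apply (A : U -> 'L(V, K)) (g : U -> V) z A' g' :
  has_frechet (fun u => A u (g z)) z A' -> {for z, continuous A} ->
  has_frechet g z g' ->
  has_frechet (fun u => A u (g u)) z (A' + oper_comp (A z) g').
Proof.
move=> AA Ac gg e e0; have e3 : 0 < e / 3 by rewrite divr_gt0.
have [d1 d10 H1] := AA _ e3.
have [d2 d20 H2] := has_frechet_comp_oper (A z) gg e3.
have [d3 d30 H3] := gg 1 ltr01.
have l0 : 0 < `|g'| + 1 by rewrite ltr_wpDl.
have [d4 d40 H4] := eps_continuous_at Ac (divr_gt0 e3 l0).
exists (Num.min (Num.min d1 d2) (Num.min d3 d4)); first by rewrite !lt_min d10 d20 d30.
move=> h; rewrite !lt_min => /andP[/andP[h1 h2] /andP[h3 h4]].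
have gl : `|g (z + h) - g z| <= (`|g'| + 1) * `|h|.
  rewrite -[g (z + h) - g z](subrK (g' h)) mulrDl addrC.
  by apply: le_trans (ler_normD _ _) _; rewrite lerD ?oper_norm_le ?H3.
have -> : A (z + h) (g (z + h)) - A z (g z) - (A' + oper_comp (A z) g') h =
  (A (z + h) (g z) - A z (g z) - A' h) +
  (A z (g (z + h)) - A z (g z) - oper_comp (A z) g' h) +
  (A (z + h) - A z) (g (z + h) - g z).
  by rewrite operB !oper_subE oper_addE; module_eq.
apply: le_trans (ler_normD _ _) _; apply: le_trans (lerD (ler_normD _ _) (lexx _)) _.
have h5 : `|(A (z + h) - A z) (g (z + h) - g z)| <= e / 3 * `|h|.
  apply: le_trans (oper_norm_leM (H4 h h4) gl) _.
  by rewrite mulrA divfK// gt_eqF.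
have := lerD (lerD (H1 h h1) (H2 h h2)) h5; move/le_trans; apply.
by rewrite le_eqVlt; apply/orP; left; apply/eqP; field.
Qed.

Lemma apply_lip (A A' : 'L(V, K)) (v v' : V) a b da db :
  `|A'| <= a -> `|v| <= b -> `|A' - A| <= da -> `|v' - v| <= db ->
  `|A' v' - A v| <= a * db + da * b.
Proof.
move=> Aa vb dA dv.
have -> : A' v' - A v = A' (v' - v) + (A' - A) v.
  by rewrite operB oper_subE; module_eq.
apply: le_trans (ler_normD _ _) _.
by apply: lerD; apply: oper_norm_leM.
Qed.

Lemma oper_comp_lip {W : normedModType R} (A A' : 'L(V, K)) (B B' : 'L(W, V))
    a b da db :
  `|A'| <= a -> `|B| <= b -> `|A' - A| <= da -> `|B' - B| <= db ->
  `|oper_comp A' B' - oper_comp A B| <= a * db + da * b.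
Proof.
move=> Aa Bb dA dB.
have -> : oper_comp A' B' - oper_comp A B =
    oper_comp A' (B' - B) + oper_comp (A' - A) B.
  apply: oper_eqP => v; rewrite -[LHS]/(A' (B' v) - A (B v)).
  rewrite -[RHS]/(A' (B' v - B v) + (A' (B v) - A (B v))) operB.
  by module_eq.
apply: le_trans (ler_normD _ _) _.
by apply: lerD; apply: le_trans (oper_comp_norm _ _) _; apply: ler_pM.
Qed.

End ProductRule.

Section IteratedLift.
Context {R : realType} {V : completeNormedModType R} (VV : proj_tensor V).
Context (T alpha N : R) (X : R -> V) (XX : R -> R -> VV).
Hypotheses (T0 : 0 <= T) (a13 : 3^-1 < alpha).
Hypothesis XN : rough_path_le T alpha X XX N.
Context (beta : 'I_3 -> R) (f : V -> V -> V).
Hypothesis f_C : @C_loc R V 3 2 beta f.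
Local Notation F k j := (D2n k (D1n j f)).
Local Notation hull := (path_hull T X).
Local Notation w s t := (`|t - s : R| `^ alpha).

Context (C : R) (C0 : 0 <= C).
Hypothesis fC : forall j k z y, (j <= 3)%N -> (k <= 2)%N -> hull z ->
  `|F k j z y| <= C * (1 + `|y|) `^ beta (inord k).

Let b (k : nat) (y : V) : R := C * (1 + `|y|) `^ beta (inord k).

Let b0 k y : 0 <= b k y. Proof. by rewrite mulr_ge0// powR_ge0. Qed.
Let N0 : 0 <= N. Proof. by case: XN. Qed.
Let X1 s t : 0 <= s <= T -> 0 <= t <= T -> `|X t - X s| <= N * w s t.
Proof. by case: XN => _ h _ _; exact: h. Qed.
Let g1 : 1 < 3 * alpha. Proof. by move: a13; lra. Qed.

(** For [k > 0] the derivative of [F k j] in the first variable is available only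
   once its other arguments are fixed, so operator norms are estimated at fixed
   arguments. *)
Lemma hull_lip k j y z v : (k <= 2)%N -> (j < 3)%N ->
  (forall t, 0 <= t <= 1 -> hull (z + t *: v)) ->
  `|F k j (z + v) y - F k j z y| <= b k y * `|v|.
Proof using f_C fC C0.
move=> + j3 hz; have b0v : 0 <= b k y * `|v| by rewrite mulr_ge0.
case: k b0v => [|[|[|//]]] b0v _.
- apply: (mean_value_le (f := D1n j f ^~ y) (f1 := D1n j.+1 f ^~ y)) => t t01.
    exact: (D1n_has_frechet f_C).
  by apply: (fC (j := j.+1) (k := 0)) => //; exact: hz.
- apply: oper_le => // a; rewrite oper_subE mulrAC.
  apply: (mean_value_le (f := fun z => F 1 j z y a)
    (f1 := fun z => F 1 j.+1 z y a)) => t t01.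
    exact: (D21_has_frechet f_C).
  by apply: oper_norm_leM => //; apply: (fC (j := j.+1) (k := 1)) => //; exact: hz.
- apply: oper_le => // a; apply: oper_le => [|c]; first by rewrite mulr_ge0.
  rewrite !oper_subE [leRHS](_ : _ = b 2 y * `|a| * `|c| * `|v|); last by ring.
  apply: (mean_value_le (f := fun z => F 2 j z y a c)
    (f1 := fun z => F 2 j.+1 z y a c)) => t t01.
    exact: (D22_has_frechet f_C).
  apply: oper_norm_leM => //; apply: oper_norm_leM => //.
  by apply: (fC (j := j.+1) (k := 2)) => //; exact: hz.
Qed.

Let seg s t : 0 <= s <= T -> 0 <= t <= T ->
  forall u, 0 <= u <= 1 -> hull (X s + u *: (X t - X s)).
Proof. by move=> sT tT u u1; exact: path_hull_segment. Qed.

Let subseg s t u : 0 <= s <= T -> 0 <= t <= T -> 0 <= u <= 1 ->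
  forall v, 0 <= v <= 1 -> hull (X s + v *: (u *: (X t - X s))).
Proof. by move=> sT tT u1 v v1; exact: path_hull_subsegment. Qed.

Let XE s t : X t = X s + (X t - X s). Proof. by rewrite addrC subrK. Qed.

Lemma path_lip k j y s t : (k <= 2)%N -> (j < 3)%N ->
  0 <= s <= T -> 0 <= t <= T ->
  `|F k j (X t) y - F k j (X s) y| <= b k y * N * w s t.
Proof using f_C fC C0 XN.
move=> k2 j3 sT tT; rewrite {1}(XE s t).
apply: le_trans (hull_lip y k2 j3 (seg sT tT)) _.
by rewrite -mulrA ler_wpM2l ?X1// b0.
Qed.

Lemma path_remainder {K : normedModType R} (phi : V -> K) (phi1 : V -> 'L(V, K)) L :
  0 <= L -> (forall z, has_frechet phi z (phi1 z)) ->
  (forall s t u, 0 <= s <= T -> 0 <= t <= T -> 0 <= u <= 1 ->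
    `|phi1 (X s + u *: (X t - X s)) - phi1 (X s)| <= L * `|X t - X s|) ->
  time_le T (2 * alpha) (L * N ^+ 2)
    (fun s t => phi (X t) - phi (X s) - phi1 (X s) (X t - X s)).
Proof using XN.
move=> L0 d0 d1 s t sT tT; rewrite {1}(XE s t).
apply: le_trans (taylor1 (f1 := phi1) (M := L * `|X t - X s|) _ _) _ => //.
  by move=> u u1; exact: d1.
rewrite powR2M -[leLHS]mulrA -[leRHS]mulrA ler_wpM2l// -exprMn -expr2.
by rewrite lerXn2r ?nnegrE ?mulr_ge0 ?powR_ge0// X1.
Qed.

Definition h_deriv (x y z : V) : 'L(V, 'L(V, V)) :=
  D2 (D1 (D1 f)) z y (f z x) + oper_comp (D2 (D1 f) z y) (D1 f z x).

Lemma h_has_frechet x y z : has_frechet (h_of f x y) z (h_deriv x y z).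
Proof using f_C.
apply: (has_frechet_apply (A := fun z => D2 (D1 f) z y) (g := fun z => f z x)).
- exact: (@D21_has_frechet _ _ _ _ f_C 1).
- apply: continuous_at_eps => e e0.
  have [d d0 Hd] := eps_continuous_at (@D2n_continuous _ _ _ _ f_C 1 1 isT isT (z, y)) e0.
  exists d => // v vd; have := Hd (v, 0); rewrite /= addr0; apply.
  by rewrite prod_normE/= normr0 gt_max vd.
- exact: (@D1n_has_frechet _ _ _ _ f_C 0).
Qed.

Let wx x y : R := b 1 y * b 0 x.
Let wx0 x y : 0 <= wx x y. Proof. by rewrite mulr_ge0. Qed.

Lemma h_deriv_lip x y z v : (forall t, 0 <= t <= 1 -> hull (z + t *: v)) ->
  `|h_deriv x y (z + v) - h_deriv x y z| <= 4 * wx x y * `|v|.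
Proof using f_C fC C0.
move=> hz; have hz1 : hull (z + v).
  by rewrite -[v]scale1r; apply: hz; rewrite ler01 lexx.
have hz0 : hull z.
  by have := hz 0; rewrite scale0r addr0; apply; rewrite lexx ler01.
have e1 : `|D2 (D1 (D1 f)) (z + v) y (f (z + v) x) - D2 (D1 (D1 f)) z y (f z x)| <=
    b 1 y * (b 0 x * `|v|) + b 1 y * `|v| * b 0 x.
  apply: apply_lip.
  - exact: (fC (j := 2) (k := 1)).
  - exact: (fC (j := 0) (k := 0)).
  - exact: (@hull_lip 1 2).
  - exact: (@hull_lip 0 0).
have e2 : `|oper_comp (D2 (D1 f) (z + v) y) (D1 f (z + v) x) -
    oper_comp (D2 (D1 f) z y) (D1 f z x)| <=
    b 1 y * (b 0 x * `|v|) + b 1 y * `|v| * b 0 x.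
  apply: oper_comp_lip.
  - exact: (fC (j := 1) (k := 1)).
  - exact: (fC (j := 1) (k := 0)).
  - exact: (@hull_lip 1 1).
  - exact: (@hull_lip 0 1).
rewrite /h_deriv opprD addrACA; apply: le_trans (ler_normD _ _) _.
apply: le_trans (lerD e1 e2) _.
by rewrite le_eqVlt; apply/orP; left; apply/eqP; rewrite /wx; ring.
Qed.

Lemma WW_rough_germ_almost_additive x y : exists2 M, 0 <= M &
  almost_additive M (3 * alpha) 0 T (WW_rough_germ f X XX x y).
Proof using All.
have M0 : 0 <= 4 * wx x y * (1 + N) ^+ 2.
  by rewrite mulr_ge0 ?mulr_ge0 ?exprn_ge0 ?addr_ge0.
have N1 : N <= (1 + N) ^+ 2.
  by rewrite sqrrD expr1n mul1r; have := sqr_ge0 N; have := N0; lra.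
have N2 : N ^+ 2 <= (1 + N) ^+ 2 by rewrite lerXn2r ?nnegrE ?addr_ge0// lerDr.
exists (2 * (4 * wx x y * (1 + N) ^+ 2 * N)); first by rewrite mulr_ge0// mulr_ge0.
have hE r : frechet (h_of f x y) (X r) = h_deriv x y (X r).
  exact: has_frechetE (h_has_frechet x y _).
apply: (rough_germ_almost_additive XN a13 M0) => s t sT tT.
  rewrite hE; apply: le_trans (path_remainder (phi := h_of f x y)
    (phi1 := h_deriv x y) (L := 4 * wx x y) _ _ _ sT tT) _.
  - by rewrite mulr_ge0.
  - by move=> z; exact: h_has_frechet.
  - move=> s' t' u sT' tT' u1; apply: le_trans (h_deriv_lip x y (subseg sT' tT' u1)) _.
    rewrite ler_wpM2l ?mulr_ge0//; case/andP: u1 => u0 u1.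
    by rewrite normrZ ger0_norm// ler_piMl.
  by rewrite ler_wpM2r ?powR_ge0// ler_wpM2l ?mulr_ge0.
rewrite !hE {1}(XE s t); apply: le_trans (h_deriv_lip x y (seg sT tT)) _.
rewrite -[leRHS]mulrA ler_wpM2l ?mulr_ge0//.
by apply: le_trans (X1 sT tT) _; rewrite ler_wpM2r// powR_ge0.
Qed.

Lemma WW_young_germ_almost_additive x y : exists2 M, 0 <= M &
  almost_additive M (3 * alpha) 0 T (WW_young_germ f X XX x y).
Proof using All.
have M0 : 0 <= 2 * wx x y * N by rewrite !mulr_ge0.
exists (2 * wx x y * N * (N ^+ 2 + 2 * N)).
  by rewrite mulr_ge0// addr_ge0 ?exprn_ge0// mulr_ge0.
apply: (young_germ_almost_additive XN a13 M0) => [s t sT tT|s v v' sT].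
  have -> : 2 * wx x y * N * w s t = b 1 y * (b 0 x * N * w s t) + b 1 y * N * w s t * b 0 x.
    by rewrite /wx; ring.
  apply: apply_lip.
  - by apply: (fC (j := 2) (k := 1)) => //; exact: path_hull_path.
  - by apply: (fC (j := 0) (k := 0)) => //; exact: path_hull_path.
  - exact: (@path_lip 1 2).
  - exact: (@path_lip 0 0).
exact: (D2D1n2_sym f_C).
Qed.

(** The germs of the two integrals defining the second level add up, through a
   second-order Taylor expansion of [D2 f] in its first variable, to the germ of
   the iterated integral. *)
Lemma WW_germ_iter x y : exists2 M, 0 <= M &
  forall s t, 0 <= s -> s <= t -> t <= T ->
  `|iter_germ XX (slope_path X f y) (value_path X f x) s t
    - (2^-1 *: WW_young_germ f X XX x y s t + WW_rough_germ f X XX x y s t)|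
  <= M * (t - s) `^ (3 * alpha).
Proof using All.
exists (wx x y * N ^+ 3); first by rewrite mulr_ge0// exprn_ge0.
move=> s t s0 st tT; have sT : 0 <= s <= T by rewrite s0 (le_trans st).
have tT' : 0 <= t <= T by rewrite (le_trans s0).
rewrite /WW_rough_germ /rough_germ (has_frechetE (h_has_frechet x y _)).
rewrite /iter_germ /WW_young_germ /young_germ /bracket /h_deriv.
have [a aE] : exists a, a = f (X s) x by exists (f (X s) x).
have [v vE] : exists v, v = X t - X s by exists (X t - X s).
rewrite operB operZ tens_liftE tens_liftD.
rewrite -[(slope_path _ _ _).2 s]/(D2 (D1 f) (X s) y).
rewrite -[(value_path _ _ _).2 s]/(D1 f (X s) x).
rewrite -[(slope_path _ _ _).1 s]/(D2 f (X s) y).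
rewrite -[(slope_path _ _ _).1 t]/(D2 f (X t) y).
rewrite -[(value_path _ _ _).1 s]/(f (X s) x).
rewrite -[h_of f x y (X s)]/(D2 (D1 f) (X s) y (f (X s) x)) -aE -vE.
have h := @taylor2 _ _ _ (fun z => D2 f z y a) (fun z => D2 (D1 f) z y a)
  (fun z => D2 (D1 (D1 f)) z y a) (X s) v (wx x y * `|v|) _ _ _.
have ident (u0 u1 u2 u3 u4 u5 : V) :
    u0 - u1 + u5 - (2^-1 *: (u3 - 2 *: u4) + (u2 + (u4 + u5))) =
    u0 - u1 - u2 - 2^-1 *: u3 by module_eq.
rewrite oper_subE.
have -> : D2 f (X t) y a - D2 f (X s) y a +
   tens_lift VV (oper_comp (D2 (D1 f) (X s) y) (D1 f (X s) x)) (XX s t) -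
   (2^-1 *: (D2 (D1 (D1 f)) (X s) y a v v -
      2 *: tens_lift VV (D2 (D1 (D1 f)) (X s) y a) (XX s t)) +
    (D2 (D1 f) (X s) y a v + (tens_lift VV (D2 (D1 (D1 f)) (X s) y a) (XX s t) +
     tens_lift VV (oper_comp (D2 (D1 f) (X s) y) (D1 f (X s) x)) (XX s t)))) =
  D2 f (X s + v) y a - D2 f (X s) y a - D2 (D1 f) (X s) y a v -
  2^-1 *: D2 (D1 (D1 f)) (X s) y a v v.
  rewrite vE -XE -vE.
  exact: ident.
apply: le_trans (h _ _ _) _.
- by move=> u _; exact: (@D21_has_frechet _ _ _ _ f_C 0).
- by move=> u _; exact: (@D21_has_frechet _ _ _ _ f_C 1).
- move=> u u1; rewrite -oper_subE.
  have := hull_lip (k := 1) (j := 2) y isT isT (subseg sT tT' u1).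
  rewrite -vE => hl.
  have au : `|a| <= b 0 x.
    by rewrite aE; apply: (fC (j := 0) (k := 0)) => //; exact: path_hull_path.
  apply: le_trans (oper_norm_leM hl au) _.
  rewrite /wx [leRHS]mulrAC ler_wpM2r// ler_wpM2l//.
  by case/andP: u1 => u0 u1; rewrite normrZ ger0_norm// ler_piMl.
rewrite -[leLHS]mulrA -[leRHS]mulrA ler_wpM2l// -exprS.
apply: le_trans (_ : (N * w s t) ^+ 3 <= _).
  by rewrite lerXn2r ?nnegrE ?mulr_ge0 ?powR_ge0// vE X1.
by rewrite exprMn -powR3M ger0_norm ?subr_ge0.
Qed.

Lemma WW_rough_sews x y s t : 0 <= s -> s <= t -> t <= T ->
  exists l, sews (WW_rough_germ f X XX x y) s t l.
Proof using All.
have [M M0 HM] := WW_rough_germ_almost_additive x y.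
exact: (sewing_exists M0 g1 HM).
Qed.

Lemma WW_young_sews x y s t : 0 <= s -> s <= t -> t <= T ->
  exists l, sews (WW_young_germ f X XX x y) s t l.
Proof using All.
have [M M0 HM] := WW_young_germ_almost_additive x y.
exact: (sewing_exists M0 g1 HM).
Qed.

(** Both sides are oriented integrals, and they have equivalent germs. *)
Lemma WW_of_iter x y s t : 0 <= s <= T -> 0 <= t <= T ->
  WW_of f X XX s t x y
  = iter_int XX (slope_path X f y) (value_path X f x) s t.
Proof using All.
have fwd u v : 0 <= u -> u <= v -> v <= T ->
    germ_integral (iter_germ XX (slope_path X f y) (value_path X f x)) u v =
    germ_integral (WW_rough_germ f X XX x y) u v +
    2^-1 *: germ_integral (WW_young_germ f X XX x y) u v.
  move=> u0 uv vT; rewrite addrC; apply: (sews_germ_integral uv _).2.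
  have [M M0 HM] := WW_germ_iter x y.
  apply: (sews_equiv g1 M0 HM u0 uv vT); apply: sews_linear.
    by apply: (germ_integral_sews (T := T)) => //; exact: WW_young_sews.
  by apply: (germ_integral_sews (T := T)) => //; exact: WW_rough_sews.
move=> /andP[s0 sT] /andP[t0 tT]; rewrite /WW_of /iter_int; congr (_ - _).
have [st|ts] := leP s t; first by rewrite fwd.
by rewrite ![germ_integral _ s t]germ_integral_swap// fwd ?(ltW ts)//; module_eq.
Qed.

End IteratedLift.

(** * The nonlinear rough path *)

Lemma sum_ereal_sup_fin {R : realType} {I : Type} (n : nat)
    (g : 'I_n -> I -> R) (S : set I) (M : R) :
  (forall k u, S u -> g k u <= M) ->
  (\sum_(k < n) ereal_sup [set (g k u)%:E | u in S] < +oo)%E.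
Proof.
move=> gM; apply: lte_sum_pinfty => k _; apply: (@le_lt_trans _ _ M%:E).
  by apply: ge_ereal_sup => _ [u Su <-]; rewrite lee_fin gM.
by rewrite ltry.
Qed.

Section NonlinearLift.
Context {R : realType} {V : completeNormedModType R} (VV : proj_tensor V).
Context (T alpha N : R) (X : R -> V) (XX : R -> R -> VV).
Hypotheses (T0 : 0 <= T) (a13 : 3^-1 < alpha).
Hypothesis XN : rough_path_le T alpha X XX N.
Context (beta : 'I_3 -> R) (f : V -> V -> V).
Hypothesis f_C : @C_loc R V 3 2 beta f.
Local Notation F k j := (D2n k (D1n j f)).
Local Notation hull := (path_hull T X).
Local Notation w s t := (`|t - s : R| `^ alpha).

Context (C : R) (C0 : 0 <= C).
Hypothesis fC : forall j k z y, (j <= 3)%N -> (k <= 2)%N -> hull z ->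
  `|F k j z y| <= C * (1 + `|y|) `^ beta (inord k).

Let N0 : 0 <= N. Proof. by case: XN. Qed.
Let a0 : 0 < alpha. Proof. by move: a13; lra. Qed.
Let X1 : time_le T alpha N (fun s t => X t - X s). Proof. by case: XN. Qed.

Let pC := value_path_family T0 a0 N0 X1 f_C C0 fC.
Let qC := slope_path_family T0 a0 N0 X1 f_C C0 fC.
Let p_ctrl := value_path_ctrl T0 a0 N0 X1 f_C C0 fC.
Let q_ctrl := slope_path_ctrl T0 a0 N0 X1 f_C C0 fC.
Let WWE := WW_of_iter T0 a13 XN f_C C0 fC.

Lemma Dn_W_increment k s t : (k <= 2)%N ->
  Dn k (fun z => W_of f X t z - W_of f X s z) =
  (fun y => F k 0 (X t) y - F k 0 (X s) y).
Proof using f_C.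
elim: k => [//|k IH] k2; apply/funext => y /=; rewrite IH ?(ltnW k2)//.
by apply: has_frechetE; apply: has_frechetB; apply: (D2n_has_frechet f_C).
Qed.

Lemma Dn_W k t : Dn k (W_of f X t) = F k 0 (X t).
Proof. by elim: k => [//|k IH]; apply/funext => y /=; rewrite IH. Qed.

Lemma W_C_space : @C_space R V alpha T 2 beta (W_of f X).
Proof using All.
split=> [t _|].
  split=> [k y k2|k k2]; rewrite Dn_W.
    by apply: has_frechet_differentiable; exact: (D2n_has_frechet f_C).
  move=> y; apply: continuous_at_eps => e e0.
  have [d d0 Hd] :=
    eps_continuous_at (@D2n_continuous _ _ _ _ f_C k 0 isT k2 (X t, y)) e0.
  exists d => // v vd; have := Hd (0, v); rewrite /= addr0; apply.
  by rewrite prod_normE/= normr0 gt_max vd d0.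
apply: (@sum_ereal_sup_fin _ _ 3 (fun k (u : (R * R) * V) =>
  `|Dn k (fun z => W_of f X u.1.2 z - W_of f X u.1.1 z) u.2| *
  `|u.1.2 - u.1.1| `^ (- alpha) * (1 + `|u.2|) `^ (- beta k)) _ (C * N)).
move=> k [[s t] y] [[/= sT tT st] _]; rewrite Dn_W_increment; last by rewrite -ltnS.
have w0 : 0 < w s t by rewrite powR_gt0// normr_gt0 subr_eq0 eq_sym.
have v0 : 0 < (1 + `|y|) `^ beta k by rewrite powR_gt0// ltr_pwDl.
rewrite !powRN ler_pdivrMr// ler_pdivrMr//.
have := path_lip XN f_C C0 fC y (k := k) (j := 0) _ isT sT tT.
rewrite inord_val => /(_ _)h; apply: le_trans (h _) _; first by rewrite -ltnS.
by rewrite le_eqVlt; apply/orP; left; apply/eqP; ring.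
Qed.

Let K s t : R := iter_bound T alpha N * w s t ^+ 2.

Let K0 s t : 0 <= K s t.
Proof.
rewrite mulr_ge0 ?exprn_ge0 ?powR_ge0//.
exact: (iter_bound_ge0 XN T0 a13).
Qed.

Let fb0 k (y : V) : 0 <= family_bound N beta C k y.
Proof. by rewrite mulr_ge0 ?exprn_ge0 ?addr_ge0// mulr_ge0// powR_ge0. Qed.

(** The iterated integral is a bounded bilinear map of two C1 families. *)
Lemma WW_has_frechet s t : 0 <= s <= T -> 0 <= t <= T ->
  exists D : V * V -> 'L((V * V)%type, V),
  [/\ forall z, has_frechet (fun p : V * V => WW_of f X XX s t p.1 p.2) z (D z),
      forall z, `|D z| <= K s t *
        (family_bound N beta C 1 z.2 * family_bound N beta C 1 z.1 +
         family_bound N beta C 2 z.2 * family_bound N beta C 0 z.1)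
    & continuous D].
Proof using All.
move=> sT tT.
have nE0 M q : oper_ctrl_le T alpha X M q -> 0 <= M by case.
have nF0 M p : ctrl_le T alpha X M p -> 0 <= M by case.
pose J q p := iter_int XX q p s t.
have JC M M' q p : oper_ctrl_le T alpha X M q -> ctrl_le T alpha X M' p ->
    `|J q p| <= K s t * (M * M').
  move=> qM pM; apply: le_trans (iter_int_le XN T0 a13 pM qM sT tT) _.
  by rewrite le_eqVlt; apply/orP; left; apply/eqP; rewrite /K; ring.
have Jl M M' M'' c q q' p : oper_ctrl_le T alpha X M q ->
    oper_ctrl_le T alpha X M' q' -> ctrl_le T alpha X M'' p ->
    J (c *: q + q') p = c *: J q p + J q' p.
  by move=> qM qM' pM; exact: (iter_int_linearl XN a13 c pM qM qM' sT tT).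
have Jr M M' M'' c q p p' : oper_ctrl_le T alpha X M q ->
    ctrl_le T alpha X M' p -> ctrl_le T alpha X M'' p' ->
    J q (c *: p + p') = c *: J q p + J q p'.
  by move=> qM pM pM'; exact: (iter_int_linearr XN a13 c pM pM' qM sT tT).
have nED M M' q q' : oper_ctrl_le T alpha X M q -> oper_ctrl_le T alpha X M' q' ->
    oper_ctrl_le T alpha X (M + M') (q + q') by exact: oper_ctrl_leD.
have nFD M M' p p' : ctrl_le T alpha X M p -> ctrl_le T alpha X M' p' ->
    ctrl_le T alpha X (M + M') (p + p') by exact: ctrl_leD.
exists (bilinear_derivative (K0 s t) nE0 nF0 nED nFD JC Jl Jr qC pC); split=> [z|z|].
- have := bilinear_has_frechet (K0 s t) nE0 nF0 nED nFD JC Jl Jr qC pC z.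
  congr (has_frechet _ z _); apply/funext => p.
  by rewrite WWE.
- exact: bilinear_derivative_norm.
- exact: bilinear_derivative_continuous.
Qed.

Lemma WW_le s t x y : 0 <= s <= T -> 0 <= t <= T ->
  `|WW_of f X XX s t x y| <=
  K s t * (family_bound N beta C 1 y * family_bound N beta C 0 x).
Proof using All.
move=> sT tT; rewrite WWE//.
apply: le_trans (iter_int_le XN T0 a13 (p_ctrl x) (q_ctrl y) sT tT) _.
by rewrite le_eqVlt; apply/orP; left; apply/eqP; rewrite /K; ring.
Qed.

Lemma WW_local s t x y : 0 <= s -> s <= t -> t <= T ->
  `|WW_of f X XX s t x y
    - tens_lift VV (oper_comp (D2 (D1 f) (X s) y) (D1 f (X s) x)) (XX s t)|
  <= iter_const alpha N *
     (family_bound N beta C 0 x * family_bound N beta C 1 y) * w s t ^+ 3.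
Proof using All.
move=> s0 st tT; rewrite WWE; last 2 first.
- by rewrite s0 (le_trans st).
- by rewrite (le_trans s0).
exact: (iter_int_local XN a13 (p_ctrl x) (q_ctrl y) s0 st tT).
Qed.

Lemma WW_chen s u t x y : 0 <= s <= T -> 0 <= u <= T -> 0 <= t <= T ->
  WW_of f X XX s t x y - WW_of f X XX s u x y - WW_of f X XX u t x y
  = frechet (fun z => W_of f X t z - W_of f X u z) y
      (W_of f X u x - W_of f X s x).
Proof using All.
move=> sT uT tT; rewrite !WWE//.
rewrite (iter_int_chen XN a13 (p_ctrl x) (q_ctrl y) sT uT tT).
have -> : frechet (fun z => W_of f X t z - W_of f X u z) y =
    D2 f (X t) y - D2 f (X u) y.
  by apply: has_frechetE; apply: has_frechetB; exact: (@D2n_has_frechet _ _ _ _ f_C 0 0).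
by [].
Qed.

Let inordE (k : nat) (i : 'I_3) : (k < 3)%N -> val i = k -> inord k = i.
Proof. by move=> k3 ik; apply: val_inj; rewrite /= inordK. Qed.

Lemma WW_C2_space :
  @C2_space R V (2 * alpha) T 1 (beta_star beta) (beta_star2 beta) (WW_of f X XX).
Proof using All.
have b0 : inord 0 = 0 :> 'I_3 by exact: inordE.
have b1 : inord 1 = 1 :> 'I_3 by exact: inordE.
have b2 : inord 2 = 2 :> 'I_3 by exact: inordE.
split=> [s t sT tT|].
  have [D [DE _ Dc]] := WW_has_frechet sT tT.
  split=> [[|//] z _|[|[|//]] _ z].
  - exact: has_frechet_differentiable (DE z).
  - exact: has_frechet_continuous (DE z).
  - rewrite (_ : Dn 1 _ = D); first exact: Dc.
    by apply/funext => z'; exact: has_frechetE (DE z').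
pose c := (1 + N) ^+ 2 * C.
have c0 : 0 <= c by rewrite mulr_ge0// exprn_ge0// addr_ge0.
have fbE k (y : V) : family_bound N beta C k y = c * (1 + `|y|) `^ beta (inord k).
  by rewrite /family_bound mulrA.
have y1 (y : V) : 1 <= 1 + `|y| by rewrite lerDl.
have bmax (y : V) (r m : R) : r <= m -> (1 + `|y|) `^ r <= (1 + `|y|) `^ m.
  by move=> rm; exact: ler_powR.
apply: (@sum_ereal_sup_fin _ _ 2 (fun k (u : (R * R) * (V * V)) =>
  `|Dn k (fun p : V * V => WW_of f X XX u.1.1 u.1.2 p.1 p.2) u.2| *
  `|u.1.2 - u.1.1| `^ (- (2 * alpha)) * (1 + `|u.2.1|) `^ (- beta_star beta k) *
  (1 + `|u.2.2|) `^ (- beta_star2 beta k)) _ (2 * (iter_bound T alpha N * c ^+ 2))).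
move=> k [[s t] [x y]] [[/= sT tT st] _].
have w0 : 0 < `|t - s| `^ (2 * alpha).
  by rewrite powR_gt0// normr_gt0 subr_eq0 eq_sym.
have vx m : 0 < (1 + `|x|) `^ m by rewrite powR_gt0// ltr_pwDl.
have vy m : 0 < (1 + `|y|) `^ m by rewrite powR_gt0// ltr_pwDl.
rewrite !powRN ler_pdivrMr// ler_pdivrMr// ler_pdivrMr//.
have ic0 := iter_bound_ge0 XN T0 a13.
have w2 : 0 <= w s t ^+ 2 by rewrite exprn_ge0// powR_ge0.
rewrite powR2M.
case: k => [[|[|//]]] k2 /=.
  rewrite /beta_star /beta_star2 /=.
  apply: le_trans (WW_le x y sT tT) _; rewrite !fbE b0 b1 /K.
  set px := (1 + `|x|) `^ beta 0; set py := (1 + `|y|) `^ beta 1.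
  rewrite [leLHS](_ : _ = iter_bound T alpha N * c ^+ 2 * py * px * w s t ^+ 2); last by ring.
  rewrite ler_wpM2r//.
  have q0 : 0 <= iter_bound T alpha N * c ^+ 2 * py * px.
    rewrite mulr_ge0 ?powR_ge0// mulr_ge0 ?powR_ge0// mulr_ge0//.
    by rewrite exprn_ge0.
  rewrite [leRHS](_ : _ = 2 * (iter_bound T alpha N * c ^+ 2 * py * px)); last by ring.
  by move: q0; lra.
rewrite /beta_star /beta_star2 /=.
have [D [DE Dle _]] := WW_has_frechet sT tT.
rewrite (has_frechetE (DE (x, y))); apply: le_trans (Dle (x, y)) _.
rewrite /= !fbE b0 b1 b2 /K.
have hx0 := bmax x (beta 0) (Num.max (beta 0) (beta 1)).
have hx1 := bmax x (beta 1) (Num.max (beta 0) (beta 1)).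
have hy1 := bmax y (beta 1) (Num.max (beta 1) (beta 2)).
have hy2 := bmax y (beta 2) (Num.max (beta 1) (beta 2)).
rewrite !le_max !lexx ?orbT in hx0 hx1 hy1 hy2.
have {}hx0 := hx0 isT; have {}hx1 := hx1 isT.
have {}hy1 := hy1 isT; have {}hy2 := hy2 isT.
set PX := (1 + `|x|) `^ Num.max _ _ in hx0 hx1 *.
set PY := (1 + `|y|) `^ Num.max _ _ in hy1 hy2 *.
rewrite [leLHS](_ : _ = iter_bound T alpha N * c ^+ 2 *
  ((1 + `|y|) `^ beta 1 * (1 + `|x|) `^ beta 1 +
   (1 + `|y|) `^ beta 2 * (1 + `|x|) `^ beta 0) * w s t ^+ 2); last by ring.
rewrite ler_wpM2r//.
rewrite [leRHS](_ : _ = iter_bound T alpha N * c ^+ 2 * (PY * PX + PY * PX)); last by ring.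
have ic : 0 <= iter_bound T alpha N * c ^+ 2 by rewrite mulr_ge0// exprn_ge0.
rewrite ler_wpM2l//.
by rewrite lerD// ler_pM// powR_ge0.
Qed.

Theorem WW_nonlinear_rough_path :
  nonlinear_rough_path alpha T beta (W_of f X) (WW_of f X XX).
Proof using All.
split; [exact: W_C_space|exact: WW_C2_space|].
by move=> s u t x y sT uT tT; exact: WW_chen.
Qed.

End NonlinearLift.

(** * The nonlinear integral as a linear rough integral *)

Section IntegralFormula.
Context {R : realType} {V : completeNormedModType R} (VV : proj_tensor V).
Context (T alpha N : R) (X : R -> V) (XX : R -> R -> VV).
Hypotheses (T0 : 0 <= T) (a13 : 3^-1 < alpha).
Hypothesis XN : rough_path_le T alpha X XX N.
Context (beta : 'I_3 -> R) (f : V -> V -> V).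
Hypotheses (f_C : @C_loc R V 3 2 beta f) (beta_ge0 : forall k, 0 <= beta k).
Local Notation F k j := (D2n k (D1n j f)).
Local Notation hull := (path_hull T X).
Local Notation w s t := (`|t - s : R| `^ alpha).

Context (C : R) (C0 : 0 <= C).
Hypothesis fC : forall j k z y, (j <= 3)%N -> (k <= 2)%N -> hull z ->
  `|F k j z y| <= C * (1 + `|y|) `^ beta (inord k).

Context (Y Yd : R -> V) (M r : R).
Hypotheses (M0 : 0 <= M)
  (YM : time_le T alpha M (fun s t => Y t - Y s))
  (YdM : time_le T alpha M (fun s t => Yd t - Yd s))
  (YYdM : time_le T (2 * alpha) M
     (fun s t => (Y t - Y s) - (W_of f X t (Yd s) - W_of f X s (Yd s))))
  (Yr : forall s, 0 <= s <= T -> `|Y s| <= r)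
  (Ydr : forall s, 0 <= s <= T -> `|Yd s| <= r).

Let N0 : 0 <= N. Proof. by case: XN. Qed.
Let a0 : 0 < alpha. Proof. by move: a13; lra. Qed.
Let g1 : 1 < 3 * alpha. Proof. by move: a13; lra. Qed.
Let X1 : time_le T alpha N (fun s t => X t - X s). Proof. by case: XN. Qed.
Let r0 : 0 <= r.
Proof. by apply: le_trans (Yr (s := 0) _) => //; rewrite lexx. Qed.

Let B : R := C * (1 + r) `^ beta 0 + C * (1 + r) `^ beta 1 + C * (1 + r) `^ beta 2.

Let B0 : 0 <= B.
Proof. by rewrite !addr_ge0// mulr_ge0// powR_ge0. Qed.

(** The weights increase with [`|y|], as [beta] is nonnegative, so one constant
   serves on the ball containing both paths. *)
Let weight_le k (y : V) : (k <= 2)%N -> `|y| <= r ->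
  C * (1 + `|y|) `^ beta (inord k) <= B.
Proof.
move=> k2 yr.
have h (i : 'I_3) : C * (1 + `|y|) `^ beta i <= C * (1 + r) `^ beta i.
  by rewrite ler_wpM2l// ge0_ler_powR ?nnegrE ?addr_ge0// lerD2l.
have p (i : 'I_3) : 0 <= C * (1 + r) `^ beta i by rewrite mulr_ge0// powR_ge0.
have := p 0; have := p 1; have := p 2; have := h (inord k).
have -> : inord k = [:: 0; 1; 2]`_k :> 'I_3.
  by apply: val_inj; case: k k2 => [|[|[|//]]] _; rewrite /= inordK.
by case: k k2 => [|[|[|//]]] _ /=; rewrite /B; lra.
Qed.

Let fB j k z y : (j <= 3)%N -> (k <= 2)%N -> hull z -> `|y| <= r ->
  `|F k j z y| <= B.
Proof.
by move=> j3 k2 hz yr; apply: le_trans (fC _ j3 k2 hz) (weight_le k2 yr).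
Qed.

Let x_lip k j s t y : (k <= 2)%N -> (j < 3)%N -> 0 <= s <= T -> 0 <= t <= T ->
  `|y| <= r -> `|F k j (X t) y - F k j (X s) y| <= B * N * w s t.
Proof.
move=> k2 j3 sT tT yr; apply: le_trans (path_lip XN f_C C0 fC y k2 j3 sT tT) _.
rewrite -[leLHS]mulrA -[leRHS]mulrA; apply: ler_wpM2r; last exact: weight_le.
by rewrite mulr_ge0// powR_ge0.
Qed.

Let ball_convex (y y' : V) t : `|y| <= r -> `|y'| <= r -> 0 <= t <= 1 ->
  `|y + t *: (y' - y)| <= r.
Proof.
move=> yr yr' /andP[t0 t1].
have -> : y + t *: (y' - y) = (1 - t) *: y + t *: y' by module_eq.
apply: le_trans (ler_normD _ _) _; rewrite !normrZ !ger0_norm ?subr_ge0//.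
have := ler_wpM2l t0 yr'; have := ler_wpM2l (_ : 0 <= 1 - t) yr.
by rewrite subr_ge0 => /(_ t1); lra.
Qed.

Let yE (y y' : V) : y' = y + (y' - y). Proof. by rewrite addrC subrK. Qed.

Let y_lip k j z y y' : (k < 2)%N -> (j <= 3)%N -> hull z ->
  `|y| <= r -> `|y'| <= r -> `|F k j z y' - F k j z y| <= B * `|y' - y|.
Proof.
move=> k2 j3 hz yr yr'; rewrite {1}(yE y y').
apply: (mean_value_le (f := F k j z) (f1 := F k.+1 j z)) => t t1.
  exact: (D2n_has_frechet f_C).
by apply: (fB (j := j) (k := k.+1)) => //; exact: ball_convex.
Qed.

Let y_lip_path k j z s t : (k < 2)%N -> (j <= 3)%N -> hull z ->
  0 <= s <= T -> 0 <= t <= T -> `|F k j z (Y t) - F k j z (Y s)| <= B * M * w s t.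
Proof.
move=> k2 j3 hz sT tT; apply: le_trans (y_lip k2 j3 hz (Yr sT) (Yr tT)) _.
by rewrite -mulrA ler_wpM2l// YM.
Qed.

Let Y' t := D1 f (X t) (Yd t).
Let H t := D1 f (X t) (Y t).
Let H' t := D1 (D1 f) (X t) (Y t) + oper_comp (D2 (D1 f) (X t) (Y t)) (Y' t).
Let A t := D1 (D1 f) (X t) (Y t).

Let Y'B t : 0 <= t <= T -> `|Y' t| <= B.
Proof.
move=> tT; apply: (fB (j := 1) (k := 0)) => //; last exact: Ydr.
exact: path_hull_path.
Qed.

Let Y'_lip : time_le T alpha (B * N + B * M) (fun s t => Y' t - Y' s).
Proof.
move=> s t sT tT.
apply: le_trans (ler_distD (F 0 1 (X s) (Yd t)) _ _) _; rewrite mulrDl; apply: lerD.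
  by apply: x_lip => //; exact: Ydr.
have hs := path_hull_path X sT.
apply: le_trans (y_lip (k := 0) (j := 1) isT isT hs (Ydr sT) (Ydr tT)) _.
by rewrite -mulrA ler_wpM2l// YdM.
Qed.

(** [Y] is approximated by the increment of [W] at [Yd s], and the latter by its
   first-order expansion in [X]. *)
Let Y_remainder : time_le T (2 * alpha) (M + B * N ^+ 2)
  (fun s t => (Y t - Y s) - Y' s (X t - X s)).
Proof.
move=> s t sT tT; rewrite mulrDl.
have ident (u u' a v v' : V) :
    u - u' - a = ((u - u') - (v - v')) + (v - v' - a) by module_eq.
rewrite (ident _ _ _ (W_of f X t (Yd s)) (W_of f X s (Yd s))).
apply: le_trans (ler_normD _ _) _; apply: lerD; first exact: YYdM.
apply: (path_remainder XN (phi := f ^~ (Yd s)) (phi1 := D1 f ^~ (Yd s))) => //.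
  by move=> z; exact: (@D1n_has_frechet _ _ _ _ f_C 0).
move=> s' t' u sT' tT' u1.
have hz v : 0 <= v <= 1 -> hull (X s' + v *: (u *: (X t' - X s'))).
  by move=> v1; exact: path_hull_subsegment.
apply: le_trans (hull_lip f_C C0 fC (Yd s) (k := 0) (j := 1) isT isT hz) _.
apply: ler_pM => //; first by rewrite mulr_ge0// powR_ge0.
  by apply: weight_le => //; exact: Ydr.
by case/andP: u1 => u0 u1; rewrite normrZ ger0_norm// ler_piMl.
Qed.

Lemma Y_controlled : controlled alpha T X Y Y'.
Proof using All.
split.
- exact: time_boundedW YM.
- exact: time_boundedW Y'_lip.
- exact: time_boundedW Y_remainder.
Qed.

Let A_lip : time_le T alpha (B * N + B * M) (fun s t => A t - A s).
Proof.
move=> s t sT tT.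
apply: le_trans (ler_distD (F 0 2 (X s) (Y t)) _ _) _; rewrite mulrDl; apply: lerD.
  by apply: (x_lip (k := 0) (j := 2)) => //; exact: Yr.
apply: (y_lip_path (k := 0) (j := 2)) => //.
exact: path_hull_path.
Qed.

Let H'_lip : exists2 L, 0 <= L & time_le T alpha L (fun s t => H' t - H' s).
Proof.
pose L := B * N + B * M.
have L0 : 0 <= L by rewrite addr_ge0// mulr_ge0.
exists (L + (B * L + L * B)); first by rewrite !addr_ge0// mulr_ge0.
move=> s t sT tT; have hs := path_hull_path X sT; have ht := path_hull_path X tT.
rewrite /H' opprD addrACA; apply: le_trans (ler_normD _ _) _.
rewrite mulrDl; apply: lerD; first exact: A_lip.
rewrite [leRHS](_ : _ = B * (L * w s t) + (L * w s t) * B); last by ring.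
apply: oper_comp_lip.
- by apply: (fB (j := 1) (k := 1)) => //; exact: Yr.
- exact: Y'B.
- apply: le_trans (ler_distD (F 1 1 (X s) (Y t)) _ _) _; rewrite mulrDl; apply: lerD.
    by apply: (x_lip (k := 1) (j := 1)) => //; exact: Yr.
  exact: (y_lip_path (k := 1) (j := 1)).
- exact: Y'_lip.
Qed.

(** First-order expansion of [D1 f] in both variables: the increment of [Y] is
   replaced by its linear part in [X] only after the expansion. *)
Let H_remainder : exists2 L, 0 <= L & time_le T (2 * alpha) L
  (fun s t => H t - H s - H' s (X t - X s)).
Proof.
exists (B * N ^+ 2 + B * M * N + (B * M ^+ 2 + B * (M + B * N ^+ 2))).
  have BN : 0 <= B * N ^+ 2 by rewrite mulr_ge0// exprn_ge0.
  have BM : 0 <= B * M ^+ 2 by rewrite mulr_ge0// exprn_ge0.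
  have BMN : 0 <= B * M * N by rewrite mulr_ge0// mulr_ge0.
  have BB : 0 <= B * (M + B * N ^+ 2) by rewrite mulr_ge0// addr_ge0.
  by move: BN BM BMN BB; lra.
move=> s t sT tT; have hs := path_hull_path X sT.
have w0 : 0 <= w s t by exact: powR_ge0.
have [v vE] : exists v, v = X t - X s by exists (X t - X s).
have [e eE] : exists e, e = Y t - Y s by exists (Y t - Y s).
have eM : `|e| <= M * w s t by rewrite eE YM.
have ident (u u' u'' a a' c d : 'L(V, V)) :
  u - u' - (a' + d) = (u - u'' - a) + (a - a') + ((u'' - u' - c) + (c - d)).
  by module_eq.
have -> : H t - H s - H' s (X t - X s) =
    (F 0 1 (X t) (Y t) - F 0 1 (X s) (Y t) - F 0 2 (X s) (Y t) v) +
    (F 0 2 (X s) (Y t) v - F 0 2 (X s) (Y s) v) +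
    ((F 0 1 (X s) (Y t) - F 0 1 (X s) (Y s) - F 1 1 (X s) (Y s) e) +
     (F 1 1 (X s) (Y s) e - F 1 1 (X s) (Y s) (Y' s v))).
  rewrite -vE; exact: ident.
have e1 : `|F 0 1 (X t) (Y t) - F 0 1 (X s) (Y t) - F 0 2 (X s) (Y t) v| <=
    B * N ^+ 2 * w s t ^+ 2.
  rewrite -powR2M vE; apply: (path_remainder XN (phi := F 0 1 ^~ (Y t))
    (phi1 := F 0 2 ^~ (Y t))) => //.
    by move=> z; exact: (@D1n_has_frechet _ _ _ _ f_C 1).
  move=> s' t' u sT' tT' u1.
  have hz v' : 0 <= v' <= 1 -> hull (X s' + v' *: (u *: (X t' - X s'))).
    by move=> v1; exact: path_hull_subsegment.
  apply: le_trans (hull_lip f_C C0 fC (Y t) (k := 0) (j := 2) isT isT hz) _.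
  apply: ler_pM => //; first by rewrite mulr_ge0// powR_ge0.
    by apply: weight_le => //; exact: Yr.
  by case/andP: u1 => u0 u1; rewrite normrZ ger0_norm// ler_piMl.
have e2 : `|F 0 2 (X s) (Y t) v - F 0 2 (X s) (Y s) v| <= B * M * N * w s t ^+ 2.
  rewrite -oper_subE [leRHS](_ : _ = B * M * w s t * (N * w s t)); last by ring.
  apply: oper_norm_leM; first exact: (y_lip_path (k := 0) (j := 2)).
  by rewrite vE; exact: X1.
have e3 : `|F 0 1 (X s) (Y t) - F 0 1 (X s) (Y s) - F 1 1 (X s) (Y s) e| <=
    B * M ^+ 2 * w s t ^+ 2.
  have -> : Y t = Y s + e by rewrite eE; exact: yE.
  apply: le_trans (taylor1 (f := F 0 1 (X s)) (f1 := F 1 1 (X s)) (M := B * `|e|) _ _) _.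
  - by move=> u _; exact: (@D2n_has_frechet _ _ _ _ f_C 0 1).
  - move=> u u1.
    have yr : `|Y s + u *: e| <= r by rewrite eE; apply: ball_convex => //; exact: Yr.
    apply: le_trans (y_lip (k := 1) (j := 1) isT isT hs (Yr sT) yr) _.
    rewrite addrAC subrr add0r ler_wpM2l//; case/andP: u1 => u0 u1.
    by rewrite normrZ ger0_norm// ler_piMl.
  rewrite -[leLHS]mulrA -[leRHS]mulrA ler_wpM2l// -exprMn -expr2.
  by rewrite lerXn2r ?nnegrE// mulr_ge0.
have e4 : `|F 1 1 (X s) (Y s) e - F 1 1 (X s) (Y s) (Y' s v)| <=
    B * (M + B * N ^+ 2) * w s t ^+ 2.
  rewrite -operB -mulrA; apply: oper_norm_leM.
    by apply: (fB (j := 1) (k := 1)) => //; exact: Yr.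
  by rewrite -powR2M vE eE; exact: Y_remainder.
apply: le_trans (ler_normD _ _) _; rewrite powR2M mulrDl; apply: lerD.
  by apply: le_trans (ler_normD _ _) _; rewrite mulrDl; exact: lerD.
by apply: le_trans (ler_normD _ _) _; rewrite mulrDl; exact: lerD.
Qed.

Lemma formula_rough_sews s t : 0 <= s -> s <= t -> t <= T ->
  exists l, sews (rough_germ X XX H H') s t l.
Proof using All.
have [L L0 HL] := H_remainder; have [L' L'0 HL'] := H'_lip.
have LL : 0 <= L + L' by rewrite addr_ge0.
have C1 : 0 <= 2 * ((L + L') * N) by rewrite mulr_ge0// mulr_ge0.
apply: (sewing_exists C1 g1); apply: (rough_germ_almost_additive XN a13 LL).
- move=> s' t' sT tT; apply: le_trans (HL _ _ sT tT) _.
  by rewrite ler_wpM2r ?powR_ge0// lerDl.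
- move=> s' t' sT tT; apply: le_trans (HL' _ _ sT tT) _.
  by rewrite ler_wpM2r ?powR_ge0// lerDr.
Qed.

Lemma formula_young_sews s t : 0 <= s -> s <= t -> t <= T ->
  exists l, sews (young_germ X XX A) s t l.
Proof using All.
have L0 : 0 <= B * N + B * M by rewrite addr_ge0// mulr_ge0.
have C1 : 0 <= (B * N + B * M) * (N ^+ 2 + 2 * N).
  by rewrite mulr_ge0// addr_ge0 ?exprn_ge0// mulr_ge0.
apply: (sewing_exists C1 g1); apply: (young_germ_almost_additive XN a13 L0 A_lip).
by move=> s' v v' _; exact: (D1n2_sym f_C).
Qed.

(** Expanding [f] to second order at [X s] turns the increment of [W] into the
   first-order term and half of a square of [X]; the square splits into the
   bracket and [2 *: XX s t], and the latter joins the local approximation of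
   the second level of the lift to form the compensator of the rough germ. *)
Lemma nl_germ_formula : exists2 L, 0 <= L &
  forall s t, 0 <= s -> s <= t -> t <= T ->
  `|nl_germ (W_of f X) (WW_of f X XX) Y Yd s t
    - (2^-1 *: young_germ X XX A s t + rough_germ X XX H H' s t)|
  <= L * (t - s) `^ (3 * alpha).
Proof using All.
pose b := (1 + N) ^+ 2 * B; pose c := sewing_const (1 + 4 * N) (3 * alpha).
have c0 : 0 <= c by apply: sewing_const_ge0 => //; rewrite addr_ge0// mulr_ge0.
have b0 : 0 <= b by rewrite mulr_ge0// exprn_ge0// addr_ge0.
have fbb k (y : V) : (k <= 2)%N -> `|y| <= r -> family_bound N beta C k y <= b.
  by move=> k2 yr; rewrite ler_wpM2l ?weight_le// exprn_ge0// addr_ge0.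
have fb0 k (y : V) : 0 <= family_bound N beta C k y.
  by rewrite mulr_ge0 ?exprn_ge0 ?addr_ge0// mulr_ge0// powR_ge0.
exists (B * N ^+ 3 + c * (b * b)).
  by rewrite addr_ge0// mulr_ge0 ?exprn_ge0// mulr_ge0.
move=> s t s0 st tT; have sT : 0 <= s <= T by rewrite s0 (le_trans st).
have tT' : 0 <= t <= T by rewrite (le_trans s0).
have w0 : 0 <= w s t by exact: powR_ge0.
have [v vE] : exists v, v = X t - X s by exists (X t - X s).
have e2 : `|WW_of f X XX s t (Yd s) (Y s)
    - tens_lift VV (oper_comp (D2 (D1 f) (X s) (Y s)) (Y' s)) (XX s t)|
    <= c * (b * b) * w s t ^+ 3.
  apply: le_trans (WW_local T0 a13 XN f_C C0 fC (Yd s) (Y s) s0 st tT) _.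
  rewrite ler_wpM2r ?exprn_ge0// ler_wpM2l//.
  by apply: ler_pM => //; apply: fbb => //; [exact: Ydr|exact: Yr].
have e1 : `|f (X t) (Y s) - f (X s) (Y s) - D1 f (X s) (Y s) v
    - 2^-1 *: D1 (D1 f) (X s) (Y s) v v| <= B * N ^+ 3 * w s t ^+ 3.
  have -> : X t = X s + v by rewrite vE; exact: yE.
  apply: le_trans (taylor2 (f := f ^~ (Y s)) (f1 := D1 f ^~ (Y s))
    (f2 := D1 (D1 f) ^~ (Y s)) (M := B * `|v|) _ _ _) _.
  - by move=> u _; exact: (@D1n_has_frechet _ _ _ _ f_C 0).
  - by move=> u _; exact: (@D1n_has_frechet _ _ _ _ f_C 1).
  - move=> u u1.
    have hz v' : 0 <= v' <= 1 -> hull (X s + v' *: (u *: v)).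
      by move=> v1; rewrite vE; exact: path_hull_subsegment.
    apply: le_trans (hull_lip f_C C0 fC (Y s) (k := 0) (j := 2) isT isT hz) _.
    apply: ler_pM => //; first by rewrite mulr_ge0// powR_ge0.
      by apply: weight_le => //; exact: Yr.
    by case/andP: u1 => u0 u1; rewrite normrZ ger0_norm// ler_piMl.
  rewrite -[leLHS]mulrA -[leRHS]mulrA ler_wpM2l// -exprS -exprMn.
  by rewrite lerXn2r ?nnegrE ?mulr_ge0// vE X1.
rewrite -[t - s]ger0_norm ?subr_ge0// powR3M mulrDl.
apply: le_trans (lerD e1 e2); apply: le_trans (ler_normD _ _).
rewrite le_eqVlt; apply/orP; left; apply/eqP; congr (`|_|).
have ident (u0 u1 u2 u3 u4 u5 u6 : V) :
    u0 - u1 + u6 - (2^-1 *: (u3 - 2 *: u4) + (u2 + (u4 + u5))) =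
    (u0 - u1 - u2 - 2^-1 *: u3) + (u6 - u5) by module_eq.
rewrite /nl_germ /young_germ /rough_germ /bracket -vE operB operZ tens_liftE tens_liftD.
exact: ident.
Qed.

(** Equivalent germs have the same integral, and integrals are linear in the germ. *)
Theorem nl_integral_formula s t : 0 <= s -> s <= t -> t <= T ->
  [/\ integral_exists (nl_germ (W_of f X) (WW_of f X XX) Y Yd) s t,
      integral_exists (rough_germ X XX H H') s t,
      integral_exists (young_germ X XX A) s t
    & germ_integral (nl_germ (W_of f X) (WW_of f X XX) Y Yd) s t
      = germ_integral (rough_germ X XX H H') s t
        + 2^-1 *: germ_integral (young_germ X XX A) s t].
Proof using All.
move=> s0 st tT.
have [l Sl] := formula_rough_sews s0 st tT; have [lE ->] := sews_germ_integral st Sl.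
have [m Sm] := formula_young_sews s0 st tT; have [mE ->] := sews_germ_integral st Sm.
have [L L0 HL] := nl_germ_formula.
have S := sews_equiv g1 L0 HL s0 st tT (sews_linear 2^-1 Sm Sl).
by have [nE ->] := sews_germ_integral st S; split=> //; rewrite addrC.
Qed.

End IntegralFormula.

(** * Explicit bounds for rough and controlled paths *)

(** The Chen relation at equal times makes [XX s s] vanish, so that the bound off
   the diagonal extends to the diagonal. *)
Lemma rough_path_bound {R : realType} {V : completeNormedModType R}
    (VV : proj_tensor V) (T alpha : R) (X : R -> V) (XX : R -> R -> VV) :
  rough_path alpha T X XX -> exists N, rough_path_le T alpha X XX N.
Proof.
case=> Xh XXb chen; have [N N0 XN] := holderP Xh.
have [s sT|N' N'0 XXN] := @time_boundedP _ _ T (2 * alpha) XX _ XXb.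
  have /eqP := chen s s s sT sT sT.
  by rewrite !subrr tens0l sub0r oppr_eq0 => /eqP.
exists (N + N'); split=> // [|s t sT tT|s t sT tT]; first exact: addr_ge0.
  by apply: le_trans (XN s t sT tT) _; rewrite ler_wpM2r ?powR_ge0// lerDl.
by apply: le_trans (XXN s t sT tT) _; rewrite ler_wpM2r ?powR_ge0// lerDr.
Qed.

Lemma nl_controlled_bound {R : realType} {V : normedModType R} (T alpha : R)
    (W : R -> V -> V) (Y Yd : R -> V) : 0 <= T -> 0 <= alpha ->
  nl_controlled alpha T W Y Yd -> exists M r,
  [/\ 0 <= M, time_le T alpha M (fun s t => Y t - Y s),
      time_le T alpha M (fun s t => Yd t - Yd s),
      time_le T (2 * alpha) M
        (fun s t => (Y t - Y s) - (W t (Yd s) - W s (Yd s)))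
    & forall s, 0 <= s <= T -> `|Y s| <= r /\ `|Yd s| <= r].
Proof.
move=> T0 a0 [Yh Ydh YYd].
have [M1 M10 YM] := holderP Yh; have [M2 M20 YdM] := holderP Ydh.
have [s _|M3 M30 YYdM] := time_boundedP _ YYd; first by rewrite !subrr.
pose M := M1 + M2 + M3; have M0 : 0 <= M by rewrite !addr_ge0.
have {}YM : time_le T alpha M (fun s t => Y t - Y s).
  move=> s t sT tT; apply: le_trans (YM s t sT tT) _.
  by rewrite ler_wpM2r ?powR_ge0// /M; move: M20 M30; lra.
have {}YdM : time_le T alpha M (fun s t => Yd t - Yd s).
  move=> s t sT tT; apply: le_trans (YdM s t sT tT) _.
  by rewrite ler_wpM2r ?powR_ge0// /M; move: M10 M30; lra.
have bnd (Z : R -> V) (s : R) : time_le T alpha M (fun s t => Z t - Z s) ->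
    0 <= s <= T -> `|Z s| <= `|Z 0| + M * T `^ alpha.
  move=> ZM sT; have zT : 0 <= (0 : R) <= T by rewrite lexx T0.
  rewrite -[Z s](subrK (Z 0)) addrC; apply: le_trans (ler_normD _ _) _.
  rewrite lerD2l; apply: le_trans (ZM _ _ zT sT) _; rewrite ler_wpM2l//.
  case/andP: sT => s0 sT; apply: ge0_ler_powR => //; rewrite ?nnegrE//.
  by rewrite subr0 ger0_norm.
exists M, (`|Y 0| + `|Yd 0| + M * T `^ alpha); split=> // [s t sT tT|s sT].
  apply: le_trans (YYdM s t sT tT) _.
  by rewrite ler_wpM2r ?powR_ge0// /M; move: M10 M20; lra.
have := bnd _ _ YM sT; have := bnd _ _ YdM sT.
have := normr_ge0 (Y 0); have := normr_ge0 (Yd 0).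
by split; lra.
Qed.

Unset Implicit Arguments.
Set Strict Implicit.
Set Printing Implicit Defensive.
Theorem theorem5p4 (R : realType) (V : completeNormedModType R)
    (sepV : separable V) (VV : proj_tensor V)
    (T alpha : R) (T_gt0 : 0 < T) (alpha_gt : 3^-1 < alpha)
    (alpha_le : alpha <= 2^-1)
    (beta : 'I_3 -> R) (beta_ge0 : forall k, 0 <= beta k)
    (f : V -> V -> V) (f_C : C_loc 3 beta f)
    (X : R -> V) (XX : R -> R -> VV) (X_rough : rough_path alpha T X XX) :
  let W := W_of f X in
  let WW := WW_of f X XX in
  (* the integrals defining WW exist *)
  (forall s t x y, 0 <= s -> s <= t -> t <= T ->
     integral_exists (WW_rough_germ f X XX x y) s t /\
     integral_exists (WW_young_germ f X XX x y) s t) /\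
  nonlinear_rough_path alpha T beta W WW /\
  (forall Y Yd : R -> V, nl_controlled alpha T W Y Yd ->
     let Y' := fun t => D1 f (X t) (Yd t) in
     let H := fun t => D1 f (X t) (Y t) in
     let H' := fun t =>
       D1 (D1 f) (X t) (Y t) + oper_comp (D2 (D1 f) (X t) (Y t)) (Y' t) in
     let A := fun t => D1 (D1 f) (X t) (Y t) in
     controlled alpha T X Y Y' /\
     (forall s t, 0 <= s -> s <= t -> t <= T ->
        [/\ integral_exists (nl_germ W WW Y Yd) s t,
            integral_exists (rough_germ X XX H H') s t,
            integral_exists (young_germ X XX A) s t
          & germ_integral (nl_germ W WW Y Yd) s t
            = germ_integral (rough_germ X XX H H') s t
              + 2^-1 *: germ_integral (young_germ X XX A) s t])).
Proof.
have T0 : 0 <= T by exact: ltW.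
have a0 : 0 < alpha by apply: lt_trans alpha_gt; rewrite invr_gt0.
have [N XN] := rough_path_bound X_rough.
have [N0 X1] : 0 <= N /\ time_le T alpha N (fun s t => X t - X s) by case: XN.
have hull0 : path_hull T X !=set0.
  by exists (X 0); apply: path_hull_path; rewrite lexx T0.
have [C C0 fC] := C_loc_bound f_C (path_hull_compact T0 a0 N0 X1) hull0.
move=> W WW; split=> [s t x y s0 st tT|].
  have [l lS] := WW_rough_sews T0 alpha_gt XN f_C C0 fC x y s0 st tT.
  have [m mS] := WW_young_sews T0 alpha_gt XN f_C C0 fC x y s0 st tT.
  by have [? _] := sews_germ_integral st lS; have [? _] := sews_germ_integral st mS.
split=> [|Y Yd YYd]; first exact: (WW_nonlinear_rough_path T0 alpha_gt XN f_C C0 fC).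
have [M [r [M0 YM YdM YYdM YYdr]]] := nl_controlled_bound T0 (ltW a0) YYd.
have Yr s sT := (YYdr s sT).1; have Ydr s sT := (YYdr s sT).2.
split; first exact: (Y_controlled T0 alpha_gt XN f_C beta_ge0 C0 fC M0 YM YdM YYdM Yr Ydr).
move=> s t s0 st tT.
exact: (nl_integral_formula T0 alpha_gt XN f_C beta_ge0 C0 fC M0 YM YdM YYdM Yr Ydr s0 st tT).
Qed.
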